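(* For a twisted link diagram $D$, let $\widetilde{Z}_D(x,y)=\det(\widetilde{M}-\widetilde{P})$, where $\widetilde M=\widetilde M(D)$ and $\widetilde P=\widetilde P(D)$ are the $4n\times 4n$ matrices associated with $D$ ($n$ being the number of real crossings of $D$). Then $\widetilde Z_D(x,y)$ is an invariant of the twisted link up to multiplication by powers of $x^{\pm1}$; that is, for any twisted link diagram $D'$ representing the same twisted link as $D$, $$\widetilde{Z}_{D'}(x,y)=x^{m}\,\widetilde{Z}_{D}(x,y)\quad\text{for some } m\in\mathbb{Z}.$$
   Context: **Diagrams.** A virtual link diagram is a generic immersion of finitely many oriented circles in $\mathbb{R}^2$, each double point of which is either a real crossing (with over/under information, hence positive or negative in the usual sense) or a virtual crossing (an encircled double point with no over/under information). A twisted link diagram is a virtual link diagram possibly with bars on arcs; a bar is a short transverse mark on an arc, away from the double points. **Moves.** All moves are allowed with every orientation of the strands. - Reidemeister moves I, II, III: the classical ones, on real crossings. - Virtual Reidemeister moves. I, II, III: the same local pictures with all crossings virtual. IV: a strand meeting two other strands only in virtual crossings is moved across a real crossing between those two strands. - Twisted Reidemeister moves. I: a bar on a strand slides along it through a virtual crossing. II: two consecutive bars on the same arc are removed or inserted. III: a real crossing with one bar on each of its four legs is exchanged with the following barless tangle having the same four end points NW, NE, SW, SE. Keep the same real crossing in the centre, without bars. On the left, cross its two left legs with each other in a virtual crossing before they reach the end points NW and SW. On the right, cross its two right legs with each other in a virtual crossing before they reach NE and SE. Each end point is then joined to the same opposite end point as before, the sign of the crossing is unchanged, and the over and under strands are exchanged.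 A twisted link is an equivalence class of twisted link diagrams under (planar isotopy and) all these moves. **The matrix $\widetilde M$.** Let $D$ be a twisted link diagram with real crossings $c_1,\dots,c_n$. Put $$M_+=\begin{pmatrix}1-x&-y\\-xy^{-1}&0\end{pmatrix},\qquad M_-=\begin{pmatrix}0&-x^{-1}y\\-y^{-1}&1-x^{-1}\end{pmatrix},$$ $\widetilde M_\pm=\mathrm{diag}(M_\pm,M_\pm)$ (block diagonal, $4\times4$). Let $\widetilde M=\mathrm{diag}(\widetilde M_1,\dots,\widetilde M_n)$, where $\widetilde M_i=\widetilde M_+$ if $c_i$ is positive and $\widetilde M_i=\widetilde M_-$ if $c_i$ is negative. **The graph $|D|$ and the labels.** $|D|$ is the 4-valent graph, immersed in the plane, obtained from $D$ by regarding each real crossing as a vertex; the multiple points of the immersion are the virtual crossings of $D$, and edges may carry bars. Near the vertex $c_i$ there are four short edges (the components of a small neighbourhood of $c_i$ in $|D|$ with $c_i$ removed). Draw the crossing so that both strands are directed upwards. Then $i_0^-$ and $i_1^-$ are the left and right incoming (bottom) short edges, and $i_0^+$ and $i_1^+$ are the left and right outgoing (top) short edges. **The matrix $\widetilde P$.** For $\epsilon,\lambda\in\{0,1\}$ write $i_\epsilon\overset{\mathrm e}{\leftarrow}j_\lambda$ (resp. $i_\epsilon\overset{\mathrm o}{\leftarrow}j_\lambda$) if the short edges $i_\epsilon^-$ and $j_\lambda^+$ lie on the same edge of $|D|$ and that edge carries an even (resp. odd) number of bars. If $k$ or $l$ is in $\{2,3\}$, the relations $i_k\overset{\mathrm e}{\leftarrow}j_l$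 and $i_k\overset{\mathrm o}{\leftarrow}j_l$ are declared false. The $4n\times4n$ matrix $\widetilde P=(\tilde p_{kl})$ is given, for $i,j\in\{1,\dots,n\}$ and $a,b\in\{0,1,2,3\}$, by $$\tilde p_{(4i-3+a)(4j-3+b)}=\begin{cases}1&\text{if } i_a\overset{\mathrm e}{\leftarrow}j_b\ \text{or}\ i_{3-a}\overset{\mathrm e}{\leftarrow}j_{3-b}\ \text{or}\ i_a\overset{\mathrm o}{\leftarrow}j_{3-b}\ \text{or}\ i_{3-a}\overset{\mathrm o}{\leftarrow}j_b,\\0&\text{otherwise.}\end{cases}$$
   Formalization: D and D' are assumed to have a real crossing on every component, so that |D| is truly a 4-valent graph; without this the claim fails: the crossingless circle has determinant 1, the circle with one real curl has determinant 0. *)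

(* Defs.v *)
(* Twisted link diagrams in the plane, their moves, and the polynomial
   det (M~ - P~).  MathComp / MathComp-Analysis, over an arbitrary realType. *)
From HB Require Import structures.
From mathcomp Require Import all_boot all_order all_algebra.
From mathcomp Require Import fingroup perm.
From mathcomp Require Import all_classical all_reals all_analysis.
Import Order.TTheory GRing.Theory Num.Theory numFieldNormedType.Exports.

Set Implicit Arguments.
Unset Strict Implicit.
Unset Printing Implicit Defensive.

Local Open Scope ring_scope.

Section Diagrams.
Variable R : realType.

Definition plane : Type := (R^o * R^o)%type.

Definition det2 (v w : plane) : R := v.1 * w.2 - v.2 * w.1.

(* The source of a diagram is a disjoint union of m circles R/Z; the point
   (c, t) with 0 <= t < 1 is the class of t on the circle number c. *)
Definition cpoint (m : nat) : Type := ('I_m * R)%type.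

Definition on_circle m (p : cpoint m) : bool := 0 <= p.2 < 1.

Definition C1 (V : normedModType R) (f : R -> V) : Prop :=
  (forall t, derivable f t 1) /\ continuous (derive1 f).

(* A crossing is listed as the pair of its two preimages; for a real crossing
   the first one lies on the over strand, and the order of the list is the
   numbering c_1, ..., c_n. Uniqueness of the marked points says that there are
   no triple points, that bars avoid the double points and that nothing is
   listed twice. *)
Record diagram (m : nat) := Diagram {
  curve : 'I_m -> R -> plane;
  real_crossings : seq (cpoint m * cpoint m);
  virtual_crossings : seq (cpoint m * cpoint m);
  bars : seq (cpoint m);
  crossings := real_crossings ++ virtual_crossings;
  marked := flatten [seq [:: z.1; z.2] | z <- crossings] ++ bars;
  curve_periodic : forall c t, curve c (t + 1) = curve c t;
  curve_C1 : forall c, C1 (curve c);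
  curve_immersed : forall c t, derive1 (curve c) t != 0;
  marked_on_circle : all (@on_circle m) marked;
  marked_uniq : uniq marked;
  double_points : forall p q : cpoint m, on_circle p -> on_circle q -> p != q ->
    (curve p.1 p.2 = curve q.1 q.2 <->
     (p, q) \in crossings \/ (q, p) \in crossings);
  crossings_transverse : forall z, z \in crossings ->
    det2 (derive1 (curve z.1.1) z.1.2) (derive1 (curve z.2.1) z.2.2) != 0
}.

Definition at_point m (D : diagram m) (p : cpoint m) : plane := curve D p.1 p.2.

Definition velocity m (D : diagram m) (p : cpoint m) : plane :=
  derive1 (curve D p.1) p.2.

Definition real_points m (D : diagram m) : seq (cpoint m) :=
  flatten [seq [:: z.1; z.2] | z <- real_crossings D].

(* Time runs over the whole line: an isotopy parametrized by [0, 1] is extended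
   by constants. *)
Definition ambient_isotopy (H : R -> plane -> plane) : Prop :=
  [/\ forall v, H 0 v = v,
      forall s, bijective (H s),
      continuous (fun z : R * plane => H z.1 z.2),
      forall s v, differentiable (H s) v &
      forall e : plane, continuous (fun z : R * plane => 'D_e (H z.1) z.2)] /\
  forall s v, det2 ('D_(1, 0) (H s) v) ('D_(0, 1) (H s) v) != 0.

(* Lift to R of an orientation preserving C^1 diffeomorphism of R/Z. *)
Definition circle_diffeo (h : R -> R) : Prop :=
  [/\ forall t, h (t + 1) = h t + 1,
      C1 (h : R -> R^o) &
      forall t, 0 < derive1 (h : R -> R^o) t].

Definition frac_part (t : R) : R := t - (Num.floor t)%:~R.

Definition reparam m (sigma : 'S_m) (h : 'I_m -> R -> R) (p : cpoint m) :
  cpoint m := (sigma p.1, frac_part (h p.1 p.2)).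

(* Planar isotopy, up to reparametrization of the circles and renumbering of
   the circles and of the crossings. The virtual crossings are the double
   points which are not real, hence need not be compared, here or below. *)
Definition planar_isotopic m (D D' : diagram m) : Prop :=
  exists (H : R -> plane -> plane) (sigma : 'S_m) (h : 'I_m -> R -> R),
  [/\ ambient_isotopy H,
      forall c, circle_diffeo (h c),
      forall c t, curve D' (sigma c) (h c t) = H 1 (curve D c t),
      perm_eq (real_crossings D')
        [seq (reparam sigma h z.1, reparam sigma h z.2)
           | z <- real_crossings D] &
      perm_eq (bars D') [seq reparam sigma h p | p <- bars D]].

(* A local picture in the square [-1, 1]^2: k strands, each defined for
   parameters in [-1, 1], with their real crossings (over point first) and
   bars; all other crossings of the strands are virtual. *)
Record picture (k : nat) := Picture {
  strands : k.-tuple (R -> plane);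
  pic_real : seq (cpoint k * cpoint k);
  pic_bars : seq (cpoint k)
}.

Definition on_strand k (z : cpoint k) : Prop := -1 <= z.2 <= 1.

Definition in_square (v : plane) : Prop := -1 <= v.1 <= 1 /\ -1 <= v.2 <= 1.

(* Strand j of a picture is run through by the circle [pl_circle j], at time
   [pl_center j + pl_speed j * u] for the parameter u; a negative speed means
   that the diagram runs through the strand backwards. *)
Record placement (m k : nat) := Placement {
  pl_circle : 'I_k -> 'I_m;
  pl_center : 'I_k -> R;
  pl_speed : 'I_k -> R
}.

Definition place m k (pl : placement m k) (z : cpoint k) : cpoint m :=
  (pl_circle pl z.1, pl_center pl z.1 + pl_speed pl z.1 * z.2).

(* No strand contains the base point 0 of a circle; base points can be moved by
   a reparametrization. *)
Definition placement_ok m k (pl : placement m k) : Prop :=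
  (forall j, pl_speed pl j != 0 /\
     0 < pl_center pl j - `|pl_speed pl j| /\
     pl_center pl j + `|pl_speed pl j| < 1) /\
  (forall z z', on_strand z -> on_strand z' -> place pl z = place pl z' ->
     z = z').

Definition covered m k (pl : placement m k) (p : cpoint m) : Prop :=
  exists2 z, on_strand z & p = place pl z.

(* Inside the square, D is exactly the picture P; rc and bs are its real
   crossings and bars outside of the square. *)
Definition shows m k (D : diagram m) (pl : placement m k) (P : picture k)
    (rc : seq (cpoint m * cpoint m)) (bs : seq (cpoint m)) : Prop :=
  [/\ forall z, on_strand z ->
        at_point D (place pl z) = tnth (strands P) z.1 z.2,
      forall p, on_circle p -> in_square (at_point D p) -> covered pl p,
      perm_eq (real_crossings D)
        ([seq (place pl z.1, place pl z.2) | z <- pic_real P] ++ rc) &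
      perm_eq (bars D) ([seq place pl z | z <- pic_bars P] ++ bs)].

(* D' is obtained from D by replacing P with P' in the square. *)
Definition replaces k (P P' : picture k) m (D D' : diagram m) : Prop :=
  exists (pl : placement m k) (rc : seq (cpoint m * cpoint m))
         (bs : seq (cpoint m)),
  [/\ placement_ok pl,
      shows D pl P rc bs,
      shows D' pl P' rc bs,
      (forall z, z \in rc -> ~ covered pl z.1 /\ ~ covered pl z.2) /\
      (forall p, p \in bs -> ~ covered pl p) &
      forall p, on_circle p -> ~ covered pl p -> at_point D' p = at_point D p].

(* The two pictures of a move have the same end points and the same velocities
   there. [hump] and its derivative vanish at -1 and 1, and hump (+-1/2) = 9/16;
   [wiggle] has zeros -1/2, 0, 1/2 in [-1, 1] and is tangent to the identity at
   -1 and 1. *)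
Definition hump (u : R) : R := (1 - u ^+ 2) ^+ 2.
Definition wiggle (u : R) : R := u * (1 - 16 / 9 * hump u).

Definition graph_of (f : R -> R) : R -> plane := fun u => (u, f u).

Definition onehalf : R := 1 / 2.

Definition s1_0 : 'I_1 := @Ordinal 1 0 isT.
Definition s2_0 : 'I_2 := @Ordinal 2 0 isT.
Definition s2_1 : 'I_2 := @Ordinal 2 1 isT.
Definition s3_0 : 'I_3 := @Ordinal 3 0 isT.
Definition s3_1 : 'I_3 := @Ordinal 3 1 isT.
Definition s3_2 : 'I_3 := @Ordinal 3 2 isT.

Definition line_strand : 1.-tuple (R -> plane) := [tuple graph_of (fun=> 0)].

(* A curl, crossing itself at the parameters -1/2 and 1/2. Together with the
   two directions and the two choices of the over strand this gives the four
   curls. *)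
Definition kink_strand : 1.-tuple (R -> plane) :=
  [tuple fun u => (wiggle u, onehalf * hump u) : plane].

Definition parallel_strands : 2.-tuple (R -> plane) :=
  [tuple graph_of (fun=> - onehalf); graph_of (fun=> onehalf)].

(* The strands cross at the parameters -1/2 and 1/2 of both. *)
Definition bigon_strands : 2.-tuple (R -> plane) :=
  [tuple graph_of (fun u => - onehalf + 8 / 9 * hump u);
         graph_of (fun u => onehalf - 8 / 9 * hump u)].

Definition cross_strands : 2.-tuple (R -> plane) :=
  [tuple graph_of (fun u => u); graph_of (fun u => - u)].

(* Crossings at the parameters -1/2, 0, 1/2; at 0 the two strands have traded
   their slopes with respect to [cross_strands]. *)
Definition twisted_strands : 2.-tuple (R -> plane) :=
  [tuple graph_of wiggle; graph_of (fun u => - wiggle u)].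

(* Two diagonals and an arc above (s = 1) or below (s = -1) their crossing: the
   diagonals cross at 0, the arc crosses strand 0 at s/2 and strand 1 at -s/2,
   these being the parameters on both strands. *)
Definition triangle_strands (s : R) : 3.-tuple (R -> plane) :=
  [tuple graph_of (fun u => u); graph_of (fun u => - u);
         graph_of (fun u => s * (8 / 9) * hump u)].

Definition crossing_of k (p q : cpoint k) (p_over : bool) :
  cpoint k * cpoint k :=
  if p_over then (p, q) else (q, p).

Definition diagonal_crossing (b : bool) : cpoint 2 * cpoint 2 :=
  crossing_of (s2_0, 0) (s2_1, 0) b.

Definition bigon_crossings (b : bool) : seq (cpoint 2 * cpoint 2) :=
  [:: crossing_of (s2_0, - onehalf) (s2_1, - onehalf) b;
      crossing_of (s2_0, onehalf) (s2_1, onehalf) b].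

(* Strand j has height [ht j]. *)
Definition triangle_crossings (ht : 'S_3) (s : R) : seq (cpoint 3 * cpoint 3) :=
  [:: crossing_of (s3_0, 0) (s3_1, 0) (ht s3_1 < ht s3_0)%N;
      crossing_of (s3_0, s * onehalf) (s3_2, s * onehalf) (ht s3_2 < ht s3_0)%N;
      crossing_of (s3_1, - (s * onehalf)) (s3_2, - (s * onehalf))
        (ht s3_2 < ht s3_1)%N].

(* Orientations of the strands, and the remaining versions of the pictures, come
   from the signs of the speeds of a placement, from planar isotopy (rotations)
   and from inverse moves. *)
Inductive move_pictures : forall k, picture k -> picture k -> Prop :=
| reidemeister1 (b : bool) : move_pictures
    (Picture line_strand [::] [::])
    (Picture kink_strand
       [:: crossing_of (s1_0, - onehalf) (s1_0, onehalf) b] [::])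
| reidemeister2 (b : bool) : move_pictures
    (Picture parallel_strands [::] [::])
    (Picture bigon_strands (bigon_crossings b) [::])
| reidemeister3 (ht : 'S_3) : move_pictures
    (Picture (triangle_strands 1) (triangle_crossings ht 1) [::])
    (Picture (triangle_strands (-1)) (triangle_crossings ht (-1)) [::])
| virtual1 : move_pictures
    (Picture line_strand [::] [::])
    (Picture kink_strand [::] [::])
| virtual2 : move_pictures
    (Picture parallel_strands [::] [::])
    (Picture bigon_strands [::] [::])
| virtual3 : move_pictures
    (Picture (triangle_strands 1) [::] [::])
    (Picture (triangle_strands (-1)) [::] [::])
| virtual4 (b : bool) : move_pictures
    (Picture (triangle_strands 1)
       [:: crossing_of (s3_0, 0) (s3_1, 0) b] [::])
    (Picture (triangle_strands (-1))
       [:: crossing_of (s3_0, 0) (s3_1, 0) b] [::])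
| twisted1 : move_pictures
    (Picture cross_strands [::] [:: (s2_0, - onehalf)])
    (Picture cross_strands [::] [:: (s2_0, onehalf)])
| twisted2 : move_pictures
    (Picture line_strand [::] [:: (s1_0, - onehalf); (s1_0, onehalf)])
    (Picture line_strand [::] [::])
| twisted3 (b : bool) : move_pictures
    (Picture cross_strands [:: diagonal_crossing b]
       [:: (s2_0, - onehalf); (s2_0, onehalf);
           (s2_1, - onehalf); (s2_1, onehalf)])
    (Picture twisted_strands [:: diagonal_crossing (~~ b)] [::]).

(* No move changes the number of components, so that m can be fixed. *)
Inductive twisted_equiv m : diagram m -> diagram m -> Prop :=
| equiv_isotopy D D' : planar_isotopic D D' -> twisted_equiv D D'
| equiv_move k (P P' : picture k) D D' :
    move_pictures P P' -> replaces P P' D D' -> twisted_equiv D D'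
| equiv_refl D : twisted_equiv D D
| equiv_sym D D' : twisted_equiv D D' -> twisted_equiv D' D
| equiv_trans D D' D'' :
    twisted_equiv D D' -> twisted_equiv D' D'' -> twisted_equiv D D''.

End Diagrams.

(* The field of fractions of Z[x][y]. *)
Definition ratfun : fieldType := {fraction {poly {poly int}}}.
Definition xvar : ratfun := tofrac (('X : {poly int})%:P).
Definition yvar : ratfun := tofrac ('X : {poly {poly int}}).

Section Matrices.
Variables (R : realType) (m : nat) (D : diagram R m).

Local Notation n := (size (real_crossings D)).

Definition nth_crossing (i : 'I_n) : cpoint R m * cpoint R m :=
  tnth (in_tuple (real_crossings D)) i.

(* det2 (over velocity) (under velocity) > 0 means that the under strand crosses
   the over strand from right to left. *)
Definition positive_crossing (z : cpoint R m * cpoint R m) : bool :=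
  0 < det2 (velocity D z.1) (velocity D z.2).

(* With both strands directed upwards, the over strand comes from the left at a
   positive crossing and from the right at a negative one. *)
Definition from_left (z : cpoint R m * cpoint R m) : cpoint R m :=
  if positive_crossing z then z.1 else z.2.
Definition from_right (z : cpoint R m * cpoint R m) : cpoint R m :=
  if positive_crossing z then z.2 else z.1.

(* The passage of the crossing i whose incoming (resp. outgoing) short edge is
   the left one, for e = 0, or the right one, for e = 1; the strand which comes
   from the left leaves to the right. *)
Definition incoming (i : 'I_n) (e : nat) : cpoint R m :=
  if e == 0%N then from_left (nth_crossing i) else from_right (nth_crossing i).
Definition outgoing (i : 'I_n) (e : nat) : cpoint R m :=
  if e == 0%N then from_right (nth_crossing i) else from_left (nth_crossing i).

(* r is met strictly between p and q when running forward from p to q on their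
   circle; if p = q, the whole circle is run through. *)
Definition between (p q r : cpoint R m) : bool :=
  (r.1 == p.1) &&
  (if p.2 < q.2 then p.2 < r.2 < q.2 else (p.2 < r.2) || (r.2 < q.2)).

(* For passages p and q of real crossings: the edge leaving p is the edge
   arriving at q. *)
Definition is_edge (p q : cpoint R m) : bool :=
  (p.1 == q.1) && ~~ has (between p q) (real_points D).

Definition edge_bars (p q : cpoint R m) : nat := count (between p q) (bars D).

Definition even_arrow (i : 'I_n) (e : nat) (j : 'I_n) (l : nat) : bool :=
  [&& (e < 2)%N, (l < 2)%N, is_edge (outgoing j l) (incoming i e) &
      ~~ odd (edge_bars (outgoing j l) (incoming i e))].
Definition odd_arrow (i : 'I_n) (e : nat) (j : 'I_n) (l : nat) : bool :=
  [&& (e < 2)%N, (l < 2)%N, is_edge (outgoing j l) (incoming i e) &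
      odd (edge_bars (outgoing j l) (incoming i e))].

Lemma block_subproof (k : 'I_(4 * n)) : (k %/ 4 < n)%N.
Proof. by rewrite ltn_divLR // [(_ * 4)%N]mulnC. Qed.

(* The row or column 4 i + a (counting from 0) is in the block i, with
   offset a. *)
Definition block (k : 'I_(4 * n)) : 'I_n := Ordinal (block_subproof k).
Definition offset (k : 'I_(4 * n)) : 'I_(2 + 2) :=
  Ordinal (ltn_pmod k (isT : (0 < 4)%N)).

Definition mx2 (a b c d : ratfun) : 'M[ratfun]_2 :=
  \matrix_(i, j) if i == 0 then (if j == 0 then a else b)
                 else (if j == 0 then c else d).

Definition Mpos : 'M[ratfun]_2 :=
  mx2 (1 - xvar) (- yvar) (- (xvar * yvar^-1)) 0.
Definition Mneg : 'M[ratfun]_2 :=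
  mx2 0 (- (xvar^-1 * yvar)) (- yvar^-1) (1 - xvar^-1).

Definition Mcrossing (i : 'I_n) : 'M[ratfun]_(2 + 2) :=
  let M := if positive_crossing (nth_crossing i) then Mpos else Mneg in
  block_mx M 0 0 M.

Definition Mtilde : 'M[ratfun]_(4 * n) :=
  \matrix_(k, l) if block k == block l
                 then Mcrossing (block k) (offset k) (offset l) else 0.

Definition Ptilde : 'M[ratfun]_(4 * n) :=
  \matrix_(k, l)
    let i := block k in let a : nat := offset k in
    let j := block l in let b : nat := offset l in
    if [|| even_arrow i a j b, even_arrow i (3 - a) j (3 - b),
           odd_arrow i a j (3 - b) | odd_arrow i (3 - a) j b]
    then 1 else 0.

Definition Ztilde : ratfun := \det (Mtilde - Ptilde).

(* Every component passes through a real crossing. Otherwise regarding the real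
   crossings as vertices does not give a 4-valent graph, but leaves circles
   without vertices, which no entry of the matrices sees. *)
Definition four_valent : Prop :=
  forall c : 'I_m, exists2 p, p \in real_points D & p.1 = c.

End Matrices.

(* Main.v *)
(* The rows of M~ - P~ are indexed by the incoming and its columns by the outgoing
   short edges; identify both with the passages through the real crossings, each
   of which occurs on two sheets. An edge with an odd number of bars changes the
   sheet, and the two sheets of a crossing differ by an exchange of the over and
   the under strand. So, up to an even permutation of the columns, the polynomial
   is the determinant of (weights of the crossings) - (adjacency of the passages).

   Passages of degree two, of weight 1, can be inserted on the edges without
   changing this determinant. For a Reidemeister move insert them at the ends of
   the strands of the picture and eliminate the passages inside of it. The Schur
   complement only depends on the transfer matrix of the picture: the values
   leaving the strands as functions of the values entering them. Both pictures of
   a move have the same transfer matrix, and the determinants of the eliminated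
   blocks, which are triangular, are powers of x. Sliding or cancelling bars does
   not change the parities, and bars on the four legs of a crossing exchange its
   two sheets, that is its over and under strands. An isotopy preserves the cyclic
   orders of the passages, and the signs of the crossings because its Jacobian
   determinant is positive at time 0 and never vanishes. *)

(* The eliminated block is never inverted. A solution of the equations inside a picture, with one
   value per edge and 1 entering at a single strand, directly gives the column operations that clear
   the column of that entry, and its outgoing values are a row of the transfer matrix. So a picture
   is settled by exhibiting solutions. They are found strand by strand from the bottom up, because
   the equation at an under passage does not involve the over strand.

   The weights enter through two identities: over weight times under weight is x or x^-1 according
   to the sign, and the side weight is 1 minus this product. In the second move the two factors
   cancel; in the third the signs are the same in both pictures. In the first the sheets differ:
   where the upper passage of the curl comes first, the block is not triangular and has determinant
   1; on the other sheet the determinant is x or x^-1. This is the only source of the power of x.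

   All computations are done for a sheet b in terms of upper and lower passages, so that one
   computation serves both sheets. *)
From mathcomp Require Import all_boot all_order all_algebra fingroup perm.
From mathcomp Require Import all_classical all_reals all_analysis.
From mathcomp Require Import lra ring zify.
Require Import Defs.
Import Order.TTheory GRing.Theory Num.Theory numFieldNormedType.Exports.

Set Implicit Arguments.
Unset Strict Implicit.
Unset Printing Implicit Defensive.

Local Open Scope ring_scope.

(** * Determinants indexed by sequences *)

Section SeqDeterminant.
Variable F : comNzRingType.

(** Rows and columns share one list of labels, so that passages index the matrix directly and only
    the list up to permutation matters ([seq_det_perm]). *)
Definition seq_det (I : Type) (s : seq I) (A : I -> I -> F) : F :=
  \det (\matrix_(i < size s, j < size s)
     A (tnth (in_tuple s) i) (tnth (in_tuple s) j)).

Lemma seq_det_tuple (I : Type) n (t : n.-tuple I) (A : I -> I -> F) :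
  seq_det t A = \det (\matrix_(i < n, j < n) A (tnth t i) (tnth t j)).
Proof.
case: t => s st /=; move: (st); rewrite -(eqP st) => {}st.
congr (\det _); apply/matrixP => i j; rewrite !mxE.
by have x0 := tnth (in_tuple s) i; rewrite !(tnth_nth x0).
Qed.

Lemma eq_seq_det (I : eqType) (s : seq I) (A A' : I -> I -> F) :
  {in s &, A =2 A'} -> seq_det s A = seq_det s A'.
Proof.
move=> eqA; congr (\det _); apply/matrixP => i j; rewrite !mxE.
by apply: eqA; apply: mem_tnth.
Qed.

Lemma seq_det_map (I J : Type) (f : I -> J) (s : seq I) (A : J -> J -> F) :
  seq_det (map f s) A = seq_det s (fun i j => A (f i) (f j)).
Proof.
rewrite (seq_det_tuple (map_tuple f (in_tuple s))).
by congr (\det _); apply/matrixP => i j; rewrite !mxE !tnth_map.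
Qed.

(** The same permutation acts on rows and columns, so its sign occurs twice. *)
Lemma seq_det_perm (I : eqType) (s t : seq I) (A : I -> I -> F) :
  perm_eq s t -> seq_det s A = seq_det t A.
Proof.
move=> st; have szE := perm_size st.
have [p sE] : exists p : 'S_(size t), s = [tuple tnth (in_tuple t) (p i) | i < size t].
  by apply/tuple_permP.
rewrite sE seq_det_tuple.
set M := (\matrix_(i, j) _).
have -> : M = row_perm p (col_perm p
   (\matrix_(i < size t, j < size t)
     A (tnth (in_tuple t) i) (tnth (in_tuple t) j))).
  by apply/matrixP => i j; rewrite !mxE !tnth_mktuple.
rewrite row_permE col_permE !det_mulmx !det_perm odd_permV mulrCA.
by rewrite -signr_addb addbb expr0 mulr1.
Qed.

(* Column operations: the columns of s2 are cleared against those of s1, X being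
   the coefficients. *)
Lemma seq_det_cat (I : eqType) (s1 s2 : seq I) (A X : I -> I -> F) :
  {in s1 & s2, forall i c, A i c = \sum_(k <- s1) A i k * X k c} ->
  seq_det (s1 ++ s2) A = seq_det s1 A *
    seq_det s2 (fun r c => A r c - \sum_(k <- s1) A r k * X k c).
Proof.
move=> AX; rewrite (seq_det_tuple (cat_tuple (in_tuple s1) (in_tuple s2))).
set M := (\matrix_(i, j) _).
pose t1 := in_tuple s1; pose t2 := in_tuple s2.
pose Xm := \matrix_(i < size s1, j < size s2) X (tnth t1 i) (tnth t2 j).
have E : M *m block_mx 1%:M (- Xm) 0 1%:M =
  block_mx (\matrix_(i, j) A (tnth t1 i) (tnth t1 j)) 0
   (\matrix_(i, j) A (tnth t2 i) (tnth t1 j))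
   (\matrix_(i, j) (A (tnth t2 i) (tnth t2 j)
      - \sum_(k <- s1) A (tnth t2 i) k * X k (tnth t2 j))).
  rewrite -[M]submxK mulmx_block !mulmx1 !mulmx0 !addr0 !mulmxN.
  have big k c : \sum_(k0 <- s1) A k k0 * X k0 c =
      \sum_(j < size s1) A k (tnth t1 j) * X (tnth t1 j) c.
    by rewrite big_tnth.
  have e1 (j : 'I_(size s1)) : tnth (cat_tuple t1 t2) (lshift _ j) = tnth t1 j.
    by rewrite tnth_lshift.
  have e2 (j : 'I_(size s2)) : tnth (cat_tuple t1 t2) (rshift _ j) = tnth t2 j.
    by rewrite tnth_rshift.
  congr block_mx; apply/matrixP => i j; rewrite !mxE.
  - by rewrite !e1.
  - rewrite e1 e2 AX ?mem_tnth // big addrC.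
    by apply/eqP; rewrite subr_eq0; apply/eqP/eq_bigr => k _; rewrite !mxE !e1.
  - by rewrite e1 e2.
  - rewrite !e2 big addrC; congr (_ - _).
    by apply/eq_bigr => k _; rewrite !mxE !e2 !e1.
have := congr1 (fun N => \det N) E.
by rewrite det_mulmx det_ublock !det1 !mulr1 det_lblock.
Qed.

Lemma seq_det_trig (I : eqType) (s : seq I) (A : I -> I -> F) :
  pairwise (fun i j => A i j == 0) s -> seq_det s A = \prod_(i <- s) A i i.
Proof.
elim: s => [|i s IHs] /=; first by rewrite /seq_det det_mx00 big_nil.
case/andP => /allP Ai /IHs {}IHs; rewrite -cat1s (seq_det_cat (X := fun _ _ => 0)).
  rewrite cat1s big_cons -IHs; congr (_ * _).
    by rewrite /seq_det /= det_mx11 mxE.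
  by apply: eq_seq_det => r c _ _; rewrite big1 ?subr0 // => k _; rewrite mulr0.
move=> _ j /[1!inE] /eqP -> js; rewrite (eqP (Ai j js)).
by rewrite big1 // => k _; rewrite mulr0.
Qed.

End SeqDeterminant.

(** * Cyclic order and edges *)

Section CyclicOrder.
Variables (R : realType) (m : nat).
Implicit Types (p q r t : cpoint R m) (s B : seq (cpoint R m)).

Definition cyclic (a b c : R) : bool :=
  if a < b then a < c < b else (a < c) || (c < b).

Lemma betweenE p q r : between p q r = (r.1 == p.1) && cyclic p.2 q.2 r.2.
Proof. by []. Qed.

(** The point b has to be excluded: it lies inside the arc from a to c but in neither half. *)
Lemma cyclic_split (a b c t : R) : cyclic a c b -> t != b ->
  (cyclic a c t = cyclic a b t + cyclic b c t :> nat)%N.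
Proof.
rewrite /cyclic; case: (ltrgtP a b) => ab //; case: (ltrgtP b c) => bc //;
 case: (ltrgtP a c) => ac //; case: (ltrgtP a t) => at_ //;
 case: (ltrgtP t b) => bt //; case: (ltrgtP t c) => ct //=; exfalso; lra.
Qed.

Lemma cyclic_before (a b c : R) : a != b -> cyclic a c b || cyclic b c a.
Proof.
rewrite /cyclic; case: (ltrgtP a b) => ab //; case: (ltrgtP b c) => bc //;
 case: (ltrgtP a c) => ac //=; exfalso; lra.
Qed.

Lemma cyclic_after (a b c : R) : b != c -> cyclic a b c || cyclic a c b.
Proof.
rewrite /cyclic; case: (ltrgtP a b) => ab //; case: (ltrgtP b c) => bc //;
 case: (ltrgtP a c) => ac //=; exfalso; lra.
Qed.

Lemma cyclic_endpoints (a b : R) : cyclic a b a = false /\ cyclic a b b = false.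
Proof. by rewrite /cyclic !ltxx; case: ltP; rewrite ?andbF. Qed.

Lemma pair_neq p q : p.1 = q.1 -> (p != q) = (p.2 != q.2).
Proof. by case: p q => [c u] [d v] /= ->; rewrite xpair_eqE eqxx. Qed.

Lemma between_split p q r t : p.1 = r.1 -> between p r q -> t != q ->
  (between p r t = between p q t + between q r t :> nat)%N.
Proof.
rewrite !betweenE => pr /andP[/eqP qp qpr]; rewrite qp.
case: (t.1 =P p.1) => //= tp tq; apply: cyclic_split => //.
by rewrite -pair_neq // tp qp.
Qed.

Lemma between_before p q r : p.1 = q.1 -> p != q -> between p r q || between q r p.
Proof.
by move=> pq; rewrite pair_neq // !betweenE pq eqxx /=; apply: cyclic_before.
Qed.

Lemma between_after p q r : p.1 = q.1 -> q.1 = r.1 -> q != r ->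
  between p q r || between p r q.
Proof.
move=> pq qr; rewrite pair_neq // !betweenE pq qr eqxx /=; exact: cyclic_after.
Qed.

Lemma betweenl p q : between p q p = false.
Proof. by rewrite betweenE (cyclic_endpoints p.2 q.2).1 andbF. Qed.

Lemma betweenr p q : between p q q = false.
Proof. by rewrite betweenE (cyclic_endpoints p.2 q.2).2 andbF. Qed.

(** [is_edge] with the list of passages as a parameter, so that passages can be inserted and
    removed. *)
Definition edge s p q : bool := (p.1 == q.1) && ~~ has (between p q) s.

(** Of two distinct points on the circle of q, one is met on the way from the other to q, so the
    other cannot start an edge ending at q. *)
Lemma edge_before s p p' q : p \in s -> p' \in s ->
  edge s p q -> edge s p' q -> p = p'.
Proof.
move=> ps p's /andP[/eqP pq nb] /andP[/eqP p'q nb']; apply/eqP.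
case: eqP => // /eqP neq; have := between_before q (etrans pq (esym p'q)) neq.
by case/orP => b; [case/hasP: nb; exists p' | case/hasP: nb'; exists p].
Qed.

Lemma edge_after s p q q' : q \in s -> q' \in s ->
  edge s p q -> edge s p q' -> q = q'.
Proof.
move=> qs q's /andP[/eqP pq nb] /andP[/eqP pq' nb']; apply/eqP.
case: eqP => // /eqP neq.
have := between_after pq (etrans (esym pq) pq') neq.
by case/orP => b; [case/hasP: nb; exists q' | case/hasP: nb'; exists q].
Qed.

Lemma edge_perm s s' p q : s =i s' -> edge s p q = edge s' p q.
Proof. by move=> ss'; rewrite /edge (eq_has_r ss'). Qed.

Lemma edge_cons s p c r : edge (p :: s) c r = ~~ between c r p && edge s c r.
Proof. by rewrite /edge /= negb_or andbCA. Qed.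

Lemma count_between_split B p q r : p.1 = r.1 -> between p r q -> q \notin B ->
  (count (between p r) B = count (between p q) B + count (between q r) B)%N.
Proof.
move=> pr b; elim: B => //= t B IHB; rewrite inE negb_or => /andP[qt qB].
by rewrite IHB // (between_split pr b) 1?eq_sym // addnACA.
Qed.

(** Removing p either keeps an edge or merges the two edges at p. These cases exclude each other, so
    that in [netdet_cons] they can be added as numbers. *)
Lemma edge_split s p c r : c \in s -> r \in s -> p \notin s ->
  edge s c r = edge (p :: s) c r (+) (edge (p :: s) c p && edge (p :: s) p r).
Proof.
move=> cs rs ps; rewrite !edge_cons betweenl betweenr /=.
have cp : c != p by apply: contraNneq ps => <-.
have rp : r != p by apply: contraNneq ps => <-.
have [b|nb] /= := boolP (between c r p).
  case/andP: (b) => /eqP pc1 _; rewrite /edge -pc1.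
  case: (p.1 =P r.1) => //= pr; last by rewrite andbF.
  rewrite eqxx /= -negb_or; congr (~~ _).
  have cr1 : c.1 = r.1 by rewrite -pc1.
  have E t : t \in s -> between c r t = between c p t || between p r t.
    move=> ts; have tp : t != p by apply: contraNneq ps => <-.
    have := between_split cr1 b tp.
    by case: (between c r t); case: (between c p t); case: (between p r t).
  rewrite -has_predU; apply: eq_in_has => t ts /=; exact: E.
case: (boolP (edge s c p)) => [/andP[/eqP cp1 ecp]|]; rewrite ?addbF //=.
case: (boolP (edge s p r)) => [/andP[/eqP pr1 epr]|]; rewrite ?addbF //=.
have := between_after (etrans cp1 pr1) (esym pr1) rp.
by rewrite (negbTE nb) => /= b; case/hasP: ecp; exists r.
Qed.

Definition parity B p q : bool := odd (count (between p q) B).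

Lemma parity_split s B p c r : p \notin s -> p \notin B -> c \in s -> r \in s ->
  edge (p :: s) c p -> edge (p :: s) p r ->
  parity B c r = parity B c p (+) parity B p r.
Proof.
move=> ps pB cs rs; rewrite !edge_cons betweenl betweenr /=.
move=> /andP[/eqP cp1 ncp] /andP[/eqP pr1 npr].
have rp : r != p by apply: contraNneq ps => <-.
have b : between c r p.
  have := between_after (etrans cp1 pr1) (esym pr1) rp.
  by case/orP => // b; case/hasP: ncp; exists r.
by rewrite /parity (@count_between_split B c p r) ?oddD // cp1.
Qed.

End CyclicOrder.

(** * Nets of passages *)

Section Network.
Variables (F : fieldType) (x y : F) (R : realType) (m : nat).
Local Notation point := (cpoint R m).
Local Notation crossing := (point * point * bool)%type.
Implicit Types (p q : point) (P B s : seq point) (C : seq crossing).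
Implicit Types (z : crossing) (e b : bool) (i j : point * bool).

(** The entries of [Mpos] (e = true) and [Mneg] (e = false) when rows and columns are indexed by
    passages: over-over, under-under, and the row of the over passage against the column of the
    under passage. The remaining entry is the 0 of these matrices. *)
Definition upper_weight e : F := if e then - y else - y^-1.
Definition lower_weight e : F := if e then - (x * y^-1) else - (x^-1 * y).
Definition side_weight e : F := if e then 1 - x else 1 - x^-1.

(* On the second sheet (b = true) the over and the under strand are exchanged. *)
Definition upper b z : point := if b then z.1.2 else z.1.1.
Definition lower b z : point := if b then z.1.1 else z.1.2.

(** The row q is the passage arrived at, the column p the passage left. A sum over the crossings,
    rather than a lookup, is additive in C and blind to its order. *)
Definition weight C b q p : F := \sum_(z <- C)
  (((q == upper b z) && (p == upper b z))%:R * upper_weight z.2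
   + ((q == lower b z) && (p == lower b z))%:R * lower_weight z.2
   + ((q == upper b z) && (p == lower b z))%:R * side_weight z.2).

Definition points C : seq point := flatten [seq [:: z.1.1; z.1.2] | z <- C].

Definition arrow s B i j : bool :=
  edge s j.1 i.1 && (i.2 == j.2 (+) parity B j.1 i.1).

(* The points of P are passages through vertices of degree two. *)
Definition net C P B i j : F :=
  (i.2 == j.2)%:R * (weight C i.2 i.1 j.1 + ((i.1 == j.1) && (i.1 \in P))%:R)
  - (arrow (points C ++ P) B i j)%:R.

Definition sheets s : seq (point * bool) := [seq (p, b) | p <- s, b <- [:: false; true]].

Definition netdet C P B : F := seq_det (sheets (points C ++ P)) (net C P B).

Lemma sheets_cons p s : sheets (p :: s) = (p, false) :: (p, true) :: sheets s.
Proof. by []. Qed.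

Lemma sheets_cat s s' : sheets (s ++ s') = sheets s ++ sheets s'.
Proof. by rewrite /sheets map_cat flatten_cat. Qed.

Lemma mem_sheets s i : (i \in sheets s) = (i.1 \in s).
Proof.
elim: s => // p s IHs; rewrite sheets_cons !inE IHs orbA; congr (_ || _).
by case: i {IHs} => q []; rewrite !xpair_eqE /= ?andbF ?andbT ?orbF.
Qed.

Lemma sheets_uniq s : uniq (sheets s) = uniq s.
Proof.
elim: s => // p s IHs; rewrite sheets_cons /= !inE !mem_sheets /= IHs xpair_eqE eqxx /=.
by case: (p \in s).
Qed.

Lemma sheets_perm s s' : perm_eq s s' -> perm_eq (sheets s) (sheets s').
Proof.
by move=> ss'; apply: perm_flatten; apply: perm_map.
Qed.

Lemma mem_points C p : (p \in points C) = has (fun z => (p == z.1.1) || (p == z.1.2)) C.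
Proof. by elim: C => //= z C IHC; rewrite !inE orbA IHC. Qed.

Lemma points_cat C C' : points (C ++ C') = points C ++ points C'.
Proof. by rewrite /points map_cat flatten_cat. Qed.

Lemma points_perm C C' : perm_eq C C' -> perm_eq (points C) (points C').
Proof. by move=> CC'; apply: perm_flatten; apply: perm_map. Qed.

Lemma weight_cat C C' b q p : weight (C ++ C') b q p = weight C b q p + weight C' b q p.
Proof. by rewrite /weight big_cat. Qed.

Lemma upper_points C b z : z \in C -> upper b z \in points C.
Proof.
by move=> zC; rewrite mem_points; apply/hasP; exists z => //; case: b; rewrite /= eqxx ?orbT.
Qed.

Lemma lower_points C b z : z \in C -> lower b z \in points C.
Proof.
by move=> zC; rewrite mem_points; apply/hasP; exists z => //; case: b; rewrite /= eqxx ?orbT.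
Qed.

Lemma weight_notinl C b q p : q \notin points C -> weight C b q p = 0.
Proof.
move=> qC; rewrite /weight big_seq big1 // => z zC.
have /negbTE -> : q != upper b z by apply: contraNneq qC => ->; apply: upper_points.
have /negbTE -> : q != lower b z by apply: contraNneq qC => ->; apply: lower_points.
by rewrite !mul0r !addr0.
Qed.

Lemma weight_notinr C b q p : p \notin points C -> weight C b q p = 0.
Proof.
move=> qC; rewrite /weight big_seq big1 // => z zC.
have /negbTE -> : p != upper b z by apply: contraNneq qC => ->; apply: upper_points.
have /negbTE -> : p != lower b z by apply: contraNneq qC => ->; apply: lower_points.
by rewrite !andbF !mul0r !addr0.
Qed.

Lemma netdet_perm C C' P P' B B' :
  perm_eq C C' -> perm_eq P P' -> perm_eq B B' -> netdet C P B = netdet C' P' B'.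
Proof.
move=> CC' PP' BB'; have ptE : perm_eq (points C ++ P) (points C' ++ P').
  by apply: perm_cat => //; apply: points_perm.
rewrite /netdet (seq_det_perm _ (sheets_perm ptE)); apply: eq_seq_det => i j _ _.
rewrite /net /weight (perm_big _ CC') (perm_mem PP') /arrow /parity.
by rewrite (seq.permP BB') (edge_perm _ _ (perm_mem ptE)).
Qed.

(** The two lifts of p span an identity block: no edge joins p to itself, since r lies on the same
    circle. Eliminating this block adds, for every path of two edges through p, the arrow of the
    merged edge; the parities of the two pieces add up. *)
Lemma netdet_cons C p P B r : p \notin points C ++ P -> p \notin B ->
  r \in points C ++ P -> r.1 = p.1 -> netdet C (p :: P) B = netdet C P B.
Proof.
set s := points C ++ P => ps pB rs rp.
have sE : points C ++ p :: P =i p :: s by move=> q; rewrite /s mem_cat !inE mem_cat orbCA.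
have pC : p \notin points C by move: ps; rewrite mem_cat negb_or => /andP[].
have pP : p \notin P by move: ps; rewrite mem_cat negb_or => /andP[].
have netE i j : net C (p :: P) B i j =
   (i.2 == j.2)%:R * (weight C i.2 i.1 j.1 + ((i.1 == j.1) && (i.1 \in p :: P))%:R)
     - (arrow (p :: s) B i j)%:R.
  by rewrite /net /arrow (edge_perm _ _ sE).
have pp : edge (p :: s) p p = false.
  rewrite edge_cons betweenl /=; apply/negP => /andP[_ /hasP[]].
  exists r => //; have /= := between_before p (erefl p.1).
  have rneq : r != p by apply: contraNneq ps => <-.
  by have := between_before p rp rneq; rewrite betweenr.
rewrite /netdet.
have pE : perm_eq (points C ++ p :: P) (p :: s) by rewrite perm_catC /= perm_cons perm_catC.
rewrite (seq_det_perm _ (sheets_perm pE)) sheets_cons -cat1s -[in X in _ ++ X]cat1s catA.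
set A := net C (p :: P) B.
have App b b' : A (p, b) (p, b') = (b == b')%:R.
  by rewrite /A netE /arrow /= pp weight_notinl // add0r eqxx inE eqxx mulr1 subr0.
(* The block is the identity, so the coefficients are the entries to be cleared. *)
rewrite (seq_det_cat (X := A)); last first.
  move=> i c; rewrite !inE => /orP[] /eqP -> _; rewrite !big_cons big_nil !App /=;
  by rewrite ?mul0r ?mul1r ?addr0 ?add0r.
rewrite seq_det_trig; last by rewrite /= App !eqxx.
rewrite /= !big_cons big_nil !App !mulr1 mul1r.
apply: eq_seq_det => i j; rewrite !mem_sheets => si sj.
rewrite !big_cons big_nil addr0 /A !netE /net /arrow /=.
have ip : i.1 != p by apply: contraNneq ps => <-.
have jp : j.1 != p by apply: contraNneq ps => <-.
rewrite !(weight_notinl _ _ pC) !(weight_notinr _ _ pC) (negbTE ip) (eq_sym p) (negbTE jp).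
rewrite inE (negbTE ip) /= !addr0 !mulr0 !sub0r !mulrNN -!natrM -addrA -natrD -opprD -natrD.
congr (_ - _%:R); rewrite (edge_split sj si ps).
case e1: (edge (p :: s) j.1 p); case e2: (edge (p :: s) p i.1) => //=; rewrite ?andbF ?addbF ?muln0 ?mul0n ?addn0 //=.
rewrite (parity_split ps pB sj si e1 e2).
have -> : edge (p :: s) j.1 i.1 = false.
  by apply/negP => e3; move: ip; rewrite (edge_after _ _ e3 e1) ?eqxx ?inE ?eqxx ?si ?orbT.
by case: i.2; case: j.2; case: (parity B j.1 p); case: (parity B p i.1).
Qed.

End Network.

(** * Elimination of a tangle *)

Section Tangle.
Variables (F : fieldType) (x y : F) (R : realType) (m k : nat).
Local Notation point := (cpoint R m).
Local Notation crossing := (point * point * bool)%type.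
Local Notation weight := (weight x y).
Local Notation net := (net x y).
Local Notation netdet := (netdet x y).
Variables (e f : 'I_k -> point).
Implicit Types (p q r c : point) (P B s : seq point) (C : seq crossing).
Implicit Types (z : crossing) (b : bool).
Implicit Types (G : seq (point * point)).

(* A tangle with k strands, running from e i to f i, with real crossings Cin,
   in a diagram with the further real crossings Cout; G lists the edges inside
   of the tangle, which carry no bars. *)
Record tangle Cin G Cout P B : Prop := Tangle {
  tangle_uniq : uniq (points (Cin ++ Cout) ++ P);
  tangle_e : injective e;
  tangle_f : injective f;
  tangle_eP : forall i, e i \in P;
  tangle_fP : forall i, f i \in P;
  tangle_edge : forall a, a \in G -> edge (points (Cin ++ Cout) ++ P) a.1 a.2;
  tangle_parity : forall a, a \in G -> parity B a.1 a.2 = false;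
  tangle_fst : map fst G =i points Cin ++ codom e;
  tangle_snd : map snd G =i points Cin ++ codom f;
  tangle_out : forall c r, c \in points Cout ++ P -> r \in points Cout ++ P ->
    c \notin codom e -> r \notin codom f ->
    edge (points (Cin ++ Cout) ++ P) c r = edge (points Cout ++ P) c r
}.

Definition row_sum C b (V : point -> F) q : F := \sum_(z <- C)
  ((q == upper b z)%:R * (upper_weight y z.2 * V (upper b z)
                          + side_weight x z.2 * V (lower b z))
   + (q == lower b z)%:R * (lower_weight x y z.2 * V (lower b z))).

(* V assigns a value to every edge of the tangle, named by its initial point; T i j is
   the value which leaves the tangle at the end of strand j when 1 enters at
   strand i and 0 elsewhere. *)
Definition transfer C G b (T : 'I_k -> 'I_k -> F) : Prop :=
  forall i, exists V : point -> F,
  [/\ forall j, V (e j) = (i == j)%:R,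
      forall j, V (f j) = T i j,
      forall a, a \in G -> a.2 \in points C -> row_sum C b V a.2 = V a.1 &
      forall a, a \in G -> a.2 \in codom f -> V a.2 = V a.1].

Definition inner_matrix C G b q p : F := weight C b q p - ((p, q) \in G)%:R.

(** Edges that leave an entry or arrive at an exit belong to the tangle and are suppressed. What is
    left does not refer to the interior and is therefore common to both pictures of a move. *)
Definition outer_matrix Cout P B (i j : point * bool) : F :=
  (i.2 == j.2)%:R * (weight Cout i.2 i.1 j.1 + ((i.1 == j.1) && (i.1 \in P))%:R)
  - ((i.1 \notin codom f) && (j.1 \notin codom e) && arrow (points Cout ++ P) B i j)%:R.

Definition transfer_matrix (T : bool -> 'I_k -> 'I_k -> F)
    (i j : point * bool) : F :=
  (i.2 == j.2)%:R *
  \sum_u \sum_v ((i.1 == f v) && (j.1 == e u))%:R * T i.2 u v.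

Lemma sum_pick (s : seq point) (V : point -> F) p : uniq s -> p \in s ->
  \sum_(q <- s) (q == p)%:R * V q = V p.
Proof.
move=> us ps; rewrite (bigD1_seq p) //= eqxx mul1r big1 ?addr0 // => q /negbTE ->.
by rewrite mul0r.
Qed.

Lemma sum_sheets (s : seq point) (g : point * bool -> F) :
  \sum_(i <- sheets s) g i = \sum_(p <- s) (g (p, false) + g (p, true)).
Proof.
elim: s => [|p s IHs]; first by rewrite !big_nil.
by rewrite sheets_cons !big_cons IHs addrA.
Qed.

Lemma row_sumE C b V q : uniq (points C) ->
  \sum_(p <- points C) weight C b q p * V p = row_sum C b V q.
Proof.
move=> uC; under eq_bigr => p _ do rewrite /weight mulr_suml.
rewrite exchange_big /= /row_sum [LHS]big_seq [RHS]big_seq; apply: eq_bigr => z zC.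
have pick a (w : F) : a \in points C ->
  \sum_(p <- points C) ((p == a)%:R * w * V p) = w * V a.
  move=> aC; under eq_bigr => p _ do rewrite -mulrA.
  exact: (sum_pick (fun p => w * V p)).
have uz := upper_points b zC; have lz := lower_points b zC.
transitivity (\sum_(p <- points C) (
   (q == upper b z)%:R * ((p == upper b z)%:R * upper_weight y z.2 * V p
      + (p == lower b z)%:R * side_weight x z.2 * V p)
   + (q == lower b z)%:R * ((p == lower b z)%:R * lower_weight x y z.2 * V p))).
  apply: eq_bigr => p _; rewrite -!mulnb !natrM; ring.
by rewrite big_split /= -!mulr_sumr big_split /= !pick.
Qed.

Lemma seq_det_sheets s (A : point * bool -> point * bool -> F) :
  (forall p q, p \in s -> q \in s -> forall b, A (p, b) (q, ~~ b) = 0) ->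
  seq_det (sheets s) A =
  \prod_(b <- [:: false; true]) seq_det s (fun p q => A (p, b) (q, b)).
Proof.
move=> A0.
have sE : perm_eq (sheets s) ([seq (p, false) | p <- s] ++ [seq (p, true) | p <- s]).
  elim: s {A0} => // p s IHs; rewrite sheets_cons /= perm_cons.
  by rewrite perm_sym -(cat1s (p, true) [seq _ | _ <- s]) perm_catCA perm_cons /= perm_sym.
rewrite (seq_det_perm _ sE) (seq_det_cat (X := fun _ _ => 0)); last first.
  move=> _ _ /mapP[p ps ->] /mapP[q qs ->]; rewrite big1 => [|l _]; last exact: mulr0.
  exact: A0 _ _ ps qs false.
rewrite !big_cons big_nil mulr1 !seq_det_map; congr (_ * _).
by apply: eq_seq_det => p q _ _; rewrite big1 ?subr0 // => l _; rewrite mulr0.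
Qed.

Section Schur.
Variables (Cin Cout : seq crossing) (G : seq (point * point)) (P B : seq point).
Hypothesis tG : tangle Cin G Cout P B.
Local Notation inner := (points Cin).
Local Notation outer := (points Cout ++ P).
Local Notation pts := (points (Cin ++ Cout) ++ P).

Let ptsE : pts = inner ++ outer.
Proof. by rewrite points_cat catA. Qed.

Let mem_pts p : (p \in pts) = (p \in inner) || (p \in outer).
Proof. by rewrite ptsE mem_cat. Qed.

Let inner_pts p : p \in inner -> p \in pts.
Proof. by rewrite mem_pts => ->. Qed.

Let outer_pts p : p \in outer -> p \in pts.
Proof. by rewrite mem_pts orbC => ->. Qed.

Let in_catl p s : p \in inner -> p \in inner ++ s.
Proof. by rewrite mem_cat => ->. Qed.

Let outer_inner p : p \in outer -> p \notin inner.
Proof.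
move=> po; have := tangle_uniq tG; rewrite ptsE cat_uniq => /and3P[_ /hasPn H _].
exact: H.
Qed.

Let inner_uniq : uniq inner.
Proof. by have := tangle_uniq tG; rewrite ptsE cat_uniq => /and3P[]. Qed.

Let inner_Cout p : p \in inner -> p \notin points Cout.
Proof. by apply: contraL => pC; apply: outer_inner; rewrite mem_cat pC. Qed.

Let outer_e i : e i \in outer.
Proof. by rewrite mem_cat (tangle_eP tG) ?orbT. Qed.

Let outer_f i : f i \in outer.
Proof. by rewrite mem_cat (tangle_fP tG) ?orbT. Qed.

Let fst_pts a : a \in G -> a.1 \in pts.
Proof.
move=> aG; have : a.1 \in map fst G by apply: map_f.
rewrite (tangle_fst tG) mem_cat mem_pts => /orP[-> //|/codomP[i ->]].
by rewrite outer_e orbT.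
Qed.

Let snd_pts a : a \in G -> a.2 \in pts.
Proof.
move=> aG; have : a.2 \in map snd G by apply: map_f.
rewrite (tangle_snd tG) mem_cat mem_pts => /orP[-> //|/codomP[i ->]].
by rewrite outer_f orbT.
Qed.

Let arrow_in q p b b' : q \in inner ++ codom f -> p \in pts ->
  arrow pts B (q, b) (p, b') = ((p, q) \in G) && (b == b').
Proof.
rewrite -(tangle_snd tG) => /mapP[[p' q'] aG /= ->{q}] pp; rewrite /arrow /=.
have [pG|pG] := boolP ((p, q') \in G).
  by rewrite (tangle_edge tG pG) (tangle_parity tG pG) addbF.
apply/negbTE; rewrite negb_and; apply/orP; left; apply: contra pG => ed.
by rewrite (edge_before pp (fst_pts aG) ed (tangle_edge tG aG)).
Qed.

Let arrow_from q p b b' : p \in inner ++ codom e -> q \in pts ->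
  arrow pts B (q, b) (p, b') = ((p, q) \in G) && (b == b').
Proof.
rewrite -(tangle_fst tG) => /mapP[[p' q'] aG /= ->{p}] qq; rewrite /arrow /=.
have [pG|pG] := boolP ((p', q) \in G).
  by rewrite (tangle_edge tG pG) (tangle_parity tG pG) addbF.
apply/negbTE; rewrite negb_and; apply/orP; left; apply: contra pG => ed.
by rewrite (edge_after qq (snd_pts aG) ed (tangle_edge tG aG)).
Qed.

Let pred_uniq p p' q : (p, q) \in G -> (p', q) \in G -> p = p'.
Proof.
move=> pG p'G.
exact: edge_before (fst_pts pG) (fst_pts p'G) (tangle_edge tG pG) (tangle_edge tG p'G).
Qed.

(** Only one edge arrives at q. It starts at an inner passage, at the entry i, where 1 enters, or at
    another entry, where 0 enters; the left side covers the three cases at once. *)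
Let enter_sum i p q (V : point -> F) : (forall j, V (e j) = (i == j)%:R) ->
  (p, q) \in G ->
  ((e i, q) \in G)%:R + \sum_(p' <- inner) ((p', q) \in G)%:R * V p' = V p.
Proof.
move=> Ve pG.
have GE p' : ((p', q) \in G) = (p' == p).
  by apply/idP/eqP => [p'G|->//]; apply: pred_uniq p'G pG.
under eq_bigr => p' _ do rewrite GE.
have : p \in map fst G by apply: (map_f fst pG).
rewrite GE (tangle_fst tG) mem_cat => /orP[pin|/codomP[j pj]].
  rewrite sum_pick //; case: eqP => [eip|_]; last by rewrite add0r.
  by have := outer_inner (outer_e i); rewrite eip pin.
rewrite pj Ve (inj_eq (tangle_e tG)) big_seq big1 ?addr0 // => p' p'in.
case: eqP => [eip|_]; last by rewrite mul0r.
by have := outer_inner (outer_e j); rewrite -eip p'in.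
Qed.

(** The vectors V of [transfer], up to sign, are the coefficients which clear the inner rows of the
    columns of the entries, so no inverse of the inner block appears. The inner block splits into
    its two sheets because the edges in G carry no bars. *)
Lemma netdet_tangle (T : bool -> 'I_k -> 'I_k -> F) :
  (forall b, transfer Cin G b (T b)) ->
  netdet (Cin ++ Cout) P B =
    (\prod_(b <- [:: false; true]) seq_det inner (inner_matrix Cin G b)) *
    seq_det (sheets outer) (fun i j => outer_matrix Cout P B i j - transfer_matrix T i j).
Proof.
move=> HT; rewrite /netdet ptsE sheets_cat.
have /= [V HV] := fin_all_exists (fun bi : bool * 'I_k => HT bi.1 bi.2).
set A := net _ _ _.
have Ain q p b b' : q \in inner -> p \in inner ->
   A (q, b) (p, b') = (b == b')%:R * inner_matrix Cin G b q p.
  move=> qi pi; rewrite /A /net /= weight_cat (weight_notinl _ _ _ _ (inner_Cout qi)).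
  rewrite arrow_in ?in_catl ?inner_pts //.
  have -> : (q \in P) = false.
    by apply/negP => qP; have := @outer_inner q; rewrite mem_cat qP orbT qi => /(_ isT).
  rewrite andbF !addr0 /inner_matrix; case: eqP => _; rewrite ?andbT ?andbF /=; ring.
have Aio q b c b' : q \in inner -> c \in outer ->
   A (q, b) (c, b') = - (((c, q) \in G) && (b == b'))%:R.
  move=> qi co; rewrite /A /net /= weight_cat (weight_notinl _ _ _ _ (inner_Cout qi)).
  rewrite (weight_notinr _ _ _ _ (outer_inner co)) arrow_in ?in_catl ?outer_pts //.
  have -> : (q == c) = false by apply/negP => /eqP qc; have := outer_inner co; rewrite -qc qi.
  by rewrite !addr0 mulr0 sub0r.
have Aoi q b p b' : q \in outer -> p \in inner ->
   A (q, b) (p, b') = - (((p, q) \in G) && (b == b'))%:R.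
  move=> qo pi; rewrite /A /net /= weight_cat (weight_notinl _ _ _ _ (outer_inner qo)).
  rewrite (weight_notinr _ _ _ _ (inner_Cout pi)) arrow_from ?in_catl ?outer_pts //.
  have -> : (q == p) = false by apply/negP => /eqP qc; have := outer_inner qo; rewrite qc pi.
  by rewrite !addr0 mulr0 sub0r.
(* Columns of outer passages other than entries already vanish in the inner rows and need no
   correction. *)
pose X (i j : point * bool) := - ((i.2 == j.2)%:R * \sum_u (j.1 == e u)%:R * V (j.2, u) i.1).
have Xe p b u b' : X (p, b) (e u, b') = - ((b == b')%:R * V (b', u) p).
  rewrite /X /= (bigD1 u) //= eqxx mul1r big1 ?addr0 // => v /negbTE vu.
  by rewrite (inj_eq (tangle_e tG)) eq_sym vu mul0r.
have Xn p b c b' : c \notin codom e -> X (p, b) (c, b') = 0.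
  move=> cne; rewrite /X /= big1 ?mulr0 ?oppr0 // => v _.
  by case: eqP => [ce|_]; rewrite ?mul0r //; move: cne; rewrite ce codom_f.
rewrite (seq_det_cat (X := X)); last first.
  move=> [q b] [c b']; rewrite !mem_sheets /= => qi co; rewrite Aio // sum_sheets big_seq.
  under eq_bigr => p pi do rewrite !Ain //.
  have [/codomP[u ->]|cne] := boolP (c \in codom e); last first.
    rewrite big1 => [|p _]; last by rewrite !Xn // !mulr0 addr0.
    have -> : ((c, q) \in G) = false; last by rewrite oppr0.
    apply/negP => cG; have := map_f fst cG.
    by rewrite (tangle_fst tG) mem_cat (negbTE cne) (negbTE (outer_inner co)).
  under eq_bigr => p _ do rewrite !Xe.
  have [p0 p0G] : exists p0, (p0, q) \in G.
    have : q \in map snd G by rewrite (tangle_snd tG) mem_cat qi.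
    by case/mapP => [[p0 q'] aG /= qE]; exists p0; rewrite qE.
  have [Ve _ Vrow _] := HV (b, u).
  transitivity (- (b == b')%:R * \sum_(p <- inner) inner_matrix Cin G b q p * V (b, u) p).
    have := Vrow _ p0G qi; rewrite -row_sumE // => row_p0.
    rewrite /inner_matrix; under eq_bigr => p _ do rewrite mulrBl.
    rewrite big_split /= sumrN row_p0 -(enter_sum Ve p0G).
    rewrite addrK; case: (b == b'); rewrite ?andbT ?andbF /=; ring.
  rewrite mulr_sumr [LHS]big_seq; apply: eq_bigr => p _.
  by case: b {Vrow Ve}; case: b' => /=; ring.
congr (_ * _).
  rewrite seq_det_sheets => [|p q pi qi b]; last by rewrite Ain //; case: b; rewrite mul0r.
  by apply: eq_bigr => b _; apply: eq_seq_det => p q pi qi; rewrite Ain // eqxx mul1r.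
(* Inner edges reach an outer row only at an exit. For r = [f v] and c = [e u], the direct edge, if
   there is one, and the correction add up to the value on the edge arriving at [f v], which is T b
   u v. *)
apply: eq_seq_det => [[r b] [c b']]; rewrite !mem_sheets /= => ro co.
rewrite sum_sheets big_seq; under eq_bigr => p pi do rewrite !Aoi //.
have Arc : A (r, b) (c, b') =
  (b == b')%:R * (weight Cout b r c + ((r == c) && (r \in P))%:R)
  - (arrow pts B (r, b) (c, b'))%:R.
  by rewrite /A /net /= weight_cat (weight_notinl _ _ _ _ (outer_inner ro)) add0r.
rewrite Arc /outer_matrix /=.
have [/codomP[v rv]|rnf] := boolP (r \in codom f); last first.
  have rG p : (p, r) \in G = false.
    apply/negP => pG; have := map_f snd pG.
    by rewrite (tangle_snd tG) mem_cat (negbTE rnf) (negbTE (outer_inner ro)).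
  have -> : transfer_matrix T (r, b) (c, b') = 0.
    rewrite /transfer_matrix big1 ?mulr0 // => u _; rewrite big1 // => v _ /=.
    by case: eqP => [re|_]; rewrite ?mul0r //; move: rnf; rewrite re codom_f.
  rewrite big1 => [|p _]; last by rewrite rG /= oppr0 !mul0r addr0.
  rewrite !subr0; congr (_ - _%:R).
  have [ce|cne] /= := boolP (c \in codom e).
    by rewrite arrow_from ?outer_pts // ?rG // mem_cat ce orbT.
  by rewrite /arrow /= (tangle_out tG).
rewrite /= subr0; have ri : r \in inner ++ codom f by rewrite mem_cat rv codom_f orbT.
rewrite arrow_in ?outer_pts // -!addrA; congr (_ + _).
have [/codomP[u cu]|cne] := boolP (c \in codom e); last first.
  rewrite big1 => [|p _]; last by rewrite !Xn // !mulr0 addr0.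
  have -> : transfer_matrix T (r, b) (c, b') = 0.
    rewrite /transfer_matrix big1 ?mulr0 // => u _; rewrite big1 // => w _ /=.
    by case: (c =P e u) => [ce|_]; rewrite ?andbF ?mul0r //; move: cne; rewrite ce codom_f.
  have -> : ((c, r) \in G) = false; last by rewrite /= !oppr0 addr0.
  apply/negP => cG; have := map_f fst cG.
  by rewrite (tangle_fst tG) mem_cat (negbTE cne) (negbTE (outer_inner co)).
have -> : transfer_matrix T (r, b) (c, b') = (b == b')%:R * T b u v.
  rewrite /transfer_matrix /= (bigD1 u) //= (bigD1 v) //= rv cu !eqxx mul1r.
  rewrite big1 => [|w /negbTE wv]; last first.
    by rewrite (inj_eq (tangle_f tG)) (eq_sym v) wv mul0r.
  rewrite big1 ?addr0 // => w /negbTE wu; rewrite big1 // => w' _.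
  by rewrite (inj_eq (tangle_e tG)) (eq_sym u) wu andbF mul0r.
have [p0 p0G] : exists p0, (p0, r) \in G.
  have : r \in map snd G by rewrite (tangle_snd tG).
  by case/mapP => [[p0 q'] aG /= qE]; exists p0; rewrite qE.
have [Ve Vf _ Vout] := HV (b, u).
have -> : T b u v = V (b, u) p0.
  by rewrite -Vf -(Vout _ p0G) /= ?rv ?codom_f.
rewrite -(enter_sum Ve p0G) cu -big_seq.
under eq_bigr => p _ do rewrite !Xe.
transitivity (- ((b == b')%:R * ((e u, r) \in G)%:R) - (b == b')%:R * \sum_(p' <- inner) ((p', r) \in G)%:R * V (b, u) p'); last by ring.
congr (_ - _); first by case: (b == b'); rewrite ?andbT ?andbF /=; ring.
rewrite mulr_sumr; apply: eq_bigr => p _.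
by case: b {ri Vout Vf Ve p0G Arc} => /=; case: b' => /=; rewrite ?andbT ?andbF /=; ring.
Qed.

End Schur.
End Tangle.

(** * Transfer through a kink, a bigon and a triangle *)

(** Turns the tables below, of edge values V and of ranks h, into functions on passages. *)
Lemma exists_values (I : eqType) (J : Type) (s : seq I) (v : seq J) :
  uniq s -> size s = size v -> v <> [::] -> exists V : I -> J, map V s = v.
Proof.
case: v => // v0 v us sv _; exists (fun i => nth v0 (v0 :: v) (index i s)).
apply: (@eq_from_nth _ v0) => [|n]; rewrite size_map //.
case: s us sv => // i0 s us sv ns.
by rewrite (nth_map i0) // index_uniq.
Qed.

Lemma uniq_map_inj (I J : eqType) (g : I -> J) (s : seq I) :
  uniq (map g s) -> {in s &, injective g}.
Proof.
elim: s => //= a s IHs /andP[nga us] p q; rewrite !inE.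
move=> /orP[/eqP->|ps] /orP[/eqP->|qs] // gE; last exact: IHs.
  by rewrite gE map_f in nga.
by rewrite -gE map_f in nga.
Qed.

Section UniquePoints.
Variables (R : realType) (m : nat).
Local Notation point := (cpoint R m).
Local Notation crossing := (point * point * bool)%type.
Implicit Types (p q : point) (C : seq crossing) (z : crossing) (b : bool).

Lemma perm_points C b : perm_eq (points C) (map (upper b) C ++ map (lower b) C).
Proof.
apply/seq.permP => a; elim: C => //= z C; rewrite !count_cat /= => ->.
by case: b => /=; lia.
Qed.

Section Unique.
Variables (C : seq crossing) (b : bool).
Hypothesis uC : uniq (points C).

Lemma uniq_crossings : uniq C.
Proof.
have := uC; rewrite (perm_uniq (perm_points C b)) cat_uniq => /and3P[u _ _].
exact: map_uniq u.
Qed.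

Lemma upper_eq z z' : z \in C -> z' \in C -> (upper b z == upper b z') = (z == z').
Proof.
move=> zC z'C; apply/eqP/eqP => [|-> //]; move: z z' zC z'C; apply/uniq_map_inj.
by have := uC; rewrite (perm_uniq (perm_points C b)) cat_uniq => /and3P[].
Qed.

Lemma lower_eq z z' : z \in C -> z' \in C -> (lower b z == lower b z') = (z == z').
Proof.
move=> zC z'C; apply/eqP/eqP => [|-> //]; move: z z' zC z'C; apply/uniq_map_inj.
by have := uC; rewrite (perm_uniq (perm_points C b)) cat_uniq => /and3P[].
Qed.

Lemma upper_lower z z' : z \in C -> z' \in C -> (upper b z == lower b z') = false.
Proof.
move=> zC z'C; apply/negP => /eqP zz'.
have := uC; rewrite (perm_uniq (perm_points C b)) cat_uniq => /and3P[_ /hasP[]].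
by exists (lower b z'); rewrite ?map_f //= -zz' map_f.
Qed.

Lemma point_cases p : p \in points C ->
  exists2 z, z \in C & (p = upper b z \/ p = lower b z).
Proof.
rewrite (perm_mem (perm_points C b)) mem_cat => /orP[] /mapP[z zC ->]; exists z; auto.
Qed.

End Unique.
End UniquePoints.

Section Reidemeister.
Variables (F : fieldType) (x y : F).
Hypotheses (x0 : x != 0) (y0 : y != 0).
Variables (R : realType) (m : nat).
Local Notation point := (cpoint R m).
Local Notation crossing := (point * point * bool)%type.
Local Notation weight := (weight x y).
Local Notation netdet := (netdet x y).
Local Notation transfer := (transfer x y).
Local Notation inner_matrix := (inner_matrix x y).
Local Notation wO := (upper_weight y).
Local Notation wU := (lower_weight x y).
Local Notation wC := (side_weight x).
Implicit Types (p q r c : point) (P B s : seq point) (C : seq crossing).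
Implicit Types (z : crossing) (b : bool) (G : seq (point * point)).

Definition sign_power (eps : bool) : F := if eps then x else x^-1.

(** Together with [side_weightE] this is all that the computations for the curl and the bigon need,
    besides the inversion of weights under a change of sign. *)
Lemma upper_lower_weight eps : wO eps * wU eps = sign_power eps.
Proof. by case: eps; rewrite /upper_weight /lower_weight /sign_power; field; rewrite ?x0 ?y0. Qed.

Lemma side_weightE eps : wC eps = 1 - sign_power eps.
Proof. by case: eps. Qed.

Lemma upper_weight_neq0 eps : wO eps != 0.
Proof. by case: eps; rewrite /upper_weight oppr_eq0 ?invr_eq0. Qed.

Lemma lower_weight_neq0 eps : wU eps != 0.
Proof. by case: eps; rewrite /lower_weight oppr_eq0 mulf_neq0 ?invr_eq0. Qed.

Lemma upper_weightN eps : wO (~~ eps) = (wO eps)^-1.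
Proof. by case: eps; rewrite /upper_weight invrN ?invrK. Qed.

Lemma lower_weightN eps : wU (~~ eps) = (wU eps)^-1.
Proof. by case: eps; rewrite /lower_weight invrN invfM ?invrK // mulrC. Qed.

Section Unique.
Variables (C : seq crossing) (b : bool).
Hypothesis uC : uniq (points C).

Lemma row_sum_upper V z : z \in C ->
  row_sum x y C b V (upper b z) = wO z.2 * V (upper b z) + wC z.2 * V (lower b z).
Proof.
move=> zC; rewrite /row_sum (bigD1_seq z) ?(uniq_crossings b uC) //= eqxx (upper_lower b uC) //.
rewrite mul1r mul0r addr0 big_seq_cond big1 ?addr0 // => z' /andP[z'C zz'].
by rewrite (upper_eq b uC) // (eq_sym z) (negbTE zz') (upper_lower b uC) // !mul0r addr0.
Qed.

Lemma row_sum_lower V z : z \in C ->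
  row_sum x y C b V (lower b z) = wU z.2 * V (lower b z).
Proof.
move=> zC; rewrite /row_sum (bigD1_seq z) ?(uniq_crossings b uC) //= eqxx eq_sym (upper_lower b uC) //.
rewrite mul1r mul0r add0r big_seq_cond big1 ?addr0 // => z' /andP[z'C zz'].
by rewrite (lower_eq b uC) // (eq_sym z) (negbTE zz') eq_sym (upper_lower b uC) // !mul0r addr0.
Qed.

Lemma weight_upper z p : z \in C -> weight C b (upper b z) p =
  (p == upper b z)%:R * wO z.2 + (p == lower b z)%:R * wC z.2.
Proof.
move=> zC; rewrite /weight (bigD1_seq z) ?(uniq_crossings b uC) //= eqxx (upper_lower b uC) //.
rewrite mul0r addr0 big_seq_cond big1 ?addr0 // => z' /andP[z'C zz'].
by rewrite (upper_eq b uC) // (eq_sym z) (negbTE zz') (upper_lower b uC) // !mul0r !addr0.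
Qed.

Lemma weight_lower z p : z \in C -> weight C b (lower b z) p =
  (p == lower b z)%:R * wU z.2.
Proof.
move=> zC; rewrite /weight (bigD1_seq z) ?(uniq_crossings b uC) //= eqxx eq_sym (upper_lower b uC) //.
rewrite !mul0r add0r addr0 big_seq_cond big1 ?addr0 // => z' /andP[z'C zz'].
by rewrite (lower_eq b uC) // (eq_sym z) (negbTE zz') eq_sym (upper_lower b uC) // !mul0r !addr0.
Qed.

(* The matrix is triangular in the order of the rank h. *)
Lemma seq_det_inner_matrix G (h : point -> nat) :
  (forall p q, (p, q) \in G -> q \in points C -> (h p < h q)%N) ->
  (forall z, z \in C -> (h (lower b z) < h (upper b z))%N) ->
  seq_det (points C) (inner_matrix C G b) = \prod_(z <- C) sign_power z.2.
Proof.
move=> hG hC.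
(* Every non-zero entry off the diagonal has its column of strictly smaller rank than its row, so
   ties in the sorting are harmless. *)
have sP : perm_eq (sort (relpre h leq) (points C)) (points C) by rewrite perm_sort.
rewrite -(seq_det_perm _ sP) seq_det_trig; last first.
  have srt : pairwise (relpre h leq) (sort (relpre h leq) (points C)).
    rewrite -sorted_pairwise ?sort_sorted //; first by move=> p q; apply: leq_total.
    by move=> p q r; apply: leq_trans.
  have us : pairwise (fun p q => p != q) (sort (relpre h leq) (points C)).
    by rewrite -uniq_pairwise sort_uniq.
  have mem q : q \in sort (relpre h leq) (points C) -> q \in points C by rewrite mem_sort.
  elim: (sort _ _) srt us mem => //= p s IHs /andP[/allP pl sl] /andP[/allP pn sn] mem.
  rewrite IHs ?andbT //; last by move=> q qs; apply: mem; rewrite inE qs orbT.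
  apply/allP => q qs; have {}pl := pl _ qs; have {}pn := pn _ qs.
  have pC : p \in points C by apply: mem; rewrite inE eqxx.
  rewrite /inner_matrix; have -> : ((q, p) \in G) = false.
    by apply/negP => qpG; have := hG _ _ qpG pC; rewrite ltnNge -[(h p <= h q)%N]/(relpre h leq p q) pl.
  rewrite subr0; have [z zC [pE|pE]] := point_cases b pC; rewrite pE.
    rewrite weight_upper // -pE (eq_sym q) (negbTE pn) mul0r add0r.
    case: (q =P lower b z) => [qE|_]; last by rewrite mul0r.
    by have := hC _ zC; rewrite -pE -qE ltnNge -[(h p <= h q)%N]/(relpre h leq p q) pl.
  by rewrite weight_lower // -pE (eq_sym q) (negbTE pn) mul0r.
have Gpp p : p \in points C -> inner_matrix C G b p p = weight C b p p.
  move=> pC; rewrite /inner_matrix; case: (boolP (_ \in G)) => [ppG|_]; rewrite ?subr0 //.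
  by have := hG _ _ ppG pC; rewrite ltnn.
rewrite (perm_big _ sP) big_seq; under eq_bigr => p pC do rewrite Gpp //.
rewrite -big_seq (perm_big _ (perm_points C b)) big_cat /= !big_map -big_split /=.
rewrite big_seq [RHS]big_seq; apply: eq_bigr => z zC.
by rewrite weight_upper // weight_lower // !eqxx (upper_lower b uC) // mul0r addr0 !mul1r upper_lower_weight.
Qed.

End Unique.

End Reidemeister.

Section Reidemeister.
Variables (F : fieldType) (x y : F).
Hypotheses (x0 : x != 0) (y0 : y != 0).
Variables (R : realType) (m : nat).
Local Notation point := (cpoint R m).
Local Notation crossing := (point * point * bool)%type.
Local Notation weight := (weight x y).
Local Notation netdet := (netdet x y).
Local Notation transfer := (transfer x y).
Local Notation inner_matrix := (inner_matrix x y).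
Local Notation wO := (upper_weight y).
Local Notation wU := (lower_weight x y).
Local Notation wC := (side_weight x).
Local Notation sign_power := (sign_power x).
Implicit Types (p q r c : point) (P B s : seq point) (C : seq crossing).
Implicit Types (z : crossing) (b : bool) (G : seq (point * point)).

(** The equation at the end of an edge, with the crossing or exit named explicitly. A transfer can
    then be checked edge by edge without evaluating [row_sum]. *)
Variant edge_rule k (f : 'I_k -> point) C b (V : point -> F) (a : point * point) : Prop :=
| RuleUpper z of z \in C & a.2 = upper b z &
    wO z.2 * V (upper b z) + wC z.2 * V (lower b z) = V a.1
| RuleLower z of z \in C & a.2 = lower b z & wU z.2 * V (lower b z) = V a.1
| RuleExit j of a.2 = f j & V (f j) = V a.1.

Lemma transfer_intro k (e f : 'I_k -> point) C G b T :
  uniq (points C) -> (forall j, f j \notin points C) ->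
  (forall i, exists V, [/\ forall j, V (e j) = (i == j)%:R, forall j, V (f j) = T i j &
    forall a, a \in G -> edge_rule f C b V a]) ->
  transfer e f C G b T.
Proof.
move=> uC fC H i; have [V [Ve Vf VG]] := H i; exists V; split=> // a aG.
  move=> aC; case: (VG a aG) => [z zC aE VE|z zC aE VE|j aE VE].
  - by rewrite aE row_sum_upper.
  - by rewrite aE row_sum_lower.
  - by move: aC; rewrite aE (negbTE (fC j)).
case/codomP => j aE; case: (VG a aG) => [z zC aE'|z zC aE'|j' aE' VE]; last by rewrite aE' VE.
- by have := fC j; rewrite -aE aE' upper_points.
- by have := fC j; rewrite -aE aE' lower_points.
Qed.

Lemma transfer_perm k (e f : 'I_k -> point) C C' G G' b T :
  perm_eq C C' -> G =i G' -> transfer e f C G b T -> transfer e f C' G' b T.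
Proof.
move=> CC' GG' H i; have [V [Ve Vf V1 V2]] := H i; exists V; split=> // a; rewrite -GG'.
  by rewrite -(perm_mem (points_perm CC')) /row_sum -(perm_big _ CC'); apply: V1.
exact: V2.
Qed.

Definition identity_transfer k (i j : 'I_k) : F := (i == j)%:R.

Lemma transfer_nil k (e f : 'I_k -> point) G b : injective e -> injective f ->
  (forall i j, e i != f j) ->
  (forall a, a \in G -> exists j, a = (e j, f j)) ->
  transfer e f [::] G b (@identity_transfer k).
Proof.
move=> ei fi ef HG i; exists (fun p => [exists j, (i == j) && ((p == e j) || (p == f j))]%:R).
have Ve j : [exists j0, (i == j0) && ((e j == e j0) || (e j == f j0))] = (i == j).
  apply/existsP/eqP => [[j' /andP[/eqP <-]]|<-].
    by rewrite (inj_eq ei) (negbTE (ef _ _)) orbF => /eqP.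
  by exists i; rewrite !eqxx.
have Vf j : [exists j0, (i == j0) && ((f j == e j0) || (f j == f j0))] = (i == j).
  apply/existsP/eqP => [[j' /andP[/eqP <-]]|<-].
    by rewrite (inj_eq fi) eq_sym (negbTE (ef _ _)) => /eqP.
  by exists i; rewrite !eqxx orbT.
split=> [j|j|a|a /HG[j ->] _]; rewrite ?Ve ?Vf //.
Qed.

Section Kink.
Variables (e f : 'I_1 -> point) (z : crossing) (G : seq (point * point)) (b first : bool).
Let p1 := if first then upper b z else lower b z.
Let p2 := if first then lower b z else upper b z.
Hypothesis uz : uniq [:: e ord0; p1; p2; f ord0].
Hypothesis GE : G =i [:: (e ord0, p1); (p1, p2); (p2, f ord0)].

Let uC : uniq (points [:: z]).
Proof.
move: uz; rewrite /= !inE !negb_or /p1 /p2 /upper /lower => /and4P[_ /andP[H _] _ _].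
by rewrite andbT; case: first b H => [] [] //; rewrite eq_sym.
Qed.

Lemma kink_transfer : transfer e f [:: z] G b (@identity_transfer 1).
Proof.
have fC j : f j \notin points [:: z].
  move: uz; rewrite (ord1 j) /= !inE !negb_or /p1 /p2 /upper /lower !(eq_sym _ (f ord0)).
  by case/and4P => _ /andP[_ H1] H2 _; case: first b H1 H2 => [] [] -> ->.
apply: transfer_intro => // i.
(* The only unknown is the value on the loop, read off from the equation at the lower passage; the
   equation at the upper one then says that the side weight is 1 - [wO] [wU]. *)
have [V] := @exists_values _ F _ [:: 1; if first then wU z.2 else (wU z.2)^-1; 1; 1] uz erefl ltac:(done).
case=> Ve V1 V2 Vf; exists V.
rewrite /identity_transfer (ord1 i).
split=> [j|j|a]; rewrite ?(ord1 j) ?eqxx // GE !inE => /or3P[] /eqP ->.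
all: move: V1 V2; rewrite /p1 /p2; case: first => V1 V2.
- apply: (@RuleUpper _ f _ _ _ _ z); rewrite ?inE //= V1 V2 Ve upper_lower_weight // side_weightE; ring.
- by apply: (@RuleLower _ f _ _ _ _ z); rewrite ?inE //= V1 Ve divff // lower_weight_neq0.
- by apply: (@RuleLower _ f _ _ _ _ z); rewrite ?inE //= V1 V2 mulr1.
- apply: (@RuleUpper _ f _ _ _ _ z); rewrite ?inE //= V1 V2 side_weightE -(upper_lower_weight x0 y0).
  by field; rewrite lower_weight_neq0.
- by apply: (@RuleExit _ f _ _ _ _ ord0); rewrite //= Vf V2.
- by apply: (@RuleExit _ f _ _ _ _ ord0); rewrite //= Vf V2.
Qed.

(** If the lower passage comes first, the block is triangular. If the upper one comes first, the
    loop edge sits opposite the side weight and the determinant is [wO] [wU] + [wC] = 1. No rank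
    function exists in that case, hence the direct computation. *)
Lemma kink_det : seq_det (points [:: z]) (inner_matrix [:: z] G b) =
  if first then 1 else sign_power z.2.
Proof.
have zz : z \in [:: z] by rewrite inE.
have ul := upper_lower b uC zz zz.
have sE : perm_eq (points [:: z]) [:: upper b z; lower b z] by have := perm_points [:: z] b.
have iE q p : inner_matrix [:: z] G b q p = weight [:: z] b q p - ((p, q) \in G)%:R by [].
have lu : (lower b z == upper b z) = false by rewrite eq_sym.
have [ue le uf lf] : [/\ (upper b z == e ord0) = false, (lower b z == e ord0) = false,
    (upper b z == f ord0) = false & (lower b z == f ord0) = false].
  move: uz; rewrite /= !inE !negb_or /p1 /p2 !(eq_sym (e ord0)).
  by case: first => /and4P[/and3P[/negbTE-> /negbTE-> _] /andP[_ /negbTE->] /negbTE-> _].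
have Gin q p : (q, p) \in G = [|| (q == e ord0) && (p == p1), (q == p1) && (p == p2)
    | (q == p2) && (p == f ord0)].
  by rewrite GE !inE !xpair_eqE.
have [G1 G2 G3 G4] : [/\ (upper b z, upper b z) \in G = false,
    (lower b z, lower b z) \in G = false, (upper b z, lower b z) \in G = first &
    (lower b z, upper b z) \in G = ~~ first].
  by rewrite !Gin /p1 /p2 !(ue, le, uf, lf); case: first; rewrite !(ul, lu, eqxx).
rewrite (seq_det_perm _ sE) -cat1s.
pose A := inner_matrix [:: z] G b.
rewrite -/A (seq_det_cat (X := fun i c => (wO z.2)^-1 * A (upper b z) c)); last first.
  move=> i c; rewrite !inE => /eqP -> /eqP ->; rewrite big_seq1.
  rewrite mulrA {2}/A iE (weight_upper x y b uC _ zz) eqxx ul mul0r addr0 mul1r G1.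
  by rewrite subr0 divff ?mul1r // upper_weight_neq0.
have A1 (B : point -> point -> F) : seq_det [:: upper b z] B = B (upper b z) (upper b z) by rewrite /seq_det /= det_mx11 mxE.
have A2 (B : point -> point -> F) : seq_det [:: lower b z] B = B (lower b z) (lower b z) by rewrite /seq_det /= det_mx11 mxE.
rewrite A1 A2 big_seq1 /A !iE !(weight_upper x y b uC _ zz) !(weight_lower x y b uC _ zz).
rewrite !(ul, lu, eqxx).
rewrite G1 G2 G3 G4 side_weightE -(upper_lower_weight x0 y0).
by case: first => /=; field; rewrite ?upper_weight_neq0.
Qed.

End Kink.
End Reidemeister.

Section Reidemeister.
Variables (F : fieldType) (x y : F).
Hypotheses (x0 : x != 0) (y0 : y != 0).
Variables (R : realType) (m : nat).
Local Notation point := (cpoint R m).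
Local Notation crossing := (point * point * bool)%type.
Local Notation transfer := (transfer x y).
Local Notation inner_matrix := (inner_matrix x y).
Local Notation wO := (upper_weight y).
Local Notation wU := (lower_weight x y).
Local Notation wC := (side_weight x).
Local Notation sign_power := (sign_power x).
Implicit Types (p q r c : point) (C : seq crossing) (z : crossing) (b : bool).

Lemma mem_all_ord k (I : seq 'I_k) j : uniq I -> size I = k -> j \in I.
Proof.
move=> uI sI; have [] := @uniq_min_size _ I (enum 'I_k) uI.
- by move=> i _; rewrite mem_enum.
- by rewrite size_enum_ord sI.
by move=> _ ->; rewrite mem_enum.
Qed.

Section Bigon.
Variables (e f : 'I_2 -> point) (z1 z2 : crossing) (G : seq (point * point)).
Variables (b first : bool) (iU iL : 'I_2).
Let C := [:: z1; z2].
Let l1 := if first then lower b z1 else lower b z2.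
Let l2 := if first then lower b z2 else lower b z1.
Hypothesis uC : uniq (points C).
Hypothesis fC : forall j, f j \notin points C.
Hypothesis us : uniq [:: e iU; e iL; f iU; f iL; upper b z1; upper b z2; lower b z1; lower b z2].
Hypothesis UL : uniq [:: iU; iL].
Hypothesis signs : z2.2 = ~~ z1.2.
Hypothesis GE : G =i [:: (e iU, upper b z1); (upper b z1, upper b z2); (upper b z2, f iU);
  (e iL, l1); (l1, l2); (l2, f iL)].

Let z1C : z1 \in C. Proof. by rewrite inE eqxx. Qed.
Let z2C : z2 \in C. Proof. by rewrite !inE eqxx orbT. Qed.

Lemma bigon_transfer : transfer e f C G b (@identity_transfer F 2).
Proof.
apply: transfer_intro => // i; rewrite /identity_transfer.
set a : F := (i == iU)%:R; set l : F := (i == iL)%:R.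
(* The values leaving the lower passages. They depend only on what enters the lower strand, which is
   solved first; the upper strand follows, and its last equation holds because the two crossings
   have inverse weights. *)
pose v1 := if first then l / wU z1.2 else l.
pose v2 := if first then l else l * wU z1.2.
have [V] := exists_values (v := [:: a; l; a; l; (a - wC z1.2 * v1) / wO z1.2; a; v1; v2]) us erefl ltac:(done).
case=> Ve1 Ve2 Vf1 Vf2 Vu1 Vu2 Vl1 Vl2; exists V.
have jE j : (j == iU) || (j == iL) by have := mem_all_ord j UL erefl; rewrite !inE.
have nO := upper_weight_neq0 y0 z1.2; have nU := lower_weight_neq0 x0 y0 z1.2.
have nO' := upper_weightN y z1.2; have nU' := lower_weightN x y z1.2.
split=> [j|j|w]; try by case/orP: (jE j) => /eqP ->.
rewrite GE !inE; case/or4P; [| | |case/or3P] => /eqP ->.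
- apply: (@RuleUpper _ _ _ _ _ _ f _ _ _ _ z1) => //=; rewrite Vu1 Vl1 Ve1; field; exact: nO.
- apply: (@RuleUpper _ _ _ _ _ _ f _ _ _ _ z2) => //=; rewrite Vu1 Vl2 Vu2 signs nO' !side_weightE.
  rewrite -!(upper_lower_weight x0 y0) nO' nU' /v1 /v2.
  by case: first; field; rewrite ?nO ?nU.
- by apply: (@RuleExit _ _ _ _ _ _ f _ _ _ _ iU) => //=; rewrite Vf1.
- move: Vl1 Vl2; rewrite /l1 /v1 /v2; case: first => /= Vl1 Vl2.
    by apply: (@RuleLower _ _ _ _ _ _ f _ _ _ _ z1) => //=; rewrite Vl1 Ve2; field; exact: nU.
  by apply: (@RuleLower _ _ _ _ _ _ f _ _ _ _ z2) => //=; rewrite Vl2 Ve2 signs nU'; field; exact: nU.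
- move: Vl1 Vl2; rewrite /l1 /l2 /v1 /v2; case: first => /= Vl1 Vl2.
    by apply: (@RuleLower _ _ _ _ _ _ f _ _ _ _ z2) => //=; rewrite Vl1 Vl2 signs nU'; field; exact: nU.
  by apply: (@RuleLower _ _ _ _ _ _ f _ _ _ _ z1) => //=; rewrite Vl1 Vl2; field.
- move: Vl1 Vl2; rewrite /l2 /v1 /v2; case: first => /= Vl1 Vl2;
  by apply: (@RuleExit _ _ _ _ _ _ f _ _ _ _ iL) => //=; rewrite Vf2 ?Vl1 ?Vl2.
Qed.

Lemma bigon_det : seq_det (points C) (inner_matrix C G b) = 1.
Proof.
(* Ranks increase along each strand, and the lower strand comes below the upper one. *)
have [h] := exists_values (v := [:: 0; 0; 0; 0; 3; 4; if first then 1 else 2; if first then 2 else 1]%N) us erefl ltac:(done).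
case=> He1 He2 Hf1 Hf2 Hu1 Hu2 Hl1 Hl2.
rewrite (seq_det_inner_matrix x0 y0 uC (h := h)); first last.
- by move=> z; rewrite !inE => /orP[] /eqP ->; rewrite ?Hu1 ?Hu2 ?Hl1 ?Hl2; case: first.
- move=> p q; rewrite GE => pG qC; move: pG; rewrite !inE !xpair_eqE.
  case/or4P; [| | |case/or3P] => /andP[/eqP pE /eqP qE]; rewrite pE qE ?He1 ?He2 ?Hu1 ?Hu2 //;
  try by move: qC; rewrite qE (negbTE (fC _)).
  + by move: Hl1 Hl2; rewrite /l1; case: first => Hl1 Hl2; rewrite ?Hl1 ?Hl2.
  + by move: Hl1 Hl2; rewrite /l1 /l2; case: first => Hl1 Hl2; rewrite ?Hl1 ?Hl2.
rewrite !big_cons big_nil signs mulr1.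
by case: z1.2; rewrite /= ?divff ?mulVf.
Qed.

End Bigon.
End Reidemeister.

Section Reidemeister.
Variables (F : fieldType) (x y : F).
Hypotheses (x0 : x != 0) (y0 : y != 0).
Variables (R : realType) (m : nat).
Local Notation point := (cpoint R m).
Local Notation crossing := (point * point * bool)%type.
Local Notation transfer := (transfer x y).
Local Notation inner_matrix := (inner_matrix x y).
Local Notation wO := (upper_weight y).
Local Notation wU := (lower_weight x y).
Local Notation wC := (side_weight x).
Local Notation sign_power := (sign_power x).
Implicit Types (p q r c : point) (C : seq crossing) (z : crossing) (b : bool).

Section Values.
(* sMB, sTB, sTM are the signs of the crossings between the bottom, the middle and
   the top strand; fB, fM, fT tell whether the bottom (resp. middle, top) strand meets the
   middle (resp. bottom, middle) strand first. *)
Variables (sMB sTB sTM fB fM fT : bool) (inB inM inT : F).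

(** In [val_ij] the letters name strands (bottom, middle, top): it is the value leaving the passage
    of i at its crossing with j. The bottom strand is solved first, then the middle, then the top
    one. The case of [val_tm] where the top meets the bottom first contains the formula of [val_tb]
    inlined, to avoid a circular definition. *)
Definition val_bm : F := inB / (wU sMB * if fB then 1 else wU sTB).
Definition val_bt : F := inB / (wU sTB * if fB then wU sMB else 1).
Definition val_mb : F :=
  ((if fM then inM else inM / wU sTM) - wC sMB * val_bm) / wO sMB.
Definition val_mt : F := (if fM then val_mb else inM) / wU sTM.
Definition val_tm : F := 
  ((if fT then inT else (inT - wC sTB * val_bt) / wO sTB) - wC sTM * val_mt) / wO sTM.
Definition val_tb : F :=
  ((if fT then val_tm else inT) - wC sTB * val_bt) / wO sTB.
Definition out_b : F := inB / (wU sMB * wU sTB).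
Definition out_m : F := if fM then val_mt else val_mb.
Definition out_t : F := if fT then val_tb else val_tm.
End Values.

(** Reversing the three orders passes from one side of the third move to the other. Arbitrary signs
    and orders need not come from three strands in the plane; the two hypotheses are relations that
    do hold there ([triangle_sign_flip]). They leave 16 cases, each an identity of rational
    functions. *)
Lemma out_flip sMB sTB sTM fB fM fT inB inM inT :
  sMB (+) sTB = ~~ (fT (+) fM) -> sTB (+) sTM = fB (+) fM ->
  out_m sMB sTB sTM fB fM inB inM = out_m sMB sTB sTM (~~ fB) (~~ fM) inB inM /\
  out_t sMB sTB sTM fB fM fT inB inM inT =
    out_t sMB sTB sTM (~~ fB) (~~ fM) (~~ fT) inB inM inT.
Proof.
rewrite /out_m /out_t /val_tb /val_tm /val_mt /val_mb /val_bt /val_bm.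
rewrite /upper_weight /lower_weight /side_weight.
by case: sMB; case: sTB; case: sTM; case: fB; case: fM; case: fT => // _ _;
  split; rewrite /=; field; rewrite ?oppr_eq0 ?oner_eq0 ?x0 ?y0.
Qed.

Definition triangle_values (sMB sTB sTM fB fM fT : bool) (iB iM iT i j : 'I_3) : F :=
  let inB := (i == iB)%:R in let inM := (i == iM)%:R in let inT := (i == iT)%:R in
  if j == iB then out_b sMB sTB inB
  else if j == iM then out_m sMB sTB sTM fB fM inB inM
  else out_t sMB sTB sTM fB fM fT inB inM inT.

Lemma triangle_values_flip sMB sTB sTM fB fM fT iB iM iT i j :
  sMB (+) sTB = ~~ (fT (+) fM) -> sTB (+) sTM = fB (+) fM ->
  triangle_values sMB sTB sTM fB fM fT iB iM iT i j =
  triangle_values sMB sTB sTM (~~ fB) (~~ fM) (~~ fT) iB iM iT i j.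
Proof.
move=> h1 h2; have [Em Et] := out_flip (i == iB)%:R (i == iM)%:R (i == iT)%:R h1 h2.
by rewrite /triangle_values Em Et.
Qed.

Section Triangle.
Variables (e f : 'I_3 -> point) (zMB zTB zTM : crossing) (G : seq (point * point)).
Variables (b fB fM fT : bool) (iB iM iT : 'I_3).
Let C := [:: zMB; zTB; zTM].
Let bm := lower b zMB.
Let bt := lower b zTB.
Let mb := upper b zMB.
Let mt := lower b zTM.
Let tb := upper b zTB.
Let tm := upper b zTM.
Hypothesis uC : uniq (points C).
Hypothesis fC : forall j, f j \notin points C.
Hypothesis us : uniq [:: e iB; e iM; e iT; f iB; f iM; f iT; mb; tb; tm; bm; bt; mt].
Hypothesis uI : uniq [:: iB; iM; iT].
Let chain u v (first : bool) i : seq (point * point) :=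
  if first then [:: (e i, u); (u, v); (v, f i)] else [:: (e i, v); (v, u); (u, f i)].
Hypothesis GE : G =i chain bm bt fB iB ++ chain mb mt fM iM ++ chain tm tb fT iT.

Let zMBC : zMB \in C. Proof. by rewrite !inE eqxx. Qed.
Let zTBC : zTB \in C. Proof. by rewrite !inE eqxx orbT. Qed.
Let zTMC : zTM \in C. Proof. by rewrite !inE eqxx !orbT. Qed.

Let chainE (Q : point * point -> Prop) u v first i :
  Q (e i, if first then u else v) ->
  Q (if first then u else v, if first then v else u) ->
  Q (if first then v else u, f i) ->
  forall a, a \in chain u v first i -> Q a.
Proof.
by rewrite /chain => Q1 Q2 Q3 a; case: first Q1 Q2 Q3 => Q1 Q2 Q3;
  rewrite !inE => /or3P[] /eqP ->.
Qed.

Lemma triangle_transfer :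
  transfer e f C G b (triangle_values zMB.2 zTB.2 zTM.2 fB fM fT iB iM iT).
Proof.
apply: transfer_intro => // i; rewrite /triangle_values.
set B : F := (i == iB)%:R; set M : F := (i == iM)%:R; set T : F := (i == iT)%:R.
have [V] := exists_values (v := [:: B; M; T; out_b zMB.2 zTB.2 B;
  out_m zMB.2 zTB.2 zTM.2 fB fM B M; out_t zMB.2 zTB.2 zTM.2 fB fM fT B M T;
  val_mb zMB.2 zTB.2 zTM.2 fB fM B M; val_tb zMB.2 zTB.2 zTM.2 fB fM fT B M T;
  val_tm zMB.2 zTB.2 zTM.2 fB fM fT B M T; val_bm zMB.2 zTB.2 fB B; val_bt zMB.2 zTB.2 fB B;
  val_mt zMB.2 zTB.2 zTM.2 fB fM B M]) us erefl ltac:(done).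
case=> VeB VeM VeT VfB VfM VfT Vmb Vtb Vtm Vbm Vbt Vmt; exists V.
have jE j : [|| j == iB, j == iM | j == iT] by have := mem_all_ord j uI erefl; rewrite !inE.
have [nMB nTB nTM] : [/\ (iM == iB) = false, (iT == iB) = false & (iT == iM) = false].
  move: uI; rewrite /= !inE !negb_or (eq_sym iM iB) !(eq_sym iT).
  by case/and3P => /andP[/negbTE-> /negbTE->] /negbTE->.
have nO eps := upper_weight_neq0 y0 eps; have nU eps := lower_weight_neq0 x0 y0 eps.
split=> [j|j|w].
- by case/or3P: (jE j) => /eqP ->.
- by case/or3P: (jE j) => /eqP ->; rewrite ?nMB ?nTB ?nTM ?eqxx.
rewrite GE !mem_cat => /or3P[]; move: w; apply: chainE.
- case: fB Vbm Vbt => Vbm Vbt.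
    apply: (@RuleLower _ _ _ _ _ _ f _ _ _ _ zMB) => //=; rewrite -/bm Vbm VeB /val_bm.
    by field; rewrite ?nU.
  apply: (@RuleLower _ _ _ _ _ _ f _ _ _ _ zTB) => //=; rewrite -/bt Vbt VeB /val_bt.
  by field; rewrite ?nU.
- case: fB Vbm Vbt => Vbm Vbt.
    apply: (@RuleLower _ _ _ _ _ _ f _ _ _ _ zTB) => //=; rewrite -/bt Vbm Vbt /val_bm /val_bt.
    by field; rewrite ?nU.
  apply: (@RuleLower _ _ _ _ _ _ f _ _ _ _ zMB) => //=; rewrite -/bm Vbm Vbt /val_bm /val_bt.
  by field; rewrite ?nU.
- apply: (@RuleExit _ _ _ _ _ _ f _ _ _ _ iB) => //=; rewrite VfB /out_b.
  by case: fB Vbm Vbt => Vbm Vbt; rewrite ?Vbm ?Vbt /val_bm /val_bt //; congr (_ / _); rewrite mulrC.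
- case: fM Vmb Vmt => Vmb Vmt {VfM VfT}.
    apply: (@RuleUpper _ _ _ _ _ _ f _ _ _ _ zMB) => //=; rewrite -/mb -/bm Vmb Vbm VeM /val_mb.
    by field; rewrite ?nO.
  apply: (@RuleLower _ _ _ _ _ _ f _ _ _ _ zTM) => //=; rewrite -/mt Vmt VeM /val_mt.
  by field; rewrite ?nU.
- case: fM Vmb Vmt => Vmb Vmt {VfM VfT}.
    apply: (@RuleLower _ _ _ _ _ _ f _ _ _ _ zTM) => //=; rewrite -/mt Vmb Vmt /val_mt.
    by field; rewrite ?nU.
  apply: (@RuleUpper _ _ _ _ _ _ f _ _ _ _ zMB) => //=; rewrite -/mb -/bm Vmb Vmt Vbm /val_mb /val_mt.
  by field; rewrite ?nU ?nO.
- apply: (@RuleExit _ _ _ _ _ _ f _ _ _ _ iM) => //=; rewrite VfM /out_m.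
  by case: fM Vmb Vmt.
- case: fT Vtb Vtm => Vtb Vtm {VfT}.
    apply: (@RuleUpper _ _ _ _ _ _ f _ _ _ _ zTM) => //=; rewrite -/tm -/mt Vtm Vmt VeT /val_tm.
    by field; rewrite ?nO.
  apply: (@RuleUpper _ _ _ _ _ _ f _ _ _ _ zTB) => //=; rewrite -/tb -/bt Vtb Vbt VeT /val_tb.
  by field; rewrite ?nO.
- case: fT Vtb Vtm => Vtb Vtm {VfT}.
    apply: (@RuleUpper _ _ _ _ _ _ f _ _ _ _ zTB) => //=; rewrite -/tb -/bt Vtb Vtm Vbt /val_tb.
    by field; rewrite ?nO.
  apply: (@RuleUpper _ _ _ _ _ _ f _ _ _ _ zTM) => //=; rewrite -/tm -/mt Vtb Vtm Vmt /val_tm /val_tb.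
  by field; rewrite ?nO.
- apply: (@RuleExit _ _ _ _ _ _ f _ _ _ _ iT) => //=; rewrite VfT /out_t.
  by case: fT Vtb Vtm.
Qed.

Lemma triangle_det : seq_det (points C) (inner_matrix C G b) = \prod_(z <- C) sign_power z.2.
Proof.
(* Ranks 1, 2 on the bottom strand, 3, 4 on the middle one and 5, 6 on the top one, in the order of
   passing. *)
have [h] := exists_values (v := [:: 0; 0; 0; 0; 0; 0; if fM then 3 else 4;
  if fT then 6 else 5; if fT then 5 else 6; if fB then 1 else 2; if fB then 2 else 1;
  if fM then 4 else 3]%N) us erefl ltac:(done).
case=> HeB HeM HeT HfB HfM HfT Hmb Htb Htm Hbm Hbt Hmt.
apply: (seq_det_inner_matrix x0 y0 uC (h := h)).
  move=> p q; rewrite GE => pG qC; rewrite !mem_cat in pG.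
  have {}pG : (p, q) \in chain bm bt fB iB \/ (p, q) \in chain mb mt fM iM \/ (p, q) \in chain tm tb fT iT.
    by case/or3P: pG; auto.
  pose Q (a : point * point) := a.2 \in points C -> (h a.1 < h a.2)%N.
  suff Qpq : Q (p, q) by exact: Qpq qC.
  by case: pG => [|[]] aG; apply: (chainE _ _ _ aG); rewrite /Q /= ?(negbTE (fC _)) // => _;
     rewrite ?HeB ?HeM ?HeT;
     move: Hmb Htb Htm Hbm Hbt Hmt; case: fB; case: fM; case: fT => /= Hmb Htb Htm Hbm Hbt Hmt;
     rewrite ?Hmb ?Htb ?Htm ?Hbm ?Hbt ?Hmt.
move=> z; rewrite !inE => /or3P[] /eqP ->; rewrite -/bm -/mb -/bt -/tb -/mt -/tm;
  rewrite ?Hmb ?Htb ?Htm ?Hbm ?Hbt ?Hmt; case: fB; case: fM; case: fT => //.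
Qed.

End Triangle.
End Reidemeister.

(** * Bars *)

Section Intervals.
Variables (R : realType) (m : nat).
Local Notation point := (cpoint R m).
Implicit Types (p q r c u v : point) (P B s : seq point).

Lemma cyclic_shift (a b u v : R) : u <= v -> ~~ (u <= a <= v) -> ~~ (u <= b <= v) ->
  cyclic a b u = cyclic a b v.
Proof.
rewrite /cyclic !negb_and -!ltNge => uv /orP[] ha /orP[] hb; case: (ltrP a b) => ab;
 case: (ltrP a u) => au; case: (ltrP a v) => av; case: (ltrP u b) => ub;
 case: (ltrP v b) => vb //=; exfalso; lra.
Qed.

Lemma cyclic_start (a c u : R) : u < c -> ~~ (u <= a < c) -> cyclic a c u.
Proof.
rewrite /cyclic; case: (ltrgtP a c) => ac; case: (lerP u a) => ua //=;
 case: (ltrP u c) => uc //=; lra.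
Qed.

Lemma cyclic_end (b c v : R) : c < v -> ~~ (c < b <= v) -> cyclic c b v.
Proof.
rewrite /cyclic; case: (ltrgtP c b) => cb; case: (lerP b v) => bv //=;
 case: (ltrP c v) => cv //=; lra.
Qed.

Lemma cyclic_startN (b c u : R) : u < c -> ~~ (u <= b <= c) -> cyclic c b u = false.
Proof.
rewrite /cyclic; case: (ltrgtP c b) => cb; case: (lerP u b) => ub //=;
 case: (ltrP c u) => cu //=; case: (ltrP u b) => ub' //=; lra.
Qed.

Lemma cyclic_endN (a c v : R) : c < v -> ~~ (c <= a <= v) -> cyclic a c v = false.
Proof.
rewrite /cyclic; case: (ltrgtP a c) => cb; case: (lerP a v) => ub //=;
 case: (ltrP a v) => cu //=; case: (ltrP v c) => ub' //=; lra.
Qed.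

(* [inside u v p]: p lies on the arc from u to v, which does not pass the base point. *)
Definition inside u v p : bool := (p.1 == u.1) && (u.2 <= p.2 <= v.2).

Lemma between_shift u v p q : u.1 = v.1 -> u.2 <= v.2 ->
  p.1 = q.1 -> ~~ inside u v p -> ~~ inside u v q -> between p q u = between p q v.
Proof.
move=> uv1 uv pq; rewrite !betweenE -uv1 /inside -pq.
rewrite eq_sym; case: (u.1 =P p.1) => //= _; exact: cyclic_shift.
Qed.

Lemma parity_cons u B p q : parity (u :: B) p q = between p q u (+) parity B p q.
Proof. by rewrite /parity /= oddD; case: between. Qed.

Section PassingBar.
Variables (s : seq point) (c p q u : point).
Hypotheses (ps : p \in s) (qs : q \in s) (cs : c \in s) (pq : edge s p q) (uc1 : u.1 = c.1).

(** An edge with neither end at c does not see the difference between u and c, as no passage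
    separates them, and it does not contain c. The edge leaving c and the edge arriving at c are
    treated directly. *)
Lemma between_bar_before : u.2 < c.2 -> (forall r, r \in s -> inside u c r -> r = c) ->
  between p q u = (q == c).
Proof.
move=> uc us; have /andP[/eqP pq1 ncp] := pq.
have [qc|qc] := eqVneq q c.
  rewrite qc betweenE -(etrans uc1 (esym (etrans pq1 (congr1 fst qc)))) eqxx /=.
  apply: cyclic_start => //; apply/negP => pu.
  have /us pc : inside u c p.
    by rewrite /inside pq1 qc uc1 eqxx; case/andP: pu => -> /ltW ->.
  by move: pu; rewrite (pc ps) ltxx andbF.
have niq : ~~ inside u c q by apply: contraNN qc => iq; rewrite (us _ qs iq).
have [pc|pc] := eqVneq p c.
  rewrite betweenE pc; case: (u.1 =P c.1) => //= _; rewrite cyclic_startN //.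
  by move: niq; rewrite /inside -pq1 pc uc1 eqxx.
rewrite (@between_shift u c) ?(ltW uc) //.
  by apply/negP => b; case/hasP: ncp; exists c.
by apply: contraNN pc => ip; rewrite (us _ ps ip).
Qed.

Lemma between_bar_after : c.2 < u.2 -> (forall r, r \in s -> inside c u r -> r = c) ->
  between p q u = (p == c).
Proof.
move=> uc us; have /andP[/eqP pq1 ncp] := pq.
have [pc|pc] := eqVneq p c.
  rewrite betweenE pc uc1 eqxx /=.
  apply: cyclic_end => //; apply/negP => qu.
  have /us qc : inside c u q.
    by rewrite /inside -pq1 pc eqxx; case/andP: qu => /ltW -> ->.
  by move: qu; rewrite (qc qs) ltxx.
have nip : ~~ inside c u p by apply: contraNN pc => ip; rewrite (us _ ps ip).
have [qc|qc] := eqVneq q c.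
  rewrite betweenE pq1 qc; case: (u.1 =P c.1) => //= _; rewrite cyclic_endN //.
  by move: nip; rewrite /inside pq1 qc eqxx.
rewrite -(@between_shift c u) ?(ltW uc) //.
  by apply/negP => b; case/hasP: ncp; exists c.
by apply: contraNN qc => ip; rewrite (us _ qs ip).
Qed.

End PassingBar.
End Intervals.

Section BarMoves.
Variables (F : fieldType) (x y : F) (R : realType) (m : nat).
Local Notation point := (cpoint R m).
Local Notation crossing := (point * point * bool)%type.
Local Notation netdet := (netdet x y).
Implicit Types (p q r c u v : point) (P B s : seq point) (C : seq crossing).
Implicit Types (z : crossing).

Lemma netdet_parity C P B B' :
  (forall p q, p \in points C ++ P -> q \in points C ++ P -> edge (points C ++ P) p q ->
     parity B p q = parity B' p q) ->
  netdet C P B = netdet C P B'.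
Proof.
move=> BB'; apply: eq_seq_det => i j; rewrite !mem_sheets => si sj.
rewrite /net /arrow; case: (boolP (edge _ j.1 i.1)) => //= e.
by rewrite BB'.
Qed.

Lemma netdet_slide C P B u v : u.1 = v.1 -> u.2 <= v.2 ->
  (forall p, p \in points C ++ P -> ~~ inside u v p) ->
  netdet C P (u :: B) = netdet C P (v :: B).
Proof.
move=> uv1 uv nin; apply: netdet_parity => p q ps qs /andP[/eqP pq _].
by rewrite !parity_cons (between_shift uv1) // nin.
Qed.

Lemma netdet_cancel C P B u v : u.1 = v.1 -> u.2 <= v.2 ->
  (forall p, p \in points C ++ P -> ~~ inside u v p) ->
  netdet C P [:: u, v & B] = netdet C P B.
Proof.
move=> uv1 uv nin; apply: netdet_parity => p q ps qs /andP[/eqP pq _].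
by rewrite !parity_cons (between_shift uv1) ?nin // addKb.
Qed.

Definition switched z : crossing := (z.1.2, z.1.1, z.2).

Lemma weight_switched C z b q p :
  weight x y (switched z :: C) b q p =
  weight x y [:: z] (~~ b) q p + weight x y C b q p.
Proof. by rewrite /weight !big_cons big_nil addr0; case: b. Qed.

Definition flip_sheet (S : pred point) (i : point * bool) : point * bool :=
  (i.1, i.2 (+) S i.1).

Lemma flip_sheetK S : involutive (flip_sheet S).
Proof. by case=> p b; rewrite /flip_sheet /= addbK. Qed.

(* The bars around a passage exchange its two lifts. *)
Lemma netdet_switch C P B z (u0 v0 u1 v1 : point) : uniq (points (z :: C) ++ P) ->
  u0.1 = z.1.1.1 -> v0.1 = z.1.1.1 -> u1.1 = z.1.2.1 -> v1.1 = z.1.2.1 ->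
  u0.2 < z.1.1.2 -> z.1.1.2 < v0.2 -> u1.2 < z.1.2.2 -> z.1.2.2 < v1.2 ->
  (forall r, r \in points (z :: C) ++ P -> inside u0 v0 r -> r = z.1.1) ->
  (forall r, r \in points (z :: C) ++ P -> inside u1 v1 r -> r = z.1.2) ->
  netdet (z :: C) P [:: u0, v0, u1, v1 & B] = netdet (switched z :: C) P B.
Proof.
move=> us u01 v01 u11 v11 u0z v0z u1z v1z in0 in1.
set s := points (z :: C) ++ P in us in0 in1.
set s' := points (switched z :: C) ++ P.
have s'E : perm_eq s' s.
  rewrite /s' /s perm_cat2r; apply/permPl; exact: (perm_catCA [:: z.1.2] [:: z.1.1] (points C)).
rewrite /netdet -/s -/s' (seq_det_perm _ (sheets_perm s'E)).
(* Rows and columns are reindexed by moving the two passages of z to the other sheet, where z reads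
   as [switched z]. *)
pose S : pred point := pred2 z.1.1 z.1.2.
have fE : perm_eq (map (flip_sheet S) (sheets s)) (sheets s).
  apply: uniq_perm; rewrite ?map_inj_uniq ?sheets_uniq //; first exact: can_inj (flip_sheetK S).
  move=> i; rewrite -[i in LHS](flip_sheetK S) mem_map ?mem_sheets //.
  exact: can_inj (flip_sheetK S).
rewrite -(seq_det_perm _ fE) seq_det_map; apply: eq_seq_det => i j.
rewrite !mem_sheets => si sj; rewrite /net -/s -/s' /flip_sheet /=.
have zs1 : z.1.1 \in s by rewrite inE eqxx.
have zs2 : z.1.2 \in s by rewrite !inE eqxx orbT.
have nSC r : S r -> r \notin points C /\ r \notin P.
  move=> Sr; apply/andP; rewrite -negb_or -mem_cat; move: us Sr.
  by rewrite /s /= inE negb_or => /and3P[/andP[_ n1] n2 _] /orP[] /eqP ->.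
have nSz r : ~~ S r -> r \notin points [:: z] by rewrite /= !inE.
congr (_ - _).
  rewrite weight_switched -[z :: C]cat1s weight_cat.
  have [Si|Si] := boolP (S i.1); have [Sj|Sj] := boolP (S j.1); rewrite ?addbT ?addbF //.
  - have [iC iP] := nSC _ Si; rewrite !(weight_notinl _ _ _ _ iC).
    by rewrite (inj_eq (can_inj negbK)) negbK.
  - have [iC iP] := nSC _ Si; rewrite !(weight_notinl _ _ _ _ iC) !(weight_notinr _ _ _ _ (nSz _ Sj)).
    by rewrite (negbTE iP) !andbF !addr0 !mulr0.
  - have [jC jP] := nSC _ Sj; rewrite !(weight_notinr _ _ _ _ jC) !(weight_notinl _ _ _ _ (nSz _ Si)).
    have -> : (i.1 == j.1) = false by apply: contraNF Si => /eqP ->.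
    by rewrite !addr0 !mulr0.
  - by rewrite !(weight_notinl _ _ _ _ (nSz _ Si)).
congr (_%:R); rewrite /arrow /= (edge_perm _ _ (perm_mem s'E)).
case: (boolP (edge s j.1 i.1)) => //= ji.
have sub0 u v : (forall r, r \in s -> inside u0 v0 r -> r = z.1.1) ->
  u.1 = u0.1 -> u0.2 <= u.2 -> v.2 <= v0.2 -> forall r, r \in s -> inside u v r -> r = z.1.1.
  move=> H uu hu hv r rs /andP[/eqP r1 /andP[ur rv]]; apply: H => //.
  by rewrite /inside r1 uu eqxx (le_trans hu ur) (le_trans rv hv).
have sub1 u v : (forall r, r \in s -> inside u1 v1 r -> r = z.1.2) ->
  u.1 = u1.1 -> u1.2 <= u.2 -> v.2 <= v1.2 -> forall r, r \in s -> inside u v r -> r = z.1.2.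
  move=> H uu hu hv r rs /andP[/eqP r1 /andP[ur rv]]; apply: H => //.
  by rewrite /inside r1 uu eqxx (le_trans hu ur) (le_trans rv hv).
rewrite !parity_cons.
(* Each of the four bars lies on exactly one edge, so an edge loses one bar for every end it has at
   z; this is the change of sheets made by [flip_sheet]. *)
rewrite (between_bar_before sj si zs1 ji u01 u0z (sub0 _ _ in0 erefl (lexx _) (ltW v0z))).
rewrite (between_bar_after sj si zs1 ji v01 v0z (sub0 _ _ in0 (esym u01) (ltW u0z) (lexx _))).
rewrite (between_bar_before sj si zs2 ji u11 u1z (sub1 _ _ in1 erefl (lexx _) (ltW v1z))).
rewrite (between_bar_after sj si zs2 ji v11 v1z (sub1 _ _ in1 (esym u11) (ltW u1z) (lexx _))).
have nz : z.1.1 != z.1.2 by move: us; rewrite /= inE negb_or => /andP[/andP[]].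
have SE r : S r = (r == z.1.1) (+) (r == z.1.2).
  by rewrite /S /=; case: eqP => [->|//]; rewrite (negbTE nz).
rewrite !SE.
by case: (i.1 == _); case: (i.1 == _); case: (j.1 == _); case: (j.1 == _);
  case: i.2; case: j.2; case: parity.
Qed.

End BarMoves.

(** * The matrices of a diagram *)

Section Relabel.
Variables (F : fieldType) (x y : F) (R : realType) (m : nat).
Local Notation point := (cpoint R m).
Local Notation crossing := (point * point * bool)%type.
Implicit Types (p q r : point) (P B : seq point) (C : seq crossing) (z : crossing).

Definition relabel (g : point -> point) z : crossing := (g z.1.1, g z.1.2, z.2).

Lemma points_relabel g C : points (map (relabel g) C) = map g (points C).
Proof. by rewrite /points map_flatten -!map_comp. Qed.

(** The points enter only through their circles and the cyclic order on them; the signs are data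
    carried along by [relabel]. *)
Lemma netdet_relabel g C P B :
  {in points C ++ P &, injective g} ->
  (forall p q r, p \in points C ++ P -> q \in points C ++ P ->
     r \in (points C ++ P) ++ B -> p.1 = q.1 ->
     between (g p) (g q) (g r) = between p q r) ->
  (forall p q, p \in points C ++ P -> q \in points C ++ P ->
     ((g p).1 == (g q).1) = (p.1 == q.1)) ->
  netdet x y (map (relabel g) C) (map g P) (map g B) = netdet x y C P B.
Proof.
move=> gi gb g1; rewrite /netdet points_relabel -map_cat.
have sE s : sheets (map g s) = map (fun i : point * bool => (g i.1, i.2)) (sheets s).
  by elim: s => //= p s IHs; rewrite sheets_cons IHs.
rewrite sE seq_det_map; apply: eq_seq_det => i j; rewrite !mem_sheets => si sj.
rewrite /net /= points_relabel -map_cat.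
have gE p q : p \in points C ++ P -> q \in points C ++ P -> (g p == g q) = (p == q).
  by move=> sp sq; apply/eqP/eqP => [/gi ->|->].
have inP p : p \in P -> p \in points C ++ P by rewrite mem_cat orbC => ->.
congr (_ * (_ + _%:R) - _%:R).
- rewrite /weight big_map [LHS]big_seq [RHS]big_seq; apply: eq_bigr => z zC.
  have us := upper_points i.2 zC; have ls := lower_points i.2 zC.
  have uE : upper i.2 (relabel g z) = g (upper i.2 z) by rewrite /upper; case: i.2.
  have lE : lower i.2 (relabel g z) = g (lower i.2 z) by rewrite /lower; case: i.2.
  by rewrite uE lE !gE // mem_cat ?us ?ls.
- rewrite gE //; congr (_ && _ : nat); apply/mapP/idP => [[p pP gp]|ip]; last by exists i.1.
  by rewrite (gi _ _ si (inP _ pP) gp).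
- rewrite /arrow /= /edge /parity g1 //; case: (j.1.1 =P i.1.1) => //= ji.
  rewrite has_map count_map; congr (nat_of_bool (_ && _)).
    congr (~~ _); apply: eq_in_has => r rs /=.
    by rewrite gb // mem_cat rs.
  congr (_ == _ (+) odd _); apply: eq_in_count => r rB /=.
  by rewrite gb // mem_cat rB orbT.
Qed.
End Relabel.

Section WeightTable.
Variables (F : fieldType) (x y : F) (R : realType) (m : nat).
Local Notation crossing := (cpoint R m * cpoint R m * bool)%type.
Variables (C : seq crossing) (uC : uniq (points C)) (b : bool).

Lemma weight_table z : z \in C ->
  [/\ weight x y C b z.1.1 z.1.1 =
        (if b then lower_weight x y z.2 else upper_weight y z.2),
      weight x y C b z.1.1 z.1.2 = (if b then 0 else side_weight x z.2),
      weight x y C b z.1.2 z.1.1 = (if b then side_weight x z.2 else 0) &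
      weight x y C b z.1.2 z.1.2 =
        (if b then upper_weight y z.2 else lower_weight x y z.2)].
Proof.
move=> zC; have wu p := weight_upper x y b uC p zC.
have wl p := weight_lower x y b uC p zC; have ul := upper_lower b uC zC zC.
have lu : (lower b z == upper b z) = false by rewrite eq_sym.
case: b wu wl ul lu => /= wu wl ul lu;
  by split; rewrite ?wl ?wu ?eqxx ?ul ?lu ?(mul0r, mul1r, add0r, addr0).
Qed.
End WeightTable.

(** [Ptilde] pairs the offset a with 3 - a. Hence 0, 1 are left and right on the first sheet, but 2,
    3 are right and left on the second. The second copy of the 2 x 2 matrix thus sees left and right
    exchanged, which amounts to exchanging the over and the under strand. *)
Definition sheet_of (a : nat) : bool := if a is (0 | 1)%N then false else true.
Definition side_of (a : nat) : nat := if a is (1 | 2)%N then 1%N else 0%N.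

(** The right side is the entry of [Mcrossing]: offsets 2 and 3 are the rows 0 and 1 of the second
    copy, so that [odd a] is the row within a copy. On the left side, [fl] and [fr] are traded for
    columns because the strand from the left leaves to the right. *)
Lemma crossing_entry (F : fieldType) (x y : F) (R : realType) (m : nat)
    (C : seq (cpoint R m * cpoint R m * bool)) z (a b : nat) :
  uniq (points C) -> z \in C -> (a < 4)%N -> (b < 4)%N ->
  let fl := if z.2 then z.1.1 else z.1.2 in
  let fr := if z.2 then z.1.2 else z.1.1 in
  (sheet_of a == sheet_of b)%:R *
  weight x y C (sheet_of a) (if side_of a == 0%N then fl else fr)
    (if side_of b == 0%N then fr else fl) =
  if sheet_of a (+) sheet_of b then 0 else
  if odd a then (if odd b then (if z.2 then 0 else 1 - x^-1)
                 else (if z.2 then - (x * y^-1) else - y^-1))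
  else (if odd b then (if z.2 then - y else - (x^-1 * y))
        else (if z.2 then 1 - x else 0)).
Proof.
move=> uC zC a4 b4.
have [w1 w2 w3 w4] := weight_table x y uC false zC.
have [v1 v2 v3 v4] := weight_table x y uC true zC.
case: a b a4 b4 => [|[|[|[|]]]] // [|[|[|[|]]]] // _ _; case: z.2 w1 w2 w3 w4 v1 v2 v3 v4 => /= w1 w2 w3 w4 v1 v2 v3 v4;
by rewrite ?mul0r ?mul1r ?w1 ?w2 ?w3 ?w4 ?v1 ?v2 ?v3 ?v4.
Qed.

Lemma block_mx2E (p q r s : ratfun) (a b : 'I_(2 + 2)) :
  block_mx (mx2 p q r s) 0 0 (mx2 p q r s) a b =
  if sheet_of a (+) sheet_of b then 0 else
  if odd a then (if odd b then s else r) else (if odd b then q else p).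
Proof.
rewrite mxE; case: splitP => i ia; rewrite mxE; case: splitP => j jb; rewrite ?mxE ia jb;
by case: i ia => [[|[|]]] //= _ _; case: j jb => [[|[|]]].
Qed.

Section Ztilde.
Variables (R : realType) (m : nat) (D : diagram R m).
Local Notation n := (size (real_crossings D)).

Definition signed (z : cpoint R m * cpoint R m) : cpoint R m * cpoint R m * bool :=
  (z, positive_crossing D z).

Definition signed_crossings := map signed (real_crossings D).

Lemma points_signed : points signed_crossings = real_points D.
Proof. by rewrite /points /real_points -map_comp. Qed.

Lemma marked_split : perm_eq (marked D)
  (real_points D ++ (flatten [seq [:: z.1; z.2] | z <- virtual_crossings D] ++ bars D)).
Proof. by rewrite /marked /crossings map_cat flatten_cat -catA. Qed.

Lemma real_points_uniq : uniq (real_points D).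
Proof. by have := marked_uniq D; rewrite (perm_uniq marked_split) cat_uniq => /and3P[]. Qed.

Let uC : uniq (points signed_crossings).
Proof. by rewrite points_signed real_points_uniq. Qed.

Let N := (4 * n)%N.

(* Row k of the matrix is indexed by an incoming short edge, hence by a passage,
   column l by an outgoing short edge; the two passages of a crossing trade
   their places between the two. *)
Let twist (a : nat) : nat := nth 0%N [:: 2; 3; 1; 0]%N a.

Let twist_lt a : (a < 4)%N -> (twist a < 4)%N.
Proof. by case: a => [|[|[|[|]]]]. Qed.

Let twist_inj a b : (a < 4)%N -> (b < 4)%N -> twist a = twist b -> a = b.
Proof. by case: a => [|[|[|[|]]]] //; case: b => [|[|[|[|]]]]. Qed.

Let mod4 (k : nat) : (k %% 4 < 4)%N.
Proof. by rewrite ltn_mod. Qed.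

Let rot_fun_lt (k : 'I_N) : (4 * (k %/ 4) + twist (k %% 4) < N)%N.
Proof.
have := twist_lt (mod4 k).
have : (k %/ 4 < n)%N by rewrite ltn_divLR // mulnC.
by rewrite /N; lia.
Qed.

Let rot_fun (k : 'I_N) : 'I_N := Ordinal (rot_fun_lt k).

Let block_rot k : block (rot_fun k) = block k.
Proof.
have h := twist_lt (mod4 k); apply: val_inj => /=.
by rewrite mulnC divnMDl // (divn_small h) addn0.
Qed.

Let offset_rot k : offset (rot_fun k) = twist (offset k) :> nat.
Proof.
have h := twist_lt (mod4 k).
by rewrite /= mulnC modnMDl (modn_small h).
Qed.

Let ord_eq (k l : 'I_N) : block k = block l -> offset k = offset l :> nat -> k = l.
Proof.
move=> /(congr1 val) /= kl ol; apply: val_inj.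
by rewrite /= (divn_eq k 4) (divn_eq l 4) kl ol.
Qed.

Let rot_inj : injective rot_fun.
Proof.
move=> k l kl; apply: ord_eq; first by rewrite -block_rot kl block_rot.
by apply: twist_inj; rewrite ?mod4 // -!offset_rot kl.
Qed.

Let passage (k : 'I_N) : cpoint R m * bool :=
  let a := offset k : nat in (incoming (block k) (side_of a), sheet_of a).

Let out_passage (k : 'I_N) : cpoint R m * bool :=
  let a := offset k : nat in (outgoing (block k) (side_of a), sheet_of a).

Let out_passageE k : out_passage k = passage (rot_fun (rot_fun k)).
Proof.
rewrite /passage !block_rot !offset_rot /out_passage /incoming /outgoing.
by case: (offset k) => [[|[|[|[|]]]]].
Qed.

Let zi (i : 'I_n) := signed (nth_crossing i).

Let zi_in i : zi i \in signed_crossings.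
Proof. by apply: map_f; exact: mem_tnth. Qed.

Let zi_inj : injective zi.
Proof.
move=> i j /(congr1 fst) /= ij; apply: val_inj => /=; apply/eqP.
have := uniq_crossings false uC => /map_uniq u.
move: ij; rewrite /nth_crossing !(tnth_nth (nth_crossing i)) /= => /eqP.
by rewrite nth_uniq.
Qed.

Let incomingE (i : 'I_n) e : incoming i e = (zi i).1.1 \/ incoming i e = (zi i).1.2.
Proof. by rewrite /incoming /from_left /from_right; case: eqP => _; case: ifP; auto. Qed.

Let outgoingE (i : 'I_n) e : outgoing i e = (zi i).1.1 \/ outgoing i e = (zi i).1.2.
Proof. by rewrite /outgoing /from_left /from_right; case: eqP => _; case: ifP; auto. Qed.

Let weight_diff (i j : 'I_n) e l b : i != j ->
  weight xvar yvar signed_crossings b (incoming i e) (outgoing j l) = 0.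
Proof.
move=> ij; have nij : (zi j == zi i) = false by rewrite (inj_eq zi_inj) eq_sym (negbTE ij).
have u := upper_eq b uC (zi_in j) (zi_in i); have l0 := lower_eq b uC (zi_in j) (zi_in i).
have ul := upper_lower b uC (zi_in j) (zi_in i).
have lu := upper_lower b uC (zi_in i) (zi_in j).
rewrite nij in u l0; rewrite eq_sym in lu.
have pu p : p = upper b (zi i) \/ p = lower b (zi i) -> forall q,
   q = upper b (zi j) \/ q = lower b (zi j) -> weight xvar yvar signed_crossings b p q = 0.
  by move=> [] -> q [] ->; rewrite ?(weight_upper xvar yvar b uC _ (zi_in i)) ?(weight_lower xvar yvar b uC _ (zi_in i))
    ?u ?l0 ?ul ?lu ?mul0r ?addr0.
apply: pu.
  by case: (incomingE i e) => ->; rewrite /upper /lower; case: b {u l0 ul lu}; auto.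
by case: (outgoingE j l) => ->; rewrite /upper /lower; case: b {u l0 ul lu}; auto.
Qed.

Let ZE k l : (Mtilde D - Ptilde D) k l =
  net xvar yvar signed_crossings [::] (bars D) (passage k) (out_passage l).
Proof.
rewrite mxE [X in _ + X]mxE [Mtilde D _ _]mxE [Ptilde D _ _]mxE.
rewrite /net in_nil andbF addr0; congr (_ - _).
  have [kl|kl] := eqVneq (block k) (block l); last by rewrite weight_diff // mulr0.
  rewrite /passage /out_passage -kl /Mcrossing /incoming /outgoing /from_left /from_right.
  rewrite (crossing_entry xvar yvar uC (zi_in (block k))) //=.
  by case: positive_crossing; rewrite block_mx2E.
rewrite cats0 points_signed /arrow /passage /out_passage; cbv zeta.
set i := block k; set j := block l.
pose E (a b : nat) := is_edge D (outgoing j (side_of b)) (incoming i (side_of a)).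
pose O (a b : nat) := odd (edge_bars D (outgoing j (side_of b)) (incoming i (side_of a))).
(* The four relations in [Ptilde] correspond to the four pairs of sheets. *)
have L1 (a b : 'I_(2 + 2)) : even_arrow i a j b = [&& ~~ sheet_of a, ~~ sheet_of b, E a b & ~~ O a b].
  by rewrite /E /O; case: a => [[|[|[|[|]]]]] //; case: b => [[|[|[|[|]]]]].
have L2 (a b : 'I_(2 + 2)) : even_arrow i (3 - a) j (3 - b) = [&& sheet_of a, sheet_of b, E a b & ~~ O a b].
  by rewrite /E /O; case: a => [[|[|[|[|]]]]] //; case: b => [[|[|[|[|]]]]].
have L3 (a b : 'I_(2 + 2)) : odd_arrow i a j (3 - b) = [&& ~~ sheet_of a, sheet_of b, E a b & O a b].
  by rewrite /E /O; case: a => [[|[|[|[|]]]]] //; case: b => [[|[|[|[|]]]]].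
have L4 (a b : 'I_(2 + 2)) : odd_arrow i (3 - a) j b = [&& sheet_of a, ~~ sheet_of b, E a b & O a b].
  by rewrite /E /O; case: a => [[|[|[|[|]]]]] //; case: b => [[|[|[|[|]]]]].
rewrite L1 L2 L3 L4.
rewrite -[edge _ _ _]/(E (offset k) (offset l)) -[parity _ _ _]/(O (offset k) (offset l)).
rewrite [(_, sheet_of (offset k)).2]/= [(_, sheet_of (offset l)).2]/=.
by case: sheet_of; case: sheet_of; case: (E _ _); case: (O _ _).
Qed.

Theorem Ztilde_netdet : Ztilde D = netdet xvar yvar signed_crossings [::] (bars D).
Proof.
set A := net xvar yvar signed_crossings [::] (bars D).
pose M := \matrix_(k, l) A (passage k) (passage l).
pose rot := perm rot_inj.
have -> : Ztilde D = \det (col_perm (rot * rot)%g M).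
  congr (\det _); apply/matrixP => k l; rewrite ZE !mxE permM !permE.
  by rewrite out_passageE.
(* [twist] is a 4-cycle on the offsets whose square exchanges 0 with 1 and 2 with 3. Being written
   as a square, the column permutation is visibly even. *)
rewrite col_permE det_mulmx det_perm odd_permV odd_permM addbb mulr1.
rewrite /netdet cats0 points_signed.
pose t := map_tuple passage (ord_tuple N).
have -> : \det M = seq_det t A.
  by rewrite seq_det_tuple; congr (\det _); apply/matrixP => k l; rewrite !mxE !tnth_map !tnth_ord_tuple.
apply: seq_det_perm.
have us : uniq (sheets (real_points D)) by rewrite sheets_uniq real_points_uniq.
have sub : {subset sheets (real_points D) <= t}.
  move=> [p b]; rewrite mem_sheets /= => /flattenP[_ /mapP[z zD ->]] pz.
  have iz : (index z (real_crossings D) < n)%N by rewrite index_mem.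
  have zE : nth_crossing (Ordinal iz) = z.
    by rewrite /nth_crossing (tnth_nth z) /= nth_index.
  have pE : p = incoming (Ordinal iz) (p != from_left D z).
    rewrite /incoming zE; case: (p =P from_left D z) => //= pl.
    move: pz pl; rewrite !inE /from_left /from_right => /orP[] /eqP ->;
    by case: (positive_crossing D z).
  pose e := p != from_left D z; rewrite -/e in pE.
  (* The offset of the side e on the sheet b. *)
  pose a := (if b then 3 - e else e)%N.
  have a4 : (a < 4)%N by rewrite /a; case: (b); case: (e).
  have kN : (index z (real_crossings D) * 4 + a < N)%N by rewrite /N; lia.
  apply/mapP; exists (Ordinal kN); first by apply/tnthP; exists (Ordinal kN); rewrite tnth_ord_tuple.
  rewrite /passage; have -> : block (Ordinal kN) = Ordinal iz.
    by apply: val_inj; rewrite /= divnMDl // divn_small ?addn0.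
  have -> : offset (Ordinal kN) = a :> nat by rewrite /= modnMDl modn_small.
  by rewrite {1}pE /a; case: (b); case: (e).
have szt : size t = size (sheets (real_points D)).
  rewrite size_tuple -points_signed /sheets size_allpairs /points size_flatten /shape -!map_comp.
  rewrite (eq_map (g := fun=> 2%N)) // /N.
  by elim: (real_crossings D) => //= z s; lia.
(* Each lift of a real passage occurs among the 4n indices, and there are 4n such lifts, so none
   occurs twice. *)
have [_ tE] := uniq_min_size us sub (eq_leq szt).
by apply: uniq_perm => //; rewrite (uniq_size_uniq us tE) szt.
Qed.

End Ztilde.

(** * Velocities and isotopies *)

Section Derivatives.
Local Open Scope classical_set_scope.
Local Open Scope ring_scope.
Variable R : realType.

Lemma derive1_affine (V : normedModType R) (g : R -> V) (c s u : R) :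
  derivable g (c + s * u) 1 ->
  derive1 (fun w => g (c + s * w)) u = s *: derive1 g (c + s * u).
Proof.
move=> dg; have dfg : differentiable g (c + s * u) by apply/derivable1_diffP.
rewrite !derive1E [in RHS]deriveE // -linearZ /=.
rewrite [_ *: _]mulr1 -deriveE //; rewrite /derive.
pose d (h : R) := h^-1 *: (g (c + s * (h * 1 + u)) - g (c + s * u)).
pose d' (h : R) := h^-1 *: (g (h * s + (c + s * u)) - g (c + s * u)).
rewrite -[LHS]/(lim (d @ 0^')) -[RHS]/(lim (d' @ 0^')).
suff -> : d = d' by []; rewrite funeqE => h; rewrite /d /d'; congr (_ *: (g _ - _)).
by ring.
Qed.

Lemma near_derive1 (V : normedModType R) (f g : R -> V) (t : R) :
  (\near t, f t = g t) -> derive1 f t = derive1 g t.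
Proof. by move=> fg; rewrite !derive1E; apply: near_eq_derive. Qed.

Lemma derive1_pair (f g : R -> R^o) (t : R) :
  derivable f t 1 -> derivable g t 1 ->
  derive1 (fun u => (f u, g u) : plane R) t = (derive1 f t, derive1 g t).
Proof.
move=> df dg; have Df : differentiable f t by apply/derivable1_diffP.
have Dg : differentiable g t by apply/derivable1_diffP.
have Dfg : differentiable (fun u => (f u, g u) : plane R) t by apply: differentiable_pair.
by rewrite !derive1E !deriveE // diff_pair.
Qed.

Lemma derive1_periodic (V : normedModType R) (g : R -> V) t :
  (forall u, g (u + 1) = g u) -> derive1 g (t + 1) = derive1 g t.
Proof.
move=> gp; rewrite /derive1.
set d := (fun _ : R => _); set d' := (fun _ : R => _).
by suff -> : d = d' by []; rewrite funeqE => h; rewrite /d /d' addrA !gp.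
Qed.

Lemma periodic_int (T : Type) (g : R -> T) t (n : int) :
  (forall u, g (u + 1) = g u) -> g (t - n%:~R) = g t.
Proof.
move=> gp; have gn u (k : nat) : g (u + k%:R) = g u.
  by elim: k u => [|k IHk] u; rewrite ?addr0 // -natr1 addrA gp IHk.
by case: n => k; rewrite ?NegzE ?mulrNz ?opprK ?gn // -[in RHS](subrK k%:R t) gn.
Qed.

End Derivatives.

Section Velocities.
Local Open Scope classical_set_scope.
Local Open Scope ring_scope.
Variables (R : realType) (m : nat).

Lemma velocity_place k (D : diagram R m) (pl : placement R m k) (P : picture R k)
    rc bs z : shows D pl P rc bs -> -1 < z.2 < 1 ->
  derive1 (tnth (strands P) z.1) z.2 = pl_speed pl z.1 *: velocity D (place pl z).
Proof.
case: z => j u [Dpl _ _ _] /= /andP[u1 u2].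
rewrite /velocity /place /= -derive1_affine; last by have [] := curve_C1 D (pl_circle pl j).
apply: near_derive1; near=> w; rewrite -(Dpl (j, w)) //; apply/andP; split; rewrite /=; apply/ltW.
  by near: w; exact: lt_nbhsr.
by near: w; exact: lt_nbhsl.
Unshelve. all: by end_near. Qed.

Lemma on_circle_place k (pl : placement R m k) z : placement_ok pl -> on_strand z ->
  0 < (place pl z).2 < 1.
Proof.
move=> [ok _] /andP[z1 z2]; have [_ [h1 h2]] := ok z.1.
have : `|pl_speed pl z.1 * z.2| <= `|pl_speed pl z.1|.
  by rewrite normrM ler_piMr // ler_norml z1 z2.
rewrite ler_norml /= => /andP[a b]; lra.
Qed.

Lemma coveredP k (pl : placement R m k) p : placement_ok pl ->
  covered pl p <-> exists2 j, p.1 = pl_circle pl j & `|p.2 - pl_center pl j| <= `|pl_speed pl j|.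
Proof.
move=> [ok _]; split=> [[[j u] /andP[u1 u2] ->]|[j pj pc]].
  exists j => //; rewrite /place /= addrAC subrr add0r normrM ler_piMr // ler_norml.
  by rewrite u1 u2.
have [s0 _] := ok j.
exists (j, (p.2 - pl_center pl j) / pl_speed pl j).
  have : `|(p.2 - pl_center pl j) / pl_speed pl j| <= 1.
    by rewrite normrM normfV ler_pdivrMr ?normr_gt0 // mul1r.
  by rewrite ler_norml.
rewrite /place /= mulrC divfK //; case: p pj {pc} => c t /= ->; congr pair; ring.
Qed.

(** The covered times form finitely many closed intervals, so the two curves agree near an uncovered
    point and not only at it. This keeps the signs of the crossings outside of the square. *)
Lemma velocity_outside k (D D' : diagram R m) (pl : placement R m k) :
  placement_ok pl ->
  (forall p, on_circle p -> ~ covered pl p -> at_point D' p = at_point D p) ->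
  forall p, on_circle p -> ~ covered pl p -> velocity D' p = velocity D p.
Proof.
move=> ok DD' [c t] oc ncov; have [t0 t1] : 0 <= t /\ t < 1 by apply/andP.
apply: near_derive1 => /=.
have nearcov v : (forall j, c = pl_circle pl j -> `|pl_speed pl j| < `|v - pl_center pl j|) ->
    \near v, ~ covered pl (c, v).
  move=> nc; have : \forall w \near v, forall j, c = pl_circle pl j ->
      `|pl_speed pl j| < `|w - pl_center pl j|.
    apply: (@filter_forall _ 'I_k (fun j (w : R) => c = pl_circle pl j ->
      `|pl_speed pl j| < `|w - pl_center pl j|) (nbhs v) _) => j; case: (pselect (c = pl_circle pl j)) => cj; last by apply: nearW => w /cj.
    have cont : (fun w : R => `|w - pl_center pl j|) @ v --> `|v - pl_center pl j|.
      by apply: cvg_norm; apply: cvgB; [exact: cvg_id | exact: cvg_cst].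
    have H : \forall w \near v, `|pl_speed pl j| < `|w - pl_center pl j|.
      exact: cont _ (lt_nbhsr (nc j cj)).
    by apply: filterS H.
  apply: filterS => w H /(coveredP _ ok)[j /= cj]; rewrite leNgt => /negP; apply.
  exact: H.
have nct : forall j, c = pl_circle pl j -> `|pl_speed pl j| < `|t - pl_center pl j|.
  move=> j cj; rewrite ltNge; apply/negP => le; apply: ncov; apply/(coveredP _ ok).
  by exists j.
(* For t = 0 the neighbourhood contains negative times w, which are read at w + 1; so a
   neighbourhood of t + 1 has to be uncovered too. *)
have nct1 : forall j, c = pl_circle pl j -> `|pl_speed pl j| < `|t + 1 - pl_center pl j|.
  move=> j cj; have [okj _] := ok; have [_ [_ h]] := okj j.
  rewrite ltr_normr; apply/orP; left; lra.
have N1 := nearcov t nct.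
have N2 : \near t, ~ covered pl (c, t + 1).
  have := nearcov (t + 1) nct1; rewrite (near_shift t).
  by apply: filterS => w /=; rewrite (addrAC t 1) subrr add0r.
have N3 : \near t, -1 < t by apply: lt_nbhsr; lra.
have N4 : \near t, t < 1 by apply: lt_nbhsl.
near=> w.
have n1 : ~ covered pl (c, w) by near: w.
have n2 : ~ covered pl (c, w + 1) by near: w.
have n3 : -1 < w by near: w.
have n4 : w < 1 by near: w.
have [w0|w0] := lerP 0 w; first by apply: (DD' (c, w)) => //; rewrite /on_circle /= w0.
rewrite -[LHS]curve_periodic -[RHS]curve_periodic; apply: (DD' (c, w + 1)) => //.
by rewrite /on_circle /=; apply/andP; split; lra.
Unshelve. all: by end_near. Qed.

End Velocities.

Section Isotopy.
Local Open Scope classical_set_scope.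
Local Open Scope ring_scope.
Variables (R : realType).

Definition jacobian_det (g : plane R -> plane R) (v : plane R) : R :=
  det2 ('D_(1, 0) g v) ('D_(0, 1) g v).

Lemma det2_derive (g : plane R -> plane R) (v a b : plane R) : differentiable g v ->
  det2 ('D_a g v) ('D_b g v) = jacobian_det g v * det2 a b.
Proof.
move=> dg; have dE w : 'D_w g v = w.1 *: 'D_(1, 0) g v + w.2 *: 'D_(0, 1) g v.
  rewrite !deriveE // -!linearZ -linearD; congr ('d g v _).
  apply: injective_projections.
    by rewrite -[RHS]/(w.1 * 1 + w.2 * 0); ring.
  by rewrite -[RHS]/(w.1 * 0 + w.2 * 1); ring.
rewrite (dE a) (dE b) /jacobian_det.
move: ('D_(1, 0) g v) ('D_(0, 1) g v) => u w.
rewrite -[LHS]/((a.1 * u.1 + a.2 * w.1) * (b.1 * u.2 + b.2 * w.2)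
  - (a.1 * u.2 + a.2 * w.2) * (b.1 * u.1 + b.2 * w.1)) /det2; ring.
Qed.

Lemma det2Z (a b : R) (v w : plane R) : det2 (a *: v) (b *: w) = a * b * det2 v w.
Proof.
rewrite -[LHS]/((a * v.1) * (b * w.2) - (a * v.2) * (b * w.1)) /det2; ring.
Qed.

Lemma jacobian_det_gt0 (H : R -> plane R -> plane R) (v : plane R) :
  ambient_isotopy H -> 0 < jacobian_det (H 1) v.
Proof.
move=> [[H0 _ _ _ Hcont] Hdet].
have cont (e : plane R) : continuous (fun s : R => 'D_e (H s) v).
  move=> s.
  apply: (@continuous_comp _ _ _ (fun s : R => (s, v)) (fun z : R * plane R => 'D_e (H z.1) z.2)).
    by apply: (@cvg_pair _ _ _ _ (nbhs s) (nbhs v) _ _ _ id (cst v)); [exact: cvg_id | exact: cvg_cst].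
  exact: Hcont.
have cont1 e : continuous (fun s : R => ('D_e (H s) v).1 : R).
  by move=> s; apply: (continuous_comp (cont e s)); exact: cvg_fst.
have cont2 e : continuous (fun s : R => ('D_e (H s) v).2 : R).
  by move=> s; apply: (continuous_comp (cont e s)); exact: cvg_snd.
pose J (s : R) := jacobian_det (H s) v.
have Jc : continuous J.
  by move=> s; apply: cvgB; apply: cvgM; (exact: cont1 || exact: cont2).
have J0 : J 0 = 1.
  have -> : J 0 = jacobian_det id v by congr (jacobian_det _ v); apply/funext.
  by rewrite /jacobian_det !derive_id /det2 /= mulr1 mulr0 subr0.
rewrite ltNge; apply/negP => J1.
have [s _ Js] : exists2 s, s \in `[0 : R, 1] & J s = 0.
  apply: IVT => //; first exact: continuous_subspaceT.
  by rewrite J0 ge_min J1 orbT le_max ler01.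
by have := Hdet s v; rewrite -/(jacobian_det _ _) -/(J s) Js eqxx.
Qed.

Variables (m : nat) (D D' : diagram R m) (H : R -> plane R -> plane R).
Variables (sigma : 'S_m) (h : 'I_m -> R -> R).
Hypothesis isoH : ambient_isotopy H.
Hypothesis diffeo_h : forall c, circle_diffeo (h c).
Hypothesis curveE : forall c t, curve D' (sigma c) (h c t) = H 1 (curve D c t).

Lemma velocity_reparam p :
  derive1 (h p.1 : R -> R^o) p.2 *: velocity D' (reparam sigma h p) =
  'D_(velocity D p) (H 1) (at_point D p).
Proof.
have [[_ _ _ Hd _] _] := isoH.
have [hp [hd _] _] := diffeo_h p.1.
have [cd _] := curve_C1 D p.1; have [cd' _] := curve_C1 D' (sigma p.1).
have -> : velocity D' (reparam sigma h p) = derive1 (curve D' (sigma p.1)) (h p.1 p.2).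
  rewrite /velocity /reparam /frac_part /=; apply: periodic_int => u.
  by apply: derive1_periodic; exact: curve_periodic.
have dc : differentiable (curve D p.1) p.2 by apply/derivable1_diffP.
have dc' : differentiable (curve D' (sigma p.1)) (h p.1 p.2) by apply/derivable1_diffP.
have dh : differentiable (h p.1 : R -> R^o) p.2 by apply/derivable1_diffP.
have E : curve D' (sigma p.1) \o h p.1 = H 1 \o curve D p.1.
  by apply/funext => t /=; rewrite curveE.
set t := p.2 in dc dc' dh *.
have hE : 'd (h p.1 : R -> R^o) t (1 : R) = derive1 (h p.1 : R -> R^o) t.
  by rewrite derive1E'.
have L1 : 'd (curve D' (sigma p.1) \o (h p.1 : R -> R^o)) t (1 : R) =
    derive1 (h p.1 : R -> R^o) t *: derive1 (curve D' (sigma p.1)) (h p.1 t).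
  rewrite diff_comp //= hE (derive1E' dc') -linearZ /=; congr ('d _ _ _).
  by rewrite [RHS]mulr1.
have L2 : 'd (H 1 \o curve D p.1) t (1 : R) = 'D_(derive1 (curve D p.1) t) (H 1) (curve D p.1 t).
  by rewrite diff_comp //= deriveE // derive1E'.
by rewrite -L1 E L2.
Qed.

Lemma positive_reparam z : z \in crossings D ->
  positive_crossing D' (reparam sigma h z.1, reparam sigma h z.2) = positive_crossing D z.
Proof.
move=> zD; have [[_ _ _ Hd _] _] := isoH.
(* Both passages lie over one double point, so the same derivative of [H 1] maps both velocities. *)
have same : at_point D z.2 = at_point D z.1.
  have [z1 z2 z12] : [/\ on_circle z.1, on_circle z.2 & z.1 != z.2].
    have zm p : p \in [:: z.1; z.2] -> p \in marked D.
      move=> pz; rewrite mem_cat; apply/orP; left; apply/flattenP.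
      by exists [:: z.1; z.2] => //; apply: map_f.
    have /allP ma := marked_on_circle D.
    split; try by apply: ma; apply: zm; rewrite !inE eqxx ?orbT.
    have := marked_uniq D; rewrite /marked cat_uniq => /andP[+ _].
    elim: (crossings D) zD => //= w s IHs; rewrite inE => /orP[/eqP <-|zs]; last first.
      by move=> /and3P[_ _ /IHs]; apply.
    by rewrite inE negb_or => /andP[/andP[]].
  by have [_ H2] := double_points D z1 z2 z12; apply/esym/H2; left; rewrite -surjective_pairing.
rewrite /positive_crossing /=.
have d1 := (diffeo_h z.1.1); have d2 := (diffeo_h z.2.1).
have [_ _ /(_ z.1.2) h1] := d1; have [_ _ /(_ z.2.2) h2] := d2.
have V1 := velocity_reparam z.1; have V2 := velocity_reparam z.2.
rewrite same in V2.
have E := @det2_derive (H 1) (at_point D z.1) (velocity D z.1) (velocity D z.2) (Hd _ _).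
have {V1 V2}E := etrans (f_equal2 (@det2 R) V1 V2) E.
have {}E := etrans (esym (det2Z _ _ _ _)) E.
move: E; set a := derive1 _ _ in h1 *; set b := derive1 _ _ in h2 * => E.
have sgn (p q k X Y : R) : 0 < p -> 0 < q -> 0 < k -> p * q * X = k * Y ->
    (0 < X) = (0 < Y).
  by move=> p0 q0 k0 XY; rewrite -(pmulr_rgt0 X (mulr_gt0 p0 q0)) XY pmulr_rgt0.
exact: sgn h1 h2 (jacobian_det_gt0 (at_point D z.1) isoH) E.
Qed.

End Isotopy.

(** * Derivatives of the strands of the pictures *)

Section StrandDerivatives.
Local Open Scope classical_set_scope.
Local Open Scope ring_scope.
Variable R : realType.
Implicit Types u : R.

Lemma is_derive_hump u : is_derive u 1 (@hump R : R -> R^o) (- 4 * u * (1 - u ^+ 2)).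
Proof.
have -> : (@hump R : R -> R^o) = (cst 1 - (id : R -> R) ^+ 2) ^+ 2 by apply/funext.
apply: is_derive_eq.
rewrite -[LHS]/((2%:R * (1 - u ^+ 2) ^+ 1) * (0 - (2%:R * u ^+ 1) * 1)); ring.
Qed.

Lemma is_derive_wiggle u : is_derive u 1 (@wiggle R : R -> R^o)
  (1 - 16 / 9 * hump u + u * (16 / 9 * (4 * u * (1 - u ^+ 2)))).
Proof.
have -> : (@wiggle R : R -> R^o) = (id : R -> R) * (cst 1 - (16 / 9) *: (@hump R : R -> R^o)).
  by apply/funext.
have := is_derive_hump u => dh.
apply: is_derive_eq.
rewrite -[LHS]/(u * (0 - (16 / 9) * (- 4 * u * (1 - u ^+ 2))) + (1 - (16 / 9) * hump u) * 1); ring.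
Qed.

Lemma is_derive_affine_hump (a k u : R) :
  is_derive u 1 (fun w => a + k * hump w : R^o) (k * (- 4 * u * (1 - u ^+ 2))).
Proof.
have -> : (fun w => a + k * hump w : R^o) = cst a + k *: (@hump R : R -> R^o).
  by apply/funext.
have d1 := @is_deriveZ _ _ _ (@hump R : R -> R^o) k u 1 _ (is_derive_hump u).
have d2 := @is_deriveD _ _ _ _ _ u 1 _ _ (is_derive_cst (a : R^o) u (1 : R)) d1.
apply: (is_derive_eq d2).
by rewrite -[LHS]/(0 + k * (- 4 * u * (1 - u ^+ 2))) add0r.
Qed.

Lemma is_derive_diagonal u : is_derive u 1 ((fun w => w) : R -> R^o) 1.
Proof. exact: (is_derive_id u (1 : R)). Qed.

Lemma is_derive_opp u : is_derive u 1 ((fun w => - w) : R -> R^o) (- 1).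
Proof. exact: (@is_deriveN _ _ _ (id : R -> R^o) u 1 1 (is_derive_id u (1 : R))). Qed.

Lemma derive1_val (f : R -> R^o) u (df : R) : is_derive u 1 f df ->
  derivable f u 1 /\ derive1 f u = df.
Proof. by move=> [fd fE]; rewrite derive1E. Qed.

Lemma derive1_graph (f : R -> R) u (df : R) : is_derive u 1 (f : R -> R^o) df ->
  derive1 (graph_of f) u = (1, df).
Proof.
move=> /derive1_val[fd fE]; have [id1 idE] := derive1_val (is_derive_id u (1 : R)).
by rewrite [LHS](derive1_pair id1 fd) fE idE.
Qed.

End StrandDerivatives.

(** * The determinant with base points *)

Section Passive.
Variables (F : fieldType) (x y : F) (R : realType) (m : nat).
Local Notation point := (cpoint R m).
Local Notation crossing := (point * point * bool)%type.

Lemma netdet_passive (C : seq crossing) (Q P B : seq point) :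
  uniq Q -> (forall q, q \in Q -> [/\ q \notin points C ++ P, q \notin B &
     exists2 r, r \in points C ++ P & r.1 = q.1]) ->
  netdet x y C (Q ++ P) B = netdet x y C P B.
Proof.
elim: Q => //= q Q IHQ /andP[qQ uQ] H.
have [qP qB [r rP rq]] := H q (mem_head _ _).
rewrite -IHQ // => [|q' q'Q]; last by apply: H; rewrite inE q'Q orbT.
apply: netdet_cons rq => //; move: qP rP; rewrite !mem_cat !negb_or.
  by move=> /andP[-> ->]; rewrite qQ.
by move=> _ /orP[] ->; rewrite ?orbT.
Qed.
End Passive.

Section Zbar.
Variables (R : realType) (m : nat).
Local Notation point := (cpoint R m).
Implicit Types D : diagram R m.

(* One passage of degree two on every circle, just before its base point 0: no
   marked point has the time 1. Circles without real crossings, on which Ztilde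
   has no grip, may appear in the middle of a sequence of moves. *)
Definition base_points : seq point := [seq (c, 1) | c <- enum 'I_m].

Definition Zbar D : ratfun := netdet xvar yvar (signed_crossings D) base_points (bars D).

Lemma mem_base_points p : (p \in base_points) = (p.2 == 1).
Proof.
apply/mapP/eqP => [[c _ ->] //|]; case: p => c t /= ->; exists c => //.
by rewrite mem_enum.
Qed.

Lemma base_points_uniq : uniq base_points.
Proof. by rewrite map_inj_uniq ?enum_uniq // => c d []. Qed.

Lemma real_points_on_circle D p : p \in real_points D -> on_circle p.
Proof.
move=> pD; have /allP := marked_on_circle D; apply.
by rewrite (perm_mem (marked_split D)) mem_cat pD.
Qed.

Lemma bars_on_circle D p : p \in bars D -> on_circle p.
Proof.
move=> pD; have /allP := marked_on_circle D; apply.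
by rewrite mem_cat pD orbT.
Qed.

Lemma on_circle_base p : on_circle p -> p \notin base_points.
Proof. by rewrite mem_base_points => /andP[_ p1]; rewrite lt_eqF. Qed.

Lemma Zbar_passive D (P : seq point) : uniq P ->
  (forall p, p \in P -> [/\ p \notin real_points D, p \notin bars D & on_circle p]) ->
  netdet xvar yvar (signed_crossings D) (P ++ base_points) (bars D) = Zbar D.
Proof.
move=> uP HP; apply: netdet_passive => // p pP; have [pr pb oc] := HP p pP.
split=> //; first by rewrite mem_cat points_signed negb_or pr on_circle_base.
by exists (p.1, 1) => //; rewrite mem_cat mem_base_points eqxx orbT.
Qed.

(** Once P meets every circle without real crossings, the base points become ordinary passages of
    degree two and can be removed. An isotopy does not preserve base points, so other choices of P
    are needed. *)
Lemma Zbar_any D (P : seq point) : uniq P ->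
  (forall p, p \in P -> [/\ p \notin real_points D, p \notin bars D & on_circle p]) ->
  (forall c, exists2 p, p \in real_points D ++ P & p.1 = c) ->
  netdet xvar yvar (signed_crossings D) P (bars D) = Zbar D.
Proof.
move=> uP HP full; rewrite -(Zbar_passive uP HP).
rewrite (netdet_perm _ _ (perm_refl _) (permEl (perm_catC P base_points)) (perm_refl _)).
rewrite netdet_passive ?base_points_uniq // => p; rewrite mem_base_points => p1.
have notc q : on_circle q -> p != q.
  by move=> /andP[_ q1]; apply: contraTneq q1 => <-; rewrite (eqP p1) ltxx.
split; last by rewrite points_signed; exact: full.
  rewrite points_signed mem_cat negb_or; apply/andP; split; apply/negP.
    by move=> /real_points_on_circle /notc; rewrite eqxx.
  by move=> /HP[_ _ /notc]; rewrite eqxx.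
by apply/negP => /bars_on_circle /notc; rewrite eqxx.
Qed.

Lemma Zbar_four_valent D : four_valent D -> Zbar D = Ztilde D.
Proof.
move=> fD; rewrite Ztilde_netdet -(@Zbar_any D [::]) // => c.
by have [p pD pc] := fD c; exists p => //; rewrite cats0.
Qed.

(** Pigeonhole: on the circle c there are one more multiples of 1/(size s + 1) in [0, 1) than points
    in s. *)
Lemma exists_unmarked (c : 'I_m) (s : seq point) : exists2 t : R, 0 <= t < 1 & (c, t) \notin s.
Proof.
pose f (i : 'I_(size s).+1) : point := (c, i%:R / (size s).+1%:R).
have fi : injective f.
  move=> i j [] /mulIf H; apply/val_inj/eqP; rewrite -(eqr_nat R); apply/eqP/H.
  by rewrite invr_eq0 pnatr_eq0.
have [/allP H|/allPn[p]] := boolP (all (fun p => p \in s) (codom f)); last first.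
  case/codomP => i -> fs; exists (i%:R / (size s).+1%:R) => //.
  by rewrite divr_ge0 ?ler0n //= ltr_pdivrMr ?ltr0n // mul1r ltr_nat.
have := uniq_leq_size (s1 := codom f) (s2 := s); rewrite map_inj_uniq ?enum_uniq //.
by move=> /(_ isT H); rewrite size_codom card_ord ltnn.
Qed.

End Zbar.

(** * Invariance under planar isotopy *)

Section Isotopy.
Variables (R : realType).

(** All three numbers lie in a window of length 1, so taking fractional parts only rotates the
    circle. *)
Lemma cyclic_frac_part (l a b c : R) :
  l <= a < l + 1 -> l <= b < l + 1 -> l <= c < l + 1 ->
  cyclic (frac_part a) (frac_part b) (frac_part c) = cyclic a b c.
Proof.
pose n : R := (Num.floor l)%:~R.
have [nl ln] : n <= l /\ l < n + 1.
  by have := floor_itv l; rewrite intrD => /andP[].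
(* Within the window the fractional part can only jump at n + 1. *)
pose k u : bool := n + 1 <= u.
have fE u : l <= u < l + 1 -> frac_part u = if k u then u - n - 1 else u - n.
  move=> /andP[lu ul]; rewrite /k; case: (lerP (n + 1) u) => [nu|un]; last first.
    rewrite /frac_part; congr (_ - _%:~R); apply: floor_def.
    by rewrite intrD -/n un (le_trans nl lu).
  rewrite /frac_part (_ : Num.floor u = Num.floor l + 1) ?intrD ?opprD ?addrA //.
  by apply: floor_def; rewrite !intrD -/n; apply/andP; split; lra.
have ltE u v : l <= u < l + 1 -> l <= v < l + 1 ->
    (frac_part u < frac_part v) = if k u == k v then u < v else v < u.
  move=> hu hv; rewrite (fE _ hu) (fE _ hv) /k; move: hu hv => /andP[? ?] /andP[? ?].
  by case: (lerP (n + 1) u) => ?; case: (lerP (n + 1) v) => ? /=; apply/idP/idP => ?; lra.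
have hl u v : k u = false -> k v = true -> ((u < v) = true) * ((v < u) = false).
  move=> /negbT; rewrite /k -ltNge => un nv; split; first exact: lt_le_trans un nv.
  by apply/negbTE; rewrite -leNgt ltW // (lt_le_trans un nv).
move=> ha hb hc; rewrite /cyclic (ltE a b) // (ltE a c) // (ltE c b) //.
case ka: (k a); case kb: (k b); case kc: (k c) => //=;
 try rewrite !(hl _ _ ka kb); try rewrite !(hl _ _ kb ka); try rewrite !(hl _ _ ka kc);
 try rewrite !(hl _ _ kc ka); try rewrite !(hl _ _ kb kc); try rewrite !(hl _ _ kc kb);
 rewrite ?andbT ?orbF ?andbF ?orbT //=.
all: by case: (ltrgtP a b) => ab; case: (ltrgtP a c) => ac; case: (ltrgtP c b) => cb //=; exfalso; lra.
Qed.

Lemma circle_diffeo_incr (h : R -> R) : circle_diffeo h -> {mono h : a b / a <= b}.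
Proof.
move=> [hp [hd _] h0]; apply: le_mono => a b ab.
apply: (@gtr0_derive1_incr R (h : R -> R^o) a b) => //.
  by apply: derivable_within_continuous => t _; exact: hd.
Qed.

Lemma circle_diffeo_range (h : R -> R) t : circle_diffeo h -> 0 <= t < 1 ->
  h 0 <= h t < h 0 + 1.
Proof.
move=> hd /andP[t0 t1]; have := circle_diffeo_incr hd => hi.
have [hp _ _] := hd; rewrite hi t0 -hp add0r.
by rewrite (leW_mono hi).
Qed.

Lemma signed_crossings_map m (D D' : diagram R m) (g : Defs.cpoint R m -> Defs.cpoint R m) :
  perm_eq (real_crossings D') [seq (g z.1, g z.2) | z <- real_crossings D] ->
  (forall z, z \in real_crossings D ->
     positive_crossing D' (g z.1, g z.2) = positive_crossing D z) ->
  perm_eq (signed_crossings D') (map (relabel g) (signed_crossings D)).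
Proof.
move=> rcE sgn.
have -> : map (relabel g) (signed_crossings D) =
    map (signed D') [seq (g z.1, g z.2) | z <- real_crossings D].
  rewrite -!map_comp; apply/eq_in_map => z zD.
  by rewrite /= /signed /relabel /= (sgn z zD).
exact: perm_map.
Qed.

Lemma Zbar_isotopic m (D D' : diagram R m) : planar_isotopic D D' -> Zbar D' = Zbar D.
Proof.
move=> [H [sigma [h [isoH dh curveE rcE barsE]]]]; pose g := reparam sigma h.
have gE p : g p = (sigma p.1, frac_part (h p.1 p.2)) by [].
have g_circle p q : ((g p).1 == (g q).1) = (p.1 == q.1).
  by rewrite !gE /= (inj_eq (@perm_inj _ sigma)).
have g_between p q r : on_circle p -> on_circle q -> on_circle r -> p.1 = q.1 ->
    between (g p) (g q) (g r) = between p q r.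
  move=> po qo ro pq; rewrite !betweenE g_circle; case: (r.1 =P p.1) => //= rp.
  rewrite -pq rp (@cyclic_frac_part (h p.1 0)); try exact: circle_diffeo_range.
  by have hm := leW_mono (circle_diffeo_incr (dh p.1)); rewrite /cyclic !hm.
have g_inj p q : on_circle p -> on_circle q -> g p = g q -> p = q.
  move=> po qo gpq; have pq : p.1 = q.1 by apply/eqP; rewrite -g_circle gpq.
  apply/eqP; case: eqP => // /eqP neq.
  by have := between_before q pq neq; rewrite betweenr /= -(g_between q q p) // gpq betweenr.
have on_g p : on_circle (g p).
  rewrite /on_circle gE /= /frac_part; have := floor_itv (h p.1 p.2).
  by rewrite intrD => /andP[a b]; apply/andP; split; lra.
(* A base point has time 1, outside the range of [reparam]; an unmarked point on each circle
   replaces it and is carried along by g. *)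
have /fin_all_exists2[t t01 tD] c := exists_unmarked c (real_points D ++ bars D).
pose P : seq (Defs.cpoint R m) := [seq (c, t c) | c <- enum 'I_m].
have uP : uniq P by rewrite map_inj_uniq ?enum_uniq // => c d [].
have HP p : p \in P -> [/\ p \notin real_points D, p \notin bars D & on_circle p].
  by case/mapP => c _ ->; have := tD c; rewrite mem_cat negb_or => /andP[-> ->]; split=> //; exact: t01.
have signedE : perm_eq (signed_crossings D') (map (relabel g) (signed_crossings D)).
  apply: (signed_crossings_map rcE) => z zD.
  by apply: (positive_reparam isoH dh curveE); rewrite mem_cat zD.
have real' p : (g p \in real_points D') = (g p \in map g (real_points D)).
  rewrite -(points_signed D') (perm_mem (points_perm signedE)) points_relabel.
  by rewrite points_signed.
have memg s p : (forall q, q \in s -> on_circle q) -> on_circle p ->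
    g p \in map g s -> p \in s.
  move=> sc pc /mapP[q qs gpq]; have -> // : p = q.
  by apply: g_inj => //; exact: sc.
rewrite -(@Zbar_any R m D P) //; last first.
  move=> c; exists (c, t c) => //; rewrite mem_cat; apply/orP; right.
  by apply: map_f; rewrite mem_enum.
have gP_on p : p \in points (signed_crossings D) ++ P -> on_circle p.
  by rewrite points_signed mem_cat => /orP[/real_points_on_circle //|/HP[]].
rewrite -(@Zbar_any R m D' (map g P)); first last.
- move=> c; exists (g ((sigma^-1)%g c, t ((sigma^-1)%g c))); last by rewrite gE permKV.
  rewrite mem_cat; apply/orP; right; apply: map_f; apply: (map_f (fun c => (c, t c))).
  by rewrite mem_enum.
- move=> p /mapP[q qP ->]; have [qr qb qc] := HP q qP; split=> //.
    rewrite real'; apply: contra qr; apply: memg => // r; exact: real_points_on_circle.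
  rewrite (perm_mem barsE); apply: contra qb; apply: memg => // r; exact: bars_on_circle.
- rewrite map_inj_in_uniq // => p q pP qP; apply: g_inj; first by have [] := HP p pP.
  by have [] := HP q qP.
rewrite (netdet_perm _ _ signedE (perm_refl _) barsE); apply: netdet_relabel.
- by move=> p q /gP_on po /gP_on qo; exact: g_inj.
- move=> p q r /gP_on po /gP_on qo; rewrite mem_cat => /orP[/gP_on|/bars_on_circle] ro;
  exact: g_between.
- by move=> p q _ _; exact: g_circle.
Qed.

End Isotopy.

(** * Pictures in a diagram *)

Section Consecutive.
Variable R : realType.

Lemma zip_consecutive (u v : R) (s : seq R) a : path <%R u (rcons s v) ->
  a \in zip (u :: s) (rcons s v) ->
  [/\ u <= a.1, a.1 < a.2, a.2 <= v & forall t, t \in s -> (t <= a.1) || (a.2 <= t)].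
Proof.
elim: s u => [|w s IHs] u /=; first by rewrite inE andbT => uv /eqP ->; split=> //.
case/andP => uw pw; have wv : w < v.
  have := order_path_min lt_trans pw; rewrite all_rcons => /andP[]. by [].
rewrite inE => /orP[/eqP -> /=|aw].
  split=> //; first exact: ltW.
  move=> t; rewrite inE => /orP[/eqP ->|ts]; first by rewrite lexx orbT.
  have /allP H := order_path_min lt_trans pw.
  by rewrite (ltW (H t _)) ?orbT // mem_rcons inE ts orbT.
have [H1 H2 H3 H4] := IHs w pw aw; split=> //; first exact: le_trans (ltW uw) H1.
by move=> t; rewrite inE => /orP[/eqP ->|/H4 //]; rewrite H1.
Qed.

Lemma cyclic_enter (a b t u : R) : u < t -> ~~ (u <= a < t) -> cyclic a b t -> cyclic a b u.
Proof.
rewrite /cyclic negb_and -ltNge -leNgt => ut ha.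
case: (ltrP a b) => ab; case: (ltrP a t) => at_; case: (ltrP t b) => tb //=;
case: (ltrP a u) => au; case: (ltrP u b) => ub //= _; case/orP: ha => ?; exfalso; lra.
Qed.
End Consecutive.

Section Placement.
Variables (R : realType) (m k : nat) (pl : placement R m k).
Hypothesis ok : placement_ok pl.
Local Notation point := (cpoint R m).

Definition forwards (j : 'I_k) : bool := 0 < pl_speed pl j.
Definition start (j : 'I_k) : R := if forwards j then -1 else 1.
Definition entry j : point := place pl (j, start j).
Definition exit_ j : point := place pl (j, - start j).

Lemma start_neq j : start j != - start j.
Proof. by rewrite /start; case: forwards; apply/eqP => ?; lra. Qed.

Let start_strand j : @on_strand R k (j, start j).
Proof. by rewrite /on_strand /start /=; case: forwards; apply/andP; split; lra. Qed.

Let stop_strand j : @on_strand R k (j, - start j).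
Proof. by rewrite /on_strand /start /=; case: forwards; apply/andP; split; lra. Qed.

Lemma speed_sign j : pl_speed pl j = (if forwards j then `|pl_speed pl j| else - `|pl_speed pl j|)
  /\ 0 < `|pl_speed pl j|.
Proof.
have [s0 _] := ok.1 j; rewrite normr_gt0; split=> //.
rewrite /forwards; case: ltrP => h; first by rewrite gtr0_norm.
by rewrite ler0_norm // opprK.
Qed.

Lemma place_lt j u v : ((place pl (j, u)).2 < (place pl (j, v)).2) =
  (if forwards j then u < v else v < u).
Proof.
rewrite /place /= ltrD2l; have [sE n0] := speed_sign j; rewrite sE.
by case: forwards; rewrite ?mulNr ?ltrN2 (ltr_pM2l n0).
Qed.

Lemma place_le j u v : ((place pl (j, u)).2 <= (place pl (j, v)).2) =
  (if forwards j then u <= v else v <= u).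
Proof. by rewrite leNgt place_lt; case: forwards; rewrite -leNgt. Qed.

Lemma place_inj z z' : on_strand z -> on_strand z' -> place pl z = place pl z' -> z = z'.
Proof. exact: ok.2. Qed.

Lemma entryE j : (entry j).2 = pl_center pl j - `|pl_speed pl j|.
Proof. by rewrite /entry /place /start /=; have [sE _] := speed_sign j; rewrite {1}sE; case: forwards; ring. Qed.

Lemma exitE j : (exit_ j).2 = pl_center pl j + `|pl_speed pl j|.
Proof. by rewrite /exit_ /place /start /=; have [sE _] := speed_sign j; rewrite {1}sE; case: forwards; ring. Qed.

Lemma between_ends j (p : point) : p.1 = pl_circle pl j ->
  (entry j).2 <= p.2 <= (exit_ j).2 -> exists2 u, -1 <= u <= 1 & p = place pl (j, u).
Proof.
move=> pj; rewrite entryE exitE => /andP[ep pe]; have [s0 _] := ok.1 j.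
exists ((p.2 - pl_center pl j) / pl_speed pl j).
  have : `|(p.2 - pl_center pl j) / pl_speed pl j| <= 1.
    rewrite normrM normfV ler_pdivrMr ?normr_gt0 // mul1r ler_norml.
    by apply/andP; split; lra.
  by rewrite ler_norml.
rewrite /place /= mulrC divfK //; case: p pj {ep pe} => c t /= ->; congr pair; ring.
Qed.

Lemma entry_inj : injective entry.
Proof. by move=> i j /place_inj H; have [] := H (start_strand i) (start_strand j). Qed.

Lemma exit_inj : injective exit_.
Proof. by move=> i j /place_inj H; have [] := H (stop_strand i) (stop_strand j). Qed.

Lemma entry_exit i j : entry i != exit_ j.
Proof.
apply/eqP => /place_inj H; have [ij] := H (start_strand i) (stop_strand j).
by apply/eqP; rewrite -ij start_neq.
Qed.

(** The parameters -h and h in the order in which the diagram runs through them. *)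
Definition early j (h : R) : point := place pl (j, if forwards j then - h else h).
Definition late j (h : R) : point := place pl (j, if forwards j then h else - h).

Lemma early_lt j h : 0 < h -> (early j h).2 < (place pl (j, 0)).2.
Proof. by rewrite place_lt; case: (forwards j) => h0; rewrite ?oppr_lt0. Qed.

Lemma late_lt j h : 0 < h -> (place pl (j, 0)).2 < (late j h).2.
Proof. by rewrite place_lt; case: (forwards j) => h0; rewrite ?oppr_lt0. Qed.

Lemma early_late j h :
  perm_eq [:: place pl (j, - h); place pl (j, h)] [:: early j h; late j h].
Proof.
rewrite /early /late; case: (forwards j) => //.
by apply/permPl; exact: (perm_catC [:: _] [:: _]).
Qed.

End Placement.

Lemma path_bounds (R : realType) (u v : R) (s : seq R) t :
  path <%R u (rcons s v) -> t \in s -> u < t < v.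
Proof.
elim: s u => //= w s IHs u /andP[uw pw]; have /allP H := order_path_min lt_trans pw.
rewrite inE => /orP[/eqP ->|ts]; first by rewrite uw H // mem_rcons inE eqxx.
by have /andP[wt ->] := IHs w pw ts; rewrite (lt_trans uw wt).
Qed.

Section Shown.
Variables (R : realType) (m k : nat) (D : diagram R m) (pl : placement R m k).
Variables (P : picture R k) (rc : seq (cpoint R m * cpoint R m)) (bs : seq (cpoint R m)).
Hypothesis ok : placement_ok pl.
Hypothesis sh : shows D pl P rc bs.
Hypothesis out : (forall z, z \in rc -> ~ covered pl z.1 /\ ~ covered pl z.2) /\
  (forall p, p \in bs -> ~ covered pl p).
Local Notation point := (cpoint R m).
Local Notation entry := (entry pl).
Local Notation exit_ := (exit_ pl).
Local Notation forwards := (forwards pl).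

Definition pic_points : seq (cpoint R k) := flatten [seq [:: a.1; a.2] | a <- pic_real P].

Definition placed_crossings := [seq (place pl z.1, place pl z.2) | z <- pic_real P].

Definition inner_crossings := map (signed D) placed_crossings.
Definition outer_crossings := map (signed D) rc.

Lemma points_inner : points inner_crossings = map (place pl) pic_points.
Proof. by rewrite /points /pic_points map_flatten -!map_comp. Qed.

Lemma signed_split : perm_eq (signed_crossings D) (inner_crossings ++ outer_crossings).
Proof.
have [_ _ H _] := sh; rewrite /inner_crossings /outer_crossings -map_cat.
exact: perm_map.
Qed.

Lemma real_points_split : perm_eq (real_points D)
  (points inner_crossings ++ points outer_crossings).
Proof. by rewrite -points_signed -points_cat; apply: points_perm; exact: signed_split. Qed.

Lemma outer_uncovered p : p \in points outer_crossings -> ~ covered pl p.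
Proof.
rewrite mem_points has_map => /hasP[z zrc] /= /orP[] /eqP ->; by have [] := out.1 z zrc.
Qed.

Lemma inner_on_circle p : p \in points inner_crossings ++ points outer_crossings ->
  on_circle p.
Proof. by rewrite -(perm_mem real_points_split); exact: real_points_on_circle. Qed.

Section Tangle.
Variable zs : 'I_k -> seq R.
Hypothesis zs_sorted : forall j, path <%R (-1) (rcons (zs j) 1).
Hypothesis zsE : forall z, (z \in pic_points) = (z.2 \in zs z.1).
Hypothesis no_bars : pic_bars P = [::].

(** Consecutive parameters, the ends -1 and 1 included, form the edges; a strand run through
    backwards reverses each pair. *)
Definition strand_arcs j : seq (point * point) :=
  [seq (if forwards j then (place pl (j, a.1), place pl (j, a.2))
        else (place pl (j, a.2), place pl (j, a.1)))
     | a <- zip (-1 :: zs j) (rcons (zs j) 1)].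

Definition arcs : seq (point * point) := flatten [seq strand_arcs j | j <- enum 'I_k].

Definition ends : seq point := codom entry ++ codom exit_.

Let zs_in j u : u \in zs j -> -1 < u < 1.
Proof. exact: path_bounds. Qed.

Let pic_on_strand z : z \in pic_points -> on_strand z.
Proof. by rewrite zsE => /zs_in /andP[a b]; rewrite /on_strand !ltW. Qed.

Let start_on j : @on_strand R k (j, start pl j).
Proof. by rewrite /on_strand /start /=; case: ifP => _; apply/andP; split; lra. Qed.

Let stop_on j : @on_strand R k (j, - start pl j).
Proof. by rewrite /on_strand /start /=; case: ifP => _; apply/andP; split; lra. Qed.

Let inner_place j u : (place pl (j, u) \in points inner_crossings) = true -> 
  -1 <= u <= 1 -> u \in zs j.
Proof.
rewrite points_inner => /mapP[z zP E] hu; have zo := pic_on_strand zP.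
by have E' := place_inj ok (z := (j, u)) hu zo E; move: zP; rewrite -E' zsE.
Qed.

Let place_inner j u : u \in zs j -> place pl (j, u) \in points inner_crossings.
Proof. by move=> uz; rewrite points_inner map_f // zsE. Qed.

Let outer := points outer_crossings ++ (ends ++ base_points R m).
Let pts := points (inner_crossings ++ outer_crossings) ++ (ends ++ base_points R m).

Let mem_pts p : (p \in pts) = (p \in points inner_crossings) || (p \in outer).
Proof. by rewrite /pts points_cat -catA mem_cat. Qed.

Let mem_ends p : (p \in ends) = (p \in codom entry) || (p \in codom exit_).
Proof. by rewrite mem_cat. Qed.

Let end_cases p : p \in ends -> exists2 j, (p = entry j \/ p = exit_ j) & on_circle p /\ covered pl p.
Proof.
rewrite mem_ends => /orP[] /codomP[j ->]; exists j; auto.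
  split; last by exists (j, start pl j).
  by have /andP[a b] := on_circle_place ok (start_on j); rewrite /on_circle (ltW a) b.
split; last by exists (j, - start pl j).
by have /andP[a b] := on_circle_place ok (stop_on j); rewrite /on_circle (ltW a) b.
Qed.

Let ends_uniq : uniq ends.
Proof.
rewrite cat_uniq; apply/and3P; split.
- by rewrite map_inj_uniq ?enum_uniq //; exact: entry_inj.
- apply/hasPn => p /codomP[j ->]; apply/negP => /codomP[i].
  by move=> /esym/eqP; rewrite (negbTE (entry_exit ok i j)).
- by rewrite map_inj_uniq ?enum_uniq //; exact: exit_inj.
Qed.

Let ends_inner p : p \in ends -> p \notin points inner_crossings.
Proof.
rewrite mem_ends => pe; apply/negP => pin.
have nz j u : u = 1 \/ u = -1 -> u \notin zs j.
  by move=> hu; apply/negP => /zs_in; case: hu => ->; rewrite ltxx ?andbF.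
have pm j : start pl j = 1 \/ start pl j = -1 by rewrite /start; case: ifP; auto.
case/orP: pe => /codomP[j pE]; move: pin; rewrite pE => /inner_place /(_ _)/negP.
  by move=> H; case: (H (start_on j)); apply/negP; apply: nz.
move=> H; case: (H (stop_on j)); apply/negP; apply: nz.
by case: (pm j) => ->; rewrite ?opprK; auto.
Qed.

Let ends_real p : p \in ends -> p \notin real_points D.
Proof.
move=> pe; rewrite (perm_mem real_points_split) mem_cat negb_or ends_inner //=.
by apply/negP => /outer_uncovered; have [j _ [_ cov]] := end_cases pe; apply.
Qed.

Let ends_bars p : p \in ends -> p \notin bs.
Proof. by move=> pe; apply/negP => /out.2; have [j _ [_ cov]] := end_cases pe; apply. Qed.

Lemma Zbar_shown : Zbar D =
  netdet xvar yvar (inner_crossings ++ outer_crossings) (ends ++ base_points R m) bs.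
Proof.
have barsE : perm_eq (bars D) bs.
  by have [_ _ _] := sh; rewrite no_bars.
rewrite -(Zbar_passive ends_uniq); last first.
  move=> p pe; rewrite ends_real // (perm_mem barsE) ends_bars //.
  by have [j _ [oc _]] := end_cases pe.
by apply: netdet_perm => //; exact: signed_split.
Qed.

(** Outer crossings are uncovered, and no placement reaches the time 1 of the base points. *)
Let on_strand_pts j p : p \in pts -> p.1 = pl_circle pl j ->
  (entry j).2 <= p.2 <= (exit_ j).2 ->
  exists2 u, p = place pl (j, u) & [\/ u \in zs j, u = start pl j | u = - start pl j].
Proof.
move=> pp pj /(between_ends ok pj)[u hu pE]; exists u => //.
have cov : covered pl p by exists (j, u).
move: pp; rewrite mem_pts mem_cat => /or3P[|/outer_uncovered //|].
  by rewrite pE => /inner_place/(_ hu) uz; exact: Or31.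
rewrite mem_cat => /orP[|pb]; last first.
  have /andP[_] := on_circle_place ok (z := (j, u)) hu.
  by rewrite -pE; move: pb; rewrite mem_base_points => /eqP ->; rewrite ltxx.
rewrite mem_ends => /orP[] /codomP[i]; rewrite pE => /(place_inj ok) H.
  by have [-> ->] := H hu (start_on i); exact: Or32.
by have [-> ->] := H hu (stop_on i); exact: Or33.
Qed.

Let tangle_disjoint p : p \in outer -> p \notin points inner_crossings.
Proof.
rewrite mem_cat => /orP[po|]; last rewrite mem_cat => /orP[/ends_inner //|pb].
  have := real_points_uniq D; rewrite (perm_uniq real_points_split) cat_uniq.
  by case/and3P => _ /hasPn H _; exact: H.
apply/negP => pin; have := @inner_on_circle p; rewrite mem_cat pin => /(_ isT).
by move/on_circle_base; rewrite pb.
Qed.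

Let arcsP a : a \in arcs -> exists j u v, [/\ (u, v) \in zip (-1 :: zs j) (rcons (zs j) 1) &
  a = if forwards j then (place pl (j, u), place pl (j, v))
      else (place pl (j, v), place pl (j, u))].
Proof.
by case/flattenP => _ /mapP[j _ ->] /mapP[[u v] uv ->]; exists j, u, v.
Qed.

Let arc_range a : a \in arcs -> exists j,
  [/\ a.1.1 = pl_circle pl j, a.2.1 = pl_circle pl j, a.1.2 < a.2.2,
      (entry j).2 <= a.1.2 & a.2.2 <= (exit_ j).2] /\
      forall p, p \in pts -> p.1 = pl_circle pl j -> ~~ (a.1.2 < p.2 < a.2.2).
Proof.
case/arcsP => j [u [v [uv ->]]]; exists j.
have [/= H1 H2 H3 H4] := zip_consecutive (zs_sorted j) uv.
have fwd := place_lt ok j; have fwe := place_le ok j.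
pose u1 := if forwards j then u else v; pose u2 := if forwards j then v else u.
have -> : (if forwards j then (place pl (j, u), place pl (j, v))
  else (place pl (j, v), place pl (j, u))) = (place pl (j, u1), place pl (j, u2)).
  by rewrite /u1 /u2; case: (forwards _).
have lt12 : (place pl (j, u1)).2 < (place pl (j, u2)).2.
  by rewrite fwd /u1 /u2; case: (forwards _).
have e1 : (entry j).2 <= (place pl (j, u1)).2.
  by rewrite fwe /u1 /start; case: (forwards _).
have e2 : (place pl (j, u2)).2 <= (exit_ j).2.
  by rewrite fwe /u2 /start; case: (forwards _); rewrite ?opprK.
split=> // p pp pj; apply/negP => /= /andP[up pv].
have [|w pE wz] := on_strand_pts pp pj.
  by rewrite (ltW (le_lt_trans e1 up)) (ltW (lt_le_trans pv e2)).
move: up pv; rewrite pE !fwd /u1 /u2; case: wz => [/H4|->|->]; rewrite /start.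
- by case: (forwards _) => /orP[] ? ? ?; lra.
- by case: (forwards _) => ? ?; lra.
- by case: (forwards _) => ? ?; lra.
Qed.

Let mem_fst_arcs p : p \in map fst arcs <-> exists j u, p = place pl (j, u) /\
  u \in (if forwards j then -1 :: zs j else rcons (zs j) 1).
Proof.
have E j : map fst (strand_arcs j) = map (fun u => place pl (j, u))
    (if forwards j then -1 :: zs j else rcons (zs j) 1).
  have sz : size (-1 :: zs j) = size (rcons (zs j) 1) by rewrite size_rcons.
  rewrite /strand_arcs -map_comp; case: ifP => _.
    by rewrite -[in RHS](@unzip1_zip _ _ (-1 :: zs j) (rcons (zs j) 1)) ?sz // /unzip1 -map_comp.
  by rewrite -[in RHS](@unzip2_zip _ _ (-1 :: zs j) (rcons (zs j) 1)) ?sz // /unzip2 -map_comp.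
rewrite /arcs map_flatten -map_comp; split.
  by case/flattenP => _ /mapP[j _ ->] /=; rewrite E => /mapP[u us ->]; exists j, u.
move=> [j [u [-> us]]]; apply/flattenP; exists (map fst (strand_arcs j)).
  by apply: (map_f (fun j => map fst (strand_arcs j))); rewrite mem_enum.
by rewrite E; apply: (map_f (fun u => place pl (j, u))).
Qed.

Let mem_snd_arcs p : p \in map snd arcs <-> exists j u, p = place pl (j, u) /\
  u \in (if forwards j then rcons (zs j) 1 else -1 :: zs j).
Proof.
have E j : map snd (strand_arcs j) = map (fun u => place pl (j, u))
    (if forwards j then rcons (zs j) 1 else -1 :: zs j).
  have sz : size (-1 :: zs j) = size (rcons (zs j) 1) by rewrite size_rcons.
  rewrite /strand_arcs -map_comp; case: ifP => _.
    by rewrite -[in RHS](@unzip2_zip _ _ (-1 :: zs j) (rcons (zs j) 1)) ?sz // /unzip2 -map_comp.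
  by rewrite -[in RHS](@unzip1_zip _ _ (-1 :: zs j) (rcons (zs j) 1)) ?sz // /unzip1 -map_comp.
rewrite /arcs map_flatten -map_comp; split.
  by case/flattenP => _ /mapP[j _ ->] /=; rewrite E => /mapP[u us ->]; exists j, u.
move=> [j [u [-> us]]]; apply/flattenP; exists (map snd (strand_arcs j)).
  by apply: (map_f (fun j => map snd (strand_arcs j))); rewrite mem_enum.
by rewrite E; apply: (map_f (fun u => place pl (j, u))).
Qed.

Lemma shown_tangle :
  tangle entry exit_ inner_crossings arcs outer_crossings (ends ++ base_points R m) bs.
Proof.
split.
- rewrite (perm_uniq (_ : perm_eq _ (real_points D ++ (ends ++ base_points R m)))); last first.
    by rewrite perm_cat2r points_cat perm_sym real_points_split.
  rewrite cat_uniq real_points_uniq cat_uniq ends_uniq base_points_uniq andbT /=.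
  apply/andP; split; apply/hasPn => p.
    rewrite mem_cat => /orP[pe|pb] /=; first exact: ends_real.
    by apply/negP => /real_points_on_circle/on_circle_base; rewrite pb.
  move=> pb; apply/negP => pe; have [j _ [oc _]] := end_cases pe.
  by have := on_circle_base oc; rewrite pb.
- exact: entry_inj.
- exact: exit_inj.
- by move=> i; rewrite !mem_cat codom_f.
- by move=> i; rewrite !mem_cat codom_f orbT.
- move=> a /arc_range[j [[a1 a2 a12 _ _] H]]; rewrite /edge a1 a2 eqxx /=.
  apply/hasPn => p pp; rewrite betweenE a1; case: (p.1 =P _) => //= pj.
  by rewrite /cyclic a12; exact: H.
- move=> a /arc_range[j [[a1 a2 a12 b1 b2] _]]; rewrite /parity (eq_in_count (a2 := pred0)) ?count_pred0 //.
  move=> p pb /=; rewrite betweenE a1; case: (p.1 =P _) => //= pj.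
  rewrite /cyclic a12; apply/negP => /andP[up pv]; apply: (out.2 p pb).
  have [|w hw ->] := between_ends ok pj; last by exists (j, w).
  by rewrite (ltW (le_lt_trans b1 up)) (ltW (lt_le_trans pv b2)).
- move=> p; apply/idP/idP.
    move=> /mem_fst_arcs[j [u [-> us]]]; rewrite mem_cat; apply/orP.
    case: ifP us => fj; rewrite ?mem_rcons inE => /orP[/eqP ->|/place_inner ->]; auto; right;
    by apply/codomP; exists j; rewrite /entry /start fj.
  rewrite mem_cat points_inner => /orP[/mapP[[j u] zP ->]|/codomP[j ->]]; apply/mem_fst_arcs.
    exists j, u; split=> //; rewrite zsE /= in zP.
    by case: ifP => _; rewrite ?mem_rcons inE zP orbT.
  by exists j, (start pl j); split=> //; rewrite /start; case: (forwards _); rewrite ?mem_rcons inE eqxx.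
- move=> p; apply/idP/idP.
    move=> /mem_snd_arcs[j [u [-> us]]]; rewrite mem_cat; apply/orP.
    case: ifP us => fj; rewrite ?mem_rcons inE => /orP[/eqP ->|/place_inner ->]; auto; right;
    by apply/codomP; exists j; rewrite /exit_ /start fj ?opprK.
  rewrite mem_cat points_inner => /orP[/mapP[[j u] zP ->]|/codomP[j ->]]; apply/mem_snd_arcs.
    exists j, u; split=> //; rewrite zsE /= in zP.
    by case: ifP => _; rewrite ?mem_rcons inE zP orbT.
  exists j, (- start pl j); split=> //; rewrite /start.
  by case: (forwards _); rewrite ?opprK ?mem_rcons inE eqxx.
(* If an inner passage t lay between c and r, then so would the entry of its strand: c is no entry
   and no inner passage, so it cannot lie on the strand before t. *)
- move=> c r co ro ce rf; rewrite /edge points_cat -catA has_cat negb_or.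
  case: (c.1 =P r.1) => //= cr; rewrite andbC.
  case: (boolP (has (between c r) (points outer_crossings ++ _))) => //= nb.
  apply/hasPn => t ti; apply/negP => b; case/hasP: nb.
  have : t \in points inner_crossings by [].
  rewrite points_inner => /mapP[[j u] zP tE]; exists (entry j).
    by rewrite !mem_cat codom_f !orbT.
  have uz : u \in zs j by rewrite zsE in zP.
  have /andP[u1 u2] := zs_in uz.
  have eu : (entry j).2 < t.2.
    by rewrite tE (place_lt ok) /start; case: (forwards _).
  have ux : t.2 < (exit_ j).2.
    by rewrite tE (place_lt ok) /start; case: (forwards _); rewrite ?opprK.
  move: b; rewrite !betweenE {1}tE /= => /andP[/eqP tc]; rewrite tc eqxx /=.
  apply: cyclic_enter eu _; apply/negP => /andP[ec ct].
  have [|||w cE] := @on_strand_pts j c.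
  - by rewrite mem_pts co orbT.
  - by rewrite -tc.
  - by rewrite ec (ltW (lt_trans ct ux)).
  case=> [wz|ws|ws].
  - have := tangle_disjoint co; rewrite cE; apply/negP/negPn; exact: place_inner.
  - by move: ce; rewrite cE ws codom_f.
  - by move: (lt_trans ct ux); rewrite cE ws ltxx.
Qed.

End Tangle.
End Shown.

(** * The moves *)

Section Signs.
Variables (R : realType) (m k : nat) (D : diagram R m) (pl : placement R m k).
Variables (P : picture R k) (rc : seq (cpoint R m * cpoint R m)) (bs : seq (cpoint R m)).
Hypothesis ok : placement_ok pl.
Hypothesis sh : shows D pl P rc bs.

(** Each of the two strands that is run through backwards reverses one velocity and hence the
    sign. *)
Lemma sign_place z w (v v' : plane R) : -1 < z.2 < 1 -> -1 < w.2 < 1 ->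
  derive1 (tnth (strands P) z.1) z.2 = v -> derive1 (tnth (strands P) w.1) w.2 = v' ->
  det2 v v' != 0 ->
  positive_crossing D (place pl z, place pl w) =
    ((0 < det2 v v') == (forwards pl z.1 == forwards pl w.1)).
Proof.
move=> z1 w1 <- <-; rewrite (velocity_place sh z1) (velocity_place sh w1) det2Z.
rewrite /positive_crossing /=; set X := det2 _ _.
have [sz nz] := speed_sign ok z.1; have [sw nw] := speed_sign ok w.1.
have sgn (a b c : R) (f g : bool) : a = (if f then `|a| else - `|a|) -> 0 < `|a| ->
   b = (if g then `|b| else - `|b|) -> 0 < `|b| -> a * b * c != 0 ->
   (0 < c) = ((0 < a * b * c) == (f == g)).
  move=> aE a0 bE b0; have ab := mulr_gt0 a0 b0; rewrite aE bE.
  rewrite mulf_eq0 negb_or => /andP[_ c0].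
  have E : (0 < `|a| * `|b| * c) = (0 < c) by rewrite pmulr_rgt0.
  have E' : (0 < - (`|a| * `|b| * c)) = ~~ (0 < c).
    by rewrite oppr_gt0 pmulr_rlt0 //; case: (ltrgtP c 0) c0 => // ->; rewrite eqxx.
  by case: (f); case: (g); rewrite ?mulrN ?mulNr ?opprK ?E ?E' //; case: (0 < c).
exact: sgn sz nz sw nw.
Qed.

End Signs.

Section Inside.
Variables (R : realType) (m k : nat) (D : diagram R m) (pl : placement R m k).
Variables (P : picture R k) (rc : seq (cpoint R m * cpoint R m)) (bs : seq (cpoint R m)).
Hypothesis ok : placement_ok pl.
Hypothesis sh : shows D pl P rc bs.
Hypothesis out : (forall z, z \in rc -> ~ covered pl z.1 /\ ~ covered pl z.2) /\
  (forall p, p \in bs -> ~ covered pl p).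
Hypothesis pic_on : forall z, z \in pic_points P -> on_strand z.

Lemma inside_strand j u1 u2 p : -1 <= u1 <= 1 -> -1 <= u2 <= 1 ->
  p \in real_points D ++ base_points R m -> inside (place pl (j, u1)) (place pl (j, u2)) p ->
  exists w, [/\ p = place pl (j, w), (j, w) \in pic_points P,
    (place pl (j, u1)).2 <= (place pl (j, w)).2 &
    (place pl (j, w)).2 <= (place pl (j, u2)).2].
Proof.
move=> hu1 hu2 pp /andP[/eqP pj /andP[p1 p2]].
have pj' : p.1 = pl_circle pl j by rewrite pj.
have e1 : (entry pl j).2 <= (place pl (j, u1)).2.
  by rewrite place_le // /start; case: (forwards _ _); lra.
have e2 : (place pl (j, u2)).2 <= (exit_ pl j).2.
  by rewrite place_le // /start; case: (forwards _ _); rewrite ?opprK; lra.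
have [|w hw pE] := between_ends ok pj'.
  by rewrite (le_trans e1 p1) (le_trans p2 e2).
exists w; rewrite -pE; split=> //; move: pp; rewrite mem_cat => /orP[|pb]; last first.
  have /andP[_] := on_circle_place ok (z := (j, w)) hw.
  by rewrite -pE; move: pb; rewrite mem_base_points => /eqP ->; rewrite ltxx.
rewrite (perm_mem (real_points_split sh)) mem_cat => /orP[|/(outer_uncovered out) []]; last first.
  by exists (j, w).
rewrite points_inner => /mapP[z zP]; rewrite pE => E.
by rewrite (place_inj ok (z := (j, w)) hw (pic_on zP) E).
Qed.

End Inside.

Section Replacement.
Variables (R : realType) (m k : nat) (D D' : diagram R m) (pl : placement R m k).
Variables (P P' : picture R k) (rc : seq (cpoint R m * cpoint R m)) (bs : seq (cpoint R m)).
Hypothesis ok : placement_ok pl.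
Hypothesis sh : shows D pl P rc bs.
Hypothesis sh' : shows D' pl P' rc bs.
Hypothesis out : (forall z, z \in rc -> ~ covered pl z.1 /\ ~ covered pl z.2) /\
  (forall p, p \in bs -> ~ covered pl p).
Hypothesis same : forall p, on_circle p -> ~ covered pl p -> at_point D' p = at_point D p.

Lemma outer_crossings_same : outer_crossings D' rc = outer_crossings D rc.
Proof.
apply/eq_in_map => z zrc; rewrite /signed /positive_crossing.
have zp p : p \in [:: z.1; z.2] -> on_circle p.
  move=> pz; apply: (inner_on_circle (rc := rc) sh); rewrite mem_cat; apply/orP; right.
  rewrite mem_points has_map; apply/hasP; exists z => //=; move: pz; rewrite !inE.
  by [].
have [n1 n2] := out.1 z zrc.
by rewrite !(velocity_outside ok same) //; apply: zp; rewrite !inE eqxx ?orbT.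
Qed.

(** Virtual crossings leave no trace in [netdet]. So it suffices that the real crossings, with their
    signs, and the bars agree. *)
Lemma Zbar_virtual : inner_crossings D' pl P' = inner_crossings D pl P ->
  perm_eq (pic_bars P') (pic_bars P) -> Zbar D' = Zbar D.
Proof.
move=> innE barE; apply: netdet_perm => //.
  rewrite (permPl (signed_split sh')) innE outer_crossings_same perm_sym.
  exact: signed_split sh.
have [_ _ _ B] := sh; have [_ _ _ B'] := sh'.
rewrite (permPl B') (permPr B) perm_cat2r; exact: perm_map.
Qed.

Lemma Zbar_slide j u1 u2 : pic_real P = [::] -> pic_real P' = [::] ->
  pic_bars P = [:: (j, u1)] -> pic_bars P' = [:: (j, u2)] ->
  -1 <= u1 <= 1 -> -1 <= u2 <= 1 -> Zbar D' = Zbar D.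
Proof.
move=> Pr P'r Pb P'b h1 h2.
have pp0 : pic_points P = [::] by rewrite /pic_points Pr.
have nin v1 v2 : -1 <= v1 <= 1 -> -1 <= v2 <= 1 ->
    forall p, p \in points (signed_crossings D) ++ base_points R m ->
    ~~ inside (place pl (j, v1)) (place pl (j, v2)) p.
  move=> hv1 hv2 p; rewrite points_signed => pp; apply/negP => ins.
  have [|w [_]] := inside_strand ok sh out _ hv1 hv2 pp ins; first by rewrite pp0.
  by rewrite pp0.
have [_ _ _ B] := sh; have [_ _ _ B'] := sh'; rewrite Pb /= in B; rewrite P'b /= in B'.
have C : perm_eq (signed_crossings D') (signed_crossings D).
  rewrite (permPl (signed_split sh')) (permPr (signed_split sh)).
  by rewrite /inner_crossings /placed_crossings Pr P'r /= outer_crossings_same.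
rewrite /Zbar (netdet_perm _ _ C (perm_refl _) B').
rewrite [RHS](netdet_perm _ _ (perm_refl _) (perm_refl _) B).
have [le|/ltW le] := lerP (place pl (j, u1)).2 (place pl (j, u2)).2.
  by apply/esym/netdet_slide => //; exact: nin.
by apply/netdet_slide => //; exact: nin.
Qed.

Lemma Zbar_cancel j u1 u2 : pic_real P = [::] -> pic_real P' = [::] ->
  pic_bars P = [:: (j, u1); (j, u2)] -> pic_bars P' = [::] ->
  -1 <= u1 <= 1 -> -1 <= u2 <= 1 -> Zbar D' = Zbar D.
Proof.
move=> Pr P'r Pb P'b h1 h2.
have pp0 : pic_points P = [::] by rewrite /pic_points Pr.
have nin v1 v2 : -1 <= v1 <= 1 -> -1 <= v2 <= 1 ->
    forall p, p \in points (signed_crossings D) ++ base_points R m ->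
    ~~ inside (place pl (j, v1)) (place pl (j, v2)) p.
  move=> hv1 hv2 p; rewrite points_signed => pp; apply/negP => ins.
  have [|w [_]] := inside_strand ok sh out _ hv1 hv2 pp ins; first by rewrite pp0.
  by rewrite pp0.
have [_ _ _ B] := sh; have [_ _ _ B'] := sh'; rewrite Pb /= in B; rewrite P'b /= in B'.
have C : perm_eq (signed_crossings D') (signed_crossings D).
  rewrite (permPl (signed_split sh')) (permPr (signed_split sh)).
  by rewrite /inner_crossings /placed_crossings Pr P'r /= outer_crossings_same.
rewrite /Zbar (netdet_perm _ _ C (perm_refl _) B').
rewrite [RHS](netdet_perm _ _ (perm_refl _) (perm_refl _) B).
have [le|/ltW le] := lerP (place pl (j, u1)).2 (place pl (j, u2)).2.
  by apply/esym/netdet_cancel => //; exact: nin.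
have swap : perm_eq [:: place pl (j, u1), place pl (j, u2) & bs]
   [:: place pl (j, u2), place pl (j, u1) & bs].
  by apply/permPl; exact: (perm_catCA [:: _] [:: _] bs).
rewrite [RHS](netdet_perm _ _ (perm_refl _) (perm_refl _) swap).
by apply/esym/netdet_cancel => //; exact: nin.
Qed.

(** The equality of signs is what matches [switched], which exchanges over and under but keeps the
    sign. *)
Lemma Zbar_switch z w h : 0 < h < 1 -> z.2 = 0 -> w.2 = 0 -> z.1 != w.1 ->
  pic_real P = [:: (z, w)] -> pic_real P' = [:: (w, z)] ->
  perm_eq (pic_bars P) [:: (z.1, - h); (z.1, h); (w.1, - h); (w.1, h)] ->
  pic_bars P' = [::] ->
  positive_crossing D' (place pl w, place pl z) = positive_crossing D (place pl z, place pl w) ->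
  Zbar D' = Zbar D.
Proof.
move=> /andP[h0 h1] z0 w0 zw Pr P'r Pb P'b sgn.
have on0 (a : cpoint R k) : a.2 = 0 -> on_strand a.
  by move=> a0; rewrite /on_strand a0; apply/andP; split; lra.
have pic_on a : a \in pic_points P -> on_strand a.
  rewrite /pic_points Pr /= !inE => /orP[] /eqP ->; exact: on0.
pose c : cpoint R m * cpoint R m * bool := signed D (place pl z, place pl w).
have CD : perm_eq (signed_crossings D) (c :: outer_crossings D rc).
  by rewrite (permPl (signed_split sh)) /inner_crossings /placed_crossings Pr.
have CD' : perm_eq (signed_crossings D') (switched c :: outer_crossings D rc).
  rewrite (permPl (signed_split sh')) /inner_crossings /placed_crossings P'r outer_crossings_same.
  by rewrite /= /switched /c /signed /= sgn.
have BD : perm_eq (bars D) [:: early pl z.1 h, late pl z.1 h, early pl w.1 h, late pl w.1 h & bs].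
  have [_ _ _ B] := sh; rewrite (permPl B).
  rewrite -[_ :: _]/([:: early pl z.1 h; late pl z.1 h; early pl w.1 h; late pl w.1 h] ++ bs) perm_cat2r.
  rewrite (permPl (perm_map _ Pb)) /=.
  exact: (perm_cat (early_late pl z.1 h) (early_late pl w.1 h)).
have BD' : perm_eq (bars D') bs.
  by have [_ _ _ B'] := sh'; rewrite P'b /= in B'.
rewrite /Zbar (netdet_perm _ _ CD' (perm_refl _) BD') (netdet_perm _ _ CD (perm_refl _) BD).
have hu j : -1 <= (if forwards pl j then - h else h) <= 1.
  by case: ifP => _; apply/andP; split; lra.
have hv j : -1 <= (if forwards pl j then h else - h) <= 1.
  by case: ifP => _; apply/andP; split; lra.
have ptsE : perm_eq (points (c :: outer_crossings D rc) ++ base_points R m)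
    (real_points D ++ base_points R m).
  by rewrite perm_cat2r -points_signed perm_sym; exact: points_perm.
have place0 a : a.2 = 0 -> place pl a = place pl (a.1, 0).
  by case: a => j t /= ->.
have ins a b : pic_points P =i [:: a; b] -> a.1 != b.1 -> forall r,
    r \in points (c :: outer_crossings D rc) ++ base_points R m ->
    inside (early pl a.1 h) (late pl a.1 h) r -> r = place pl a.
  move=> ab nab r; rewrite (perm_mem ptsE) => rr ir.
  have [t [-> ]] := inside_strand ok sh out pic_on (hu _) (hv _) rr ir.
  rewrite ab !inE => /orP[/eqP -> //|/eqP E]; by move: nab; rewrite -E eqxx.
have ppE : pic_points P = [:: z; w] by rewrite /pic_points Pr.
apply/esym/netdet_switch.
- rewrite (perm_uniq ptsE) cat_uniq real_points_uniq base_points_uniq andbT /=.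
  apply/hasPn => p pb; apply/negP => /real_points_on_circle/on_circle_base.
  by rewrite pb.
- exact: erefl.
- exact: erefl.
- exact: erefl.
- exact: erefl.
- by rewrite -[c.1.1]/(place pl z) (place0 z z0) early_lt.
- by rewrite -[c.1.1]/(place pl z) (place0 z z0) late_lt.
- by rewrite -[c.1.2]/(place pl w) (place0 w w0) early_lt.
- by rewrite -[c.1.2]/(place pl w) (place0 w w0) late_lt.
- by apply: (ins z w _ zw) => a; rewrite ppE.
- apply: (ins w z); last by rewrite eq_sym.
  by move=> a; rewrite ppE !inE orbC.
Qed.

End Replacement.

Lemma xvar_neq0 : xvar != 0.
Proof. by rewrite tofrac_eq0 polyC_eq0 polyX_eq0. Qed.

Lemma yvar_neq0 : yvar != 0.
Proof. by rewrite tofrac_eq0 polyX_eq0. Qed.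

Section TangleUniq.
Variables (R : realType) (m k : nat) (e f : 'I_k -> cpoint R m).
Variables (Cin Cout : seq (cpoint R m * cpoint R m * bool)).
Variables (G : seq (cpoint R m * cpoint R m)) (P B : seq (cpoint R m)).
Hypothesis tG : tangle e f Cin G Cout P B.

Lemma tangle_inner_uniq : uniq (points Cin).
Proof. by have := tangle_uniq tG; rewrite points_cat -catA cat_uniq => /and3P[]. Qed.

Lemma tangle_passive p : p \in P -> p \notin points Cin.
Proof.
have := tangle_uniq tG; rewrite points_cat -catA cat_uniq => /and3P[_ /hasPn H _] pP.
by apply: H; rewrite mem_cat pP orbT.
Qed.

Lemma tangle_uniq_ends (I : seq 'I_k) : (forall i j, e i != f j) -> uniq I ->
  uniq (map e I ++ map f I ++ points Cin).
Proof.
move=> ef uI; rewrite cat_uniq (map_inj_uniq (tangle_e tG)) uI.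
rewrite cat_uniq (map_inj_uniq (tangle_f tG)) uI tangle_inner_uniq /= andbT.
apply/andP; split; apply/hasPn => p.
  rewrite mem_cat => /orP[/mapP[j _ ->]|pin]; apply/negP => /mapP[i _ pe].
    by have := ef i j; rewrite -pe eqxx.
  by have := tangle_passive (tangle_eP tG i); rewrite -pe pin.
move=> pin; apply/negP => /mapP[i _ pe].
by have := tangle_passive (tangle_fP tG i); rewrite -pe pin.
Qed.

End TangleUniq.

Section Replacement.
Variables (R : realType) (m k : nat) (D D' : diagram R m) (pl : placement R m k).
Variables (P P' : picture R k) (rc : seq (cpoint R m * cpoint R m)) (bs : seq (cpoint R m)).
Hypothesis ok : placement_ok pl.
Hypothesis sh : shows D pl P rc bs.
Hypothesis sh' : shows D' pl P' rc bs.
Hypothesis out : (forall z, z \in rc -> ~ covered pl z.1 /\ ~ covered pl z.2) /\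
  (forall p, p \in bs -> ~ covered pl p).
Hypothesis same : forall p, on_circle p -> ~ covered pl p -> at_point D' p = at_point D p.
Variables (zs zs' : 'I_k -> seq R).
Hypothesis zs_sorted : forall j, path <%R (-1) (rcons (zs j) 1).
Hypothesis zsE : forall z, (z \in pic_points P) = (z.2 \in zs z.1).
Hypothesis no_bars : pic_bars P = [::].
Hypothesis zs'_sorted : forall j, path <%R (-1) (rcons (zs' j) 1).
Hypothesis zs'E : forall z, (z \in pic_points P') = (z.2 \in zs' z.1).
Hypothesis no_bars' : pic_bars P' = [::].

Definition tangle_det (C : seq (cpoint R m * cpoint R m * bool)) G b : ratfun :=
  seq_det (points C) (inner_matrix xvar yvar C G b).

(** By [netdet_tangle] each value is its inner determinants times one common outer determinant; the
    cross-multiplied form avoids a division. *)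
Lemma Zbar_transfer (T : bool -> 'I_k -> 'I_k -> ratfun) :
  (forall b, transfer xvar yvar (entry pl) (exit_ pl) (inner_crossings D pl P) (arcs pl zs) b (T b)) ->
  (forall b, transfer xvar yvar (entry pl) (exit_ pl) (inner_crossings D' pl P') (arcs pl zs') b (T b)) ->
  Zbar D * (tangle_det (inner_crossings D' pl P') (arcs pl zs') false *
            tangle_det (inner_crossings D' pl P') (arcs pl zs') true) =
  Zbar D' * (tangle_det (inner_crossings D pl P) (arcs pl zs) false *
            tangle_det (inner_crossings D pl P) (arcs pl zs) true).
Proof.
move=> HT HT'.
rewrite (Zbar_shown ok sh out zs_sorted zsE no_bars).
rewrite (Zbar_shown ok sh' out zs'_sorted zs'E no_bars').
have t := shown_tangle ok sh out zs_sorted zsE.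
have t' := shown_tangle ok sh' out zs'_sorted zs'E.
rewrite (outer_crossings_same ok sh out same) in t' *.
rewrite (netdet_tangle t HT) (netdet_tangle t' HT') !big_cons !big_nil !mulr1.
rewrite /tangle_det; set a := seq_det _ _; set b := seq_det _ _.
set c := seq_det _ _; set d := seq_det _ _; set E := seq_det _ _; ring.
Qed.

End Replacement.

Section Arcs.
Variables (R : realType) (m k : nat) (pl : placement R m k).
Implicit Types (zs : 'I_k -> seq R).

Lemma mem_arcs zs (I : seq 'I_k) : uniq I -> size I = k ->
  arcs pl zs =i flatten (map (strand_arcs pl zs) I).
Proof.
move=> uI sI a; apply/flattenP/flattenP => -[_ /mapP[j jI ->] aj];
  exists (strand_arcs pl zs j) => //; apply: map_f.
  exact: mem_all_ord.
by rewrite mem_enum.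
Qed.

Lemma strand_arcs0 zs j : zs j = [::] -> strand_arcs pl zs j = [:: (entry pl j, exit_ pl j)].
Proof.
by rewrite /strand_arcs => -> /=; rewrite /entry /exit_ /start; case: (forwards pl j); rewrite ?opprK.
Qed.

Lemma strand_arcs2 zs j u v : zs j = [:: u; v] -> strand_arcs pl zs j =i
  if forwards pl j
  then [:: (entry pl j, place pl (j, u)); (place pl (j, u), place pl (j, v)); (place pl (j, v), exit_ pl j)]
  else [:: (entry pl j, place pl (j, v)); (place pl (j, v), place pl (j, u)); (place pl (j, u), exit_ pl j)].
Proof.
rewrite /strand_arcs => -> /= a; rewrite /entry /exit_ /start.
by case: (forwards pl j); rewrite ?opprK // !inE orbCA orbA orbC orbCA.
Qed.

Lemma arcs_nil zs a : (forall j, zs j = [::]) -> a \in arcs pl zs ->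
  exists j, a = (entry pl j, exit_ pl j).
Proof.
move=> z0 /flattenP[_ /mapP[j _ ->]]; rewrite strand_arcs0 // inE => /eqP ->.
by exists j.
Qed.

End Arcs.

(** * Moves that create real crossings from none, and the first Reidemeister move *)

Section Moves.
Variables (R : realType) (m : nat).
Local Notation h := (onehalf R).

Lemma onehalf_gt0 : 0 < h < 1.
Proof. by rewrite /onehalf; apply/andP; split; lra. Qed.

Lemma onehalf_path : path <%R (-1) (rcons [:: - h; h] 1).
Proof. by have /andP[a b] := onehalf_gt0; rewrite /= !andbT; apply/and3P; split; lra. Qed.

Section Replacement.
Variables (k : nat) (D D' : diagram R m) (pl : placement R m k).
Variables (P P' : picture R k) (rc : seq (cpoint R m * cpoint R m)) (bs : seq (cpoint R m)).
Hypothesis ok : placement_ok pl.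
Hypothesis sh : shows D pl P rc bs.
Hypothesis sh' : shows D' pl P' rc bs.
Hypothesis out : (forall z, z \in rc -> ~ covered pl z.1 /\ ~ covered pl z.2) /\
  (forall p, p \in bs -> ~ covered pl p).
Hypothesis same : forall p, on_circle p -> ~ covered pl p -> at_point D' p = at_point D p.
Hypotheses (no_bars : pic_bars P = [::]) (no_bars' : pic_bars P' = [::]).
Hypothesis no_real : pic_real P = [::].

(** Strands without real crossings have the identity as transfer matrix and the empty determinant
    1. *)
Lemma Zbar_identity zs' : (forall j, path <%R (-1) (rcons (zs' j) 1)) ->
  (forall z, (z \in pic_points P') = (z.2 \in zs' z.1)) ->
  (forall b, transfer xvar yvar (entry pl) (exit_ pl) (inner_crossings D' pl P')
     (arcs pl zs') b (@identity_transfer _ k)) ->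
  Zbar D' = Zbar D * (tangle_det (inner_crossings D' pl P') (arcs pl zs') false *
            tangle_det (inner_crossings D' pl P') (arcs pl zs') true).
Proof.
move=> p' E' T'; pose zs := fun _ : 'I_k => [::] : seq R.
have pp0 z : (z \in pic_points P) = (z.2 \in zs z.1) by rewrite /pic_points no_real.
have p j : path <%R (-1) (rcons (zs j) 1) by rewrite /= andbT; lra.
have in0 : inner_crossings D pl P = [::] by rewrite /inner_crossings /placed_crossings no_real.
rewrite (Zbar_transfer ok sh sh' out same p pp0 no_bars p' E' no_bars' _ T').
  by rewrite in0 /tangle_det /seq_det !det_mx00 !mulr1.
move=> b; rewrite in0; apply: transfer_nil; first exact: entry_inj.
- exact: exit_inj.
- exact: entry_exit.
by move=> a; apply: arcs_nil.
Qed.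

End Replacement.

Section Kink.
Variables (D D' : diagram R m) (pl : placement R m 1) (b : bool).
Variables (rc : seq (cpoint R m * cpoint R m)) (bs : seq (cpoint R m)).
Let P := Picture (@line_strand R) [::] [::].
Let P' := Picture (@kink_strand R) [:: crossing_of (s1_0, - h) (s1_0, h) b] [::].
Hypothesis ok : placement_ok pl.
Hypothesis sh : shows D pl P rc bs.
Hypothesis sh' : shows D' pl P' rc bs.
Hypothesis out : (forall z, z \in rc -> ~ covered pl z.1 /\ ~ covered pl z.2) /\
  (forall p, p \in bs -> ~ covered pl p).
Hypothesis same : forall p, on_circle p -> ~ covered pl p -> at_point D' p = at_point D p.

Lemma Zbar_kink : exists n : int, Zbar D' = xvar ^ n * Zbar D.
Proof.
pose zs := fun _ : 'I_1 => [:: - h; h].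
have zs_sorted j : path <%R (-1) (rcons (zs j) 1) by exact: onehalf_path.
have zsE z : (z \in pic_points P') = (z.2 \in zs z.1).
  rewrite /pic_points /= /crossing_of; case: z => j t; rewrite (ord1 j) /=.
  have e : s1_0 = ord0 by apply: val_inj.
  by case: b; rewrite e !inE !xpair_eqE eqxx //= orbC.
have t := shown_tangle ok sh' out zs_sorted zsE.
pose pm := place pl (ord0, - h); pose pp := place pl (ord0, h).
have [c [cE cin]] : exists c, [/\ inner_crossings D' pl P' = [:: c] &
    c.1 = if b then (pm, pp) else (pp, pm)].
  exists (signed D' (place pl (crossing_of (s1_0, - h) (s1_0, h) b).1,
      place pl (crossing_of (s1_0, - h) (s1_0, h) b).2)).
  split=> //; have e : s1_0 = ord0 by apply: val_inj.
  by rewrite /signed /= /crossing_of e; case: b.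
have GE : arcs pl zs =i if forwards pl ord0
    then [:: (entry pl ord0, pm); (pm, pp); (pp, exit_ pl ord0)]
    else [:: (entry pl ord0, pp); (pp, pm); (pm, exit_ pl ord0)].
  have fE : flatten (map (strand_arcs pl zs) [:: ord0]) = strand_arcs pl zs ord0.
    exact: cats0.
  move=> a; rewrite (@mem_arcs _ _ _ pl zs [:: ord0] isT erefl a) fE.
  exact: (strand_arcs2 pl (erefl (zs ord0))).
(* The parameter -1/2 comes first exactly if the strand runs forwards, and it is the upper passage
   on the sheet s exactly if b (+) s. *)
pose first s := forwards pl ord0 == (b (+) s).
have uE s : upper s c = if b (+) s then pm else pp.
  by rewrite /upper cin; case: b; case: s.
have lE s : lower s c = if b (+) s then pp else pm.
  by rewrite /lower cin; case: b; case: s.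
have G s : arcs pl zs =i [:: (entry pl ord0, if first s then upper s c else lower s c);
    (if first s then upper s c else lower s c, if first s then lower s c else upper s c);
    (if first s then lower s c else upper s c, exit_ pl ord0)].
  by move=> a; rewrite GE uE lE /first; case: (forwards pl ord0); case: (b (+) s).
have us s : uniq [:: entry pl ord0; if first s then upper s c else lower s c;
    if first s then lower s c else upper s c; exit_ pl ord0].
  have := tangle_uniq_ends t (entry_exit ok) (I := [:: ord0]) isT.
  rewrite cE -[X in uniq X]/[:: entry pl ord0; exit_ pl ord0; c.1.1; c.1.2].
  set e0 := entry pl _; set f0 := exit_ pl _ => u.
  rewrite (perm_uniq (_ : perm_eq _ [:: e0; f0; c.1.1; c.1.2])) // perm_cons perm_sym.
  apply: perm_trans (_ : perm_eq _ [:: c.1.1; c.1.2; f0]) _.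
    by rewrite -(perm_rot 1).
  have two (q r : cpoint R m) : perm_eq [:: q; r; f0] [:: r; q; f0].
    by apply/permPl; exact: (perm_catCA [:: q] [:: r] [:: f0]).
  by rewrite /upper /lower; case: (first s); case: s.
exists (if c.2 then 1 else -1).
rewrite (Zbar_identity ok sh sh' out same erefl erefl erefl zs_sorted zsE); last first.
  by move=> s; rewrite cE; exact: (kink_transfer xvar_neq0 yvar_neq0 (us s) (G s)).
rewrite cE /tangle_det (kink_det xvar_neq0 yvar_neq0 (us false) (G false)).
rewrite (kink_det xvar_neq0 yvar_neq0 (us true) (G true)) mulrC; congr (_ * _).
(* Exactly one of the two sheets therefore contributes the power of x, and the other contributes
   1. *)
have -> : first true = ~~ first false.
  by rewrite /first; case: (forwards pl ord0); case: (b).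
by rewrite /sign_power; case: (first false); case: c.2 => /=; rewrite ?mul1r ?mulr1.
Qed.

End Kink.
End Moves.

Section Perm.
Variables (R : realType) (m : nat).
Implicit Types (C : seq (cpoint R m * cpoint R m * bool)).

Lemma tangle_det_perm C C' G G' b : perm_eq C C' -> G =i G' ->
  tangle_det C G b = tangle_det C' G' b.
Proof.
move=> CC' GG'; rewrite /tangle_det (seq_det_perm _ (points_perm CC')).
by apply: eq_seq_det => p q _ _; rewrite /inner_matrix /weight (perm_big _ CC') GG'.
Qed.

Lemma tangle_uniq_upper_lower k (e f : 'I_k -> cpoint R m) Cin Cout G P B C b I :
  tangle e f Cin G Cout P B -> (forall i j, e i != f j) -> uniq I -> perm_eq Cin C ->
  uniq (map e I ++ map f I ++ map (upper b) C ++ map (lower b) C).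
Proof.
move=> t ef uI CC'; have := tangle_uniq_ends t ef uI.
rewrite (perm_uniq (_ : perm_eq _ (map e I ++ map f I ++ map (upper b) C ++ map (lower b) C))) //.
rewrite !perm_cat2l (permPl (points_perm CC')); exact: perm_points.
Qed.

End Perm.

(** * The second Reidemeister move *)

Section Bigon.
Variables (R : realType) (m : nat).
Local Notation h := (onehalf R).
Variables (D D' : diagram R m) (pl : placement R m 2) (b : bool).
Variables (rc : seq (cpoint R m * cpoint R m)) (bs : seq (cpoint R m)).
Let P := Picture (@parallel_strands R) [::] [::].
Let P' := Picture (@bigon_strands R) (@bigon_crossings R b) [::].
Hypothesis ok : placement_ok pl.
Hypothesis sh : shows D pl P rc bs.
Hypothesis sh' : shows D' pl P' rc bs.
Hypothesis out : (forall z, z \in rc -> ~ covered pl z.1 /\ ~ covered pl z.2) /\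
  (forall p, p \in bs -> ~ covered pl p).
Hypothesis same : forall p, on_circle p -> ~ covered pl p -> at_point D' p = at_point D p.

Let slope (t : R) : R := 8 / 9 * (- 4 * t * (1 - t ^+ 2)).

Lemma bigon_derive0 t : derive1 (tnth (strands P') s2_0) t = (1, slope t).
Proof.
rewrite /P' /= /tnth /=; apply: derive1_graph; exact: is_derive_affine_hump.
Qed.

Lemma bigon_derive1 t : derive1 (tnth (strands P') s2_1) t = (1, - slope t).
Proof.
rewrite /P' /= /tnth /= (_ : graph_of _ = graph_of (fun u => h + - (8 / 9) * hump u)).
  rewrite (_ : - slope t = - (8 / 9) * (- 4 * t * (1 - t ^+ 2))); last by rewrite /slope [RHS]mulNr.
  apply: derive1_graph; exact: is_derive_affine_hump.
by congr graph_of; apply/funext => u; rewrite mulNr.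
Qed.

Lemma bigon_sign (t : R) : -1 < t < 1 -> slope t != 0 ->
  positive_crossing D' (place pl (s2_0, t), place pl (s2_1, t)) =
    ((slope t < 0) == (forwards pl s2_0 == forwards pl s2_1)) /\
  positive_crossing D' (place pl (s2_1, t), place pl (s2_0, t)) =
    ((0 < slope t) == (forwards pl s2_0 == forwards pl s2_1)).
Proof.
move=> ht st; have d0 := bigon_derive0 t; have d1 := bigon_derive1 t.
have E1 : det2 (1, slope t) (1, - slope t) = - 2 * slope t by rewrite /det2 /=; ring.
have E2 : det2 (1, - slope t) (1, slope t) = 2 * slope t by rewrite /det2 /=; ring.
split.
  rewrite (sign_place ok sh' (z := (s2_0, t)) (w := (s2_1, t)) ht ht d0 d1) E1.
    by rewrite mulNr oppr_gt0 pmulr_rlt0.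
  by rewrite mulf_neq0 // oppr_eq0.
rewrite (sign_place ok sh' (z := (s2_1, t)) (w := (s2_0, t)) ht ht d1 d0) E2.
  by rewrite pmulr_rgt0 // (eq_sym (forwards pl s2_1)).
by rewrite mulf_neq0.
Qed.

Let pt j u := place pl (j, u).
Let c u := signed D' (place pl (crossing_of (s2_0, u) (s2_1, u) b).1,
                      place pl (crossing_of (s2_0, u) (s2_1, u) b).2).

Lemma bigon_slope : slope (- h) = 4 / 3 /\ slope h = - (4 / 3).
Proof. by rewrite /slope /onehalf; split; field. Qed.

Let h_range : -1 < h < 1 /\ -1 < - h < 1.
Proof. by have /andP[a a'] := onehalf_gt0 R; split; apply/andP; split; lra. Qed.

(** The slopes at -1/2 and 1/2 are opposite, and the directions of the strands affect both signs
    alike. *)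
Lemma bigon_signs : (c h).2 = ~~ (c (- h)).2.
Proof.
have [sm sp] := bigon_slope; have [hp hm] := h_range.
have q : (0 : R) < 4 / 3 by rewrite divr_gt0 ?ltr0n.
have np : slope h != 0 by rewrite sp oppr_eq0 gt_eqF.
have nm : slope (- h) != 0 by rewrite sm gt_eqF.
have [a1 a2] := bigon_sign hp np; have [b1 b2] := bigon_sign hm nm.
rewrite sp oppr_lt0 q in a1; rewrite sp oppr_gt0 (lt_gtF q) in a2.
rewrite sm (lt_gtF q) in b1; rewrite sm q in b2.
rewrite /c /signed /crossing_of; case: (b) => /=.
  by rewrite a1 b1; case: (forwards _ _ == _).
by rewrite a2 b2; case: (forwards _ _ == _).
Qed.

Lemma Zbar_bigon : Zbar D' = Zbar D.
Proof.
pose zs := fun _ : 'I_2 => [:: - h; h].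
have zs_sorted j : path <%R (-1) (rcons (zs j) 1) by exact: onehalf_path.
have zsE z : (z \in pic_points P') = (z.2 \in zs z.1).
  case: z => j t; have : (j == s2_0) || (j == s2_1) by case: j => -[|[|]].
  rewrite /pic_points /= /crossing_of; case: (b) => /orP[] /eqP ->;
    by rewrite !inE !xpair_eqE /= ?orbF.
have t := shown_tangle ok sh' out zs_sorted zsE.
have inE_ : inner_crossings D' pl P' = [:: c (- h); c h] by [].
pose iU s := if b (+) s then s2_0 else s2_1.
pose iL s := if b (+) s then s2_1 else s2_0.
have uI s : uniq [:: iU s; iL s] by rewrite /iU /iL; case: (_ (+) _).
have uE s u : upper s (c u) = pt (iU s) u.
  by rewrite /upper /c /iU /crossing_of; case: (b); case: s.
have lE s u : lower s (c u) = pt (iL s) u.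
  by rewrite /lower /c /iL /crossing_of; case: (b); case: s.
(* z1 and z2 are the crossings in the order in which the upper strand of the sheet s meets them. *)
have [z1 [z2 [signs CC zE]]] : exists z1 z2 : bool -> _, [/\ forall s, (z2 s).2 = ~~ (z1 s).2,
    forall s, perm_eq [:: c (- h); c h] [:: z1 s; z2 s] &
    forall s, [/\ upper s (z1 s) = pt (iU s) (if forwards pl (iU s) then - h else h),
      upper s (z2 s) = pt (iU s) (if forwards pl (iU s) then h else - h),
      lower s (z1 s) = pt (iL s) (if forwards pl (iU s) then - h else h) &
      lower s (z2 s) = pt (iL s) (if forwards pl (iU s) then h else - h)]].
  exists (fun s => if forwards pl (iU s) then c (- h) else c h).
  exists (fun s => if forwards pl (iU s) then c h else c (- h)).
  split=> s; case: (forwards pl (iU s)).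
  - exact: bigon_signs.
  - exact: (etrans (esym (negbK (c (- h)).2)) (congr1 negb (esym bigon_signs))).
  - exact: perm_refl.
  - exact/permPl/(perm_catC [:: c (- h)] [:: c h]).
  - by split; [exact: uE | exact: uE | exact: lE | exact: lE].
  - by split; [exact: uE | exact: uE | exact: lE | exact: lE].
have CC' s : perm_eq (inner_crossings D' pl P') [:: z1 s; z2 s] by rewrite inE_; exact: CC.
pose first s := forwards pl (iL s) == forwards pl (iU s).
have GE s : arcs pl zs =i [:: (entry pl (iU s), upper s (z1 s)); (upper s (z1 s), upper s (z2 s));
    (upper s (z2 s), exit_ pl (iU s));
    (entry pl (iL s), if first s then lower s (z1 s) else lower s (z2 s));
    (if first s then lower s (z1 s) else lower s (z2 s), if first s then lower s (z2 s) else lower s (z1 s));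
    (if first s then lower s (z2 s) else lower s (z1 s), exit_ pl (iL s))].
  move=> a; rewrite (@mem_arcs _ _ _ pl zs [:: iU s; iL s] (uI s) erefl a).
  rewrite -[flatten _]/(strand_arcs pl zs (iU s) ++ strand_arcs pl zs (iL s) ++ [::]) cats0.
  rewrite mem_cat (strand_arcs2 pl (erefl (zs (iU s)))) (strand_arcs2 pl (erefl (zs (iL s)))).
  have [-> -> -> ->] := zE s; rewrite /first -mem_cat.
  case: (forwards pl (iU s)); case: (forwards pl (iL s)); exact: erefl.
have us s : uniq [:: entry pl (iU s); entry pl (iL s); exit_ pl (iU s); exit_ pl (iL s);
    upper s (z1 s); upper s (z2 s); lower s (z1 s); lower s (z2 s)].
  exact: (tangle_uniq_upper_lower s t (entry_exit ok) (uI s) (CC' s)).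
have uC s : uniq (points [:: z1 s; z2 s]).
  by rewrite -(perm_uniq (points_perm (CC' s))); exact: (tangle_inner_uniq t).
have fC s j : exit_ pl j \notin points [:: z1 s; z2 s].
  by rewrite -(perm_mem (points_perm (CC' s))); exact: (tangle_passive t (tangle_fP t j)).
rewrite (Zbar_identity ok sh sh' out same erefl erefl erefl zs_sorted zsE).
  have det1 s : tangle_det (inner_crossings D' pl P') (arcs pl zs) s = 1.
    rewrite (tangle_det_perm s (CC' s) (fun=> erefl)).
    exact: (bigon_det xvar_neq0 yvar_neq0 (uC s) (fC s) (us s) (signs s) (GE s)).
  by rewrite !det1 !mulr1.
move=> s; apply: (transfer_perm (_ : perm_eq [:: z1 s; z2 s] _) (fun _ => erefl)).
  by rewrite perm_sym.
exact: (bigon_transfer xvar_neq0 yvar_neq0 (uC s) (fC s) (us s) (uI s) (signs s) (GE s)).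
Qed.

End Bigon.

(** * The third Reidemeister move *)

Section Three.
Implicit Types (i j k : 'I_3) (ht : 'S_3).

Lemma ord3P (Q : 'I_3 -> Prop) : Q s3_0 -> Q s3_1 -> Q s3_2 -> forall i, Q i.
Proof.
move=> Q0 Q1 Q2 [[|[|[|//]]] p].
- by rewrite (_ : Ordinal p = s3_0) //; apply: val_inj.
- by rewrite (_ : Ordinal p = s3_1) //; apply: val_inj.
- by rewrite (_ : Ordinal p = s3_2) //; apply: val_inj.
Qed.

Lemma height_order ht : exists L M H, [/\ uniq [:: L; M; H], (ht L < ht M)%N & (ht M < ht H)%N].
Proof.
exists (ht^-1%g s3_0), (ht^-1%g s3_1), (ht^-1%g s3_2).
by rewrite !permKV /= !inE !(inj_eq perm_inj).
Qed.

Lemma sort_by_height (T : eqType) (cr : 'I_3 -> 'I_3 -> T) ht L M H :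
  uniq [:: L; M; H] -> (ht L < ht M)%N -> (ht M < ht H)%N ->
  perm_eq [seq if (ht a.2 < ht a.1)%N then cr a.1 a.2 else cr a.2 a.1
            | a <- [:: (s3_0, s3_1); (s3_0, s3_2); (s3_1, s3_2)]]
    [:: cr M L; cr H L; cr H M].
Proof.
move=> u LM MH; have LH := ltn_trans LM MH.
have F i j : (ht i < ht j)%N -> (ht j < ht i)%N = false.
  by move=> ij; apply/negbTE; rewrite -leqNgt ltnW.
have [ML HM HL] := And3 (F _ _ LM) (F _ _ MH) (F _ _ LH).
have p1 (x y z : T) : perm_eq [:: x; y; z] [:: y; x; z] by exact/permPl/(perm_catCA [:: x] [:: y]).
have p2 (x y z : T) : perm_eq [:: x; y; z] [:: x; z; y].
  by rewrite perm_cons; exact/permPl/(perm_catC [:: y] [:: z]).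
move: L M H u LM MH LH ML HM HL.
by elim/ord3P; elim/ord3P; elim/ord3P => // _ LM MH LH ML HM HL;
  rewrite /= ?LM ?MH ?LH ?ML ?HM ?HL // perm_sym ?p1 ?p2 //;
  [ apply: perm_trans (p1 _ _ _) _; rewrite p2 | apply: perm_trans (p2 _ _ _) _; rewrite p1
  | apply: perm_trans (p1 _ _ _) _; apply: perm_trans (p2 _ _ _) _; rewrite p1 ].
Qed.

(* At its crossing with the strand i of triangle_strands s, for s = 1 as for
   s = -1, the strand j goes to the left of i. *)
Definition turns_left i j : bool := (val j == 0)%N || (val i == 1)%N.
(* For s = 1 the strand i of triangle_strands s meets j after the third strand;
   for s = -1 the order is the opposite one. *)
Definition meets_later i j : bool := (val j == 0)%N || ((val i == 0)%N && (val j == 2)%N).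

(** The sign of the crossing whose upper strand on the sheet b is i. For b = true the over strand is
    j, and exchanging two distinct strands negates [turns_left]. *)
Definition triangle_sign (fwd : 'I_3 -> bool) (b : bool) i j : bool :=
  (turns_left i j (+) b) == (fwd i == fwd j).
Definition meets_first (fwd : 'I_3 -> bool) (t : bool) i j : bool :=
  (t (+) meets_later i j) == fwd i.

Lemma meets_firstN fwd t i j : meets_first fwd (~~ t) i j = ~~ meets_first fwd t i j.
Proof. by rewrite /meets_first addNb; case: (_ (+) _); case: (fwd i). Qed.

(** The relations between signs and orders required by [out_flip]; this is where the planar position
    of the three strands enters. *)
Lemma triangle_sign_flip fwd t b B M T : uniq [:: B; M; T] ->
  triangle_sign fwd b M B (+) triangle_sign fwd b T B =
    ~~ (meets_first fwd t T M (+) meets_first fwd t M B) /\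
  triangle_sign fwd b T B (+) triangle_sign fwd b T M =
    meets_first fwd t B M (+) meets_first fwd t M B.
Proof.
move: B M T; elim/ord3P; elim/ord3P; elim/ord3P => // _;
  rewrite /triangle_sign /meets_first /turns_left /meets_later /=;
  by case: (fwd s3_0); case: (fwd s3_1); case: (fwd s3_2); case: t; case: b.
Qed.

End Three.

Section Triangle.
Variables (R : realType) (m : nat).
Local Notation h := (onehalf R).

Section Picture.
Variables (D : diagram R m) (pl : placement R m 3) (ht : 'S_3) (s : R) (t : bool).
Variables (rc : seq (cpoint R m * cpoint R m)) (bs : seq (cpoint R m)).
Let P := Picture (triangle_strands s) (triangle_crossings ht s) [::].
Hypothesis st : s = if t then 1 else -1.
Hypothesis ok : placement_ok pl.
Hypothesis sh : shows D pl P rc bs.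
Hypothesis out : (forall z, z \in rc -> ~ covered pl z.1 /\ ~ covered pl z.2) /\
  (forall p, p \in bs -> ~ covered pl p).
Implicit Types i j k : 'I_3.
Let fwd := forwards pl.

(** For distinct strands the sum i + j determines the pair, and the parameter of a crossing is the
    same on both strands. *)
Definition meeting_time (s : R) i j : R :=
  match (i + j)%N with 1 => 0 | 2 => s * h | _ => - (s * h) end.
Local Notation par := (meeting_time s).

Definition meeting_times j : seq R :=
  let: (i, k) := match val j with 0 => (s3_1, s3_2) | 1 => (s3_2, s3_0) | _ => (s3_1, s3_0) end in
  if t then [:: par j i; par j k] else [:: par j k; par j i].

Lemma meeting_timesE i j k : uniq [:: i; j; k] ->
  meeting_times i = if t (+) meets_later i j then [:: par i j; par i k] else [:: par i k; par i j].
Proof.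
move: i j k; elim/ord3P; elim/ord3P; elim/ord3P => // _;
  by rewrite /meeting_times /meets_later /=; case: (t).
Qed.

Lemma meeting_times_sorted j : path <%R (-1) (rcons (meeting_times j) 1).
Proof.
move: j; elim/ord3P; rewrite /meeting_times /meeting_time st /onehalf; case: (t);
  rewrite /= !andbT; apply/and3P; split; lra.
Qed.

Lemma mem_meeting_times z : (z \in pic_points P) = (z.2 \in meeting_times z.1).
Proof.
case: z => j u; rewrite /pic_points /= /triangle_crossings /meeting_times /meeting_time /crossing_of.
move: (0 : R) (s * h) (- (s * h)) => p q r.
case: (_ < _)%N; case: (_ < _)%N; case: (_ < _)%N; move: j; elim/ord3P; case: (t);
  rewrite !inE !xpair_eqE /= ?orbF //; exact: orbC.
Qed.

Definition triangle_slope (i : 'I_3) (u : R) : R :=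
  match val i with 0 => 1 | 1 => -1 | _ => s * (8 / 9) * (- 4 * u * (1 - u ^+ 2)) end.

Lemma derive1_triangle (i : 'I_3) u : derive1 (tnth (strands P) i) u = (1, triangle_slope i u).
Proof.
move: i; elim/ord3P.
- exact: (derive1_graph (is_derive_diagonal u)).
- exact: (derive1_graph (is_derive_opp u)).
have := derive1_graph (is_derive_affine_hump 0 (s * (8 / 9)) u).
rewrite (_ : (fun w => 0 + s * (8 / 9) * hump w : R^o) = (fun w => s * (8 / 9) * hump w)).
  by apply.
by apply/funext => w; rewrite add0r.
Qed.

Lemma triangle_turn i j : i != j ->
  det2 (1, triangle_slope i (par i j)) (1, triangle_slope j (par j i)) != 0 /\
  (0 < det2 (1, triangle_slope i (par i j)) (1, triangle_slope j (par j i))) = turns_left i j.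
Proof.
have E a b : @det2 R (1, a) (1, b) = b - a by rewrite /det2 /= mul1r mulr1.
have pos (v : R) : 0 < v -> v != 0 /\ (0 < v) = true by move=> v0; rewrite v0 gt_eqF.
have neg (v : R) : v < 0 -> v != 0 /\ (0 < v) = false by move=> v0; rewrite lt_eqF // lt_gtF.
(* Since s is 1 or -1, the slope of the arc at the parameter s u does not depend on s; hence both
   pictures turn the same way. *)
have s2 u : s * (8 / 9) * (- 4 * (s * u) * (1 - (s * u) ^+ 2)) = 8 / 9 * (- 4 * u * (1 - u ^+ 2)).
  by rewrite st; case: (t); ring.
have s2' u : s * (8 / 9) * (- 4 * - (s * u) * (1 - (- (s * u)) ^+ 2)) = 8 / 9 * (4 * u * (1 - u ^+ 2)).
  by rewrite st; case: (t); ring.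
move: pos neg i j => pos neg; elim/ord3P; elim/ord3P => // _; rewrite E /triangle_slope /turns_left /meeting_time /=;
  rewrite ?s2 ?s2' /onehalf; clear s2 s2'; first [apply: pos; lra | apply: neg; lra].
Qed.

Lemma meeting_time_range i j : -1 < par i j < 1.
Proof.
rewrite /meeting_time st /onehalf; case: (_ + _)%N => [|[|[|_]]]; case: (t);
  apply/andP; split; lra.
Qed.

Let pt i j := place pl (i, par i j).
Let meeting i j := signed D (pt i j, pt j i).

Lemma meeting_sign i j : i != j -> (meeting i j).2 = triangle_sign fwd false i j.
Proof.
move=> ij; have [n0 tE] := triangle_turn ij.
have di := derive1_triangle i (par i j); have dj := derive1_triangle j (par j i).
rewrite /triangle_sign addbF -tE.
exact: (sign_place ok sh (z := (i, par i j)) (w := (j, par j i))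
  (meeting_time_range i j) (meeting_time_range j i) di dj n0).
Qed.

Lemma triangle_inner L M H : uniq [:: L; M; H] -> (ht L < ht M)%N -> (ht M < ht H)%N ->
  perm_eq (inner_crossings D pl P) [:: meeting M L; meeting H L; meeting H M].
Proof.
move=> u LM MH; have := sort_by_height meeting u LM MH.
rewrite /inner_crossings /placed_crossings /= /triangle_crossings /crossing_of.
by case: (_ < _)%N; case: (_ < _)%N; case: (_ < _)%N.
Qed.

Lemma strand_arcs_triangle i j k : uniq [:: i; j; k] ->
  strand_arcs pl meeting_times i =i
    if meets_first fwd t i j
    then [:: (entry pl i, pt i j); (pt i j, pt i k); (pt i k, exit_ pl i)]
    else [:: (entry pl i, pt i k); (pt i k, pt i j); (pt i j, exit_ pl i)].
Proof.
move=> u a; have := meeting_timesE u; rewrite /meets_first; case: (t (+) _) => zE;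
  by rewrite (strand_arcs2 pl zE) -/fwd; case: (fwd i).
Qed.

(** On the second sheet the heights are reversed: B, M, T run from bottom to top as seen on the
    sheet b. *)
Lemma triangle_crossings_at b B M T : uniq [:: B; M; T] ->
  (if b then (ht T < ht M)%N && (ht M < ht B)%N else (ht B < ht M)%N && (ht M < ht T)%N) ->
  exists c : 'I_3 -> 'I_3 -> cpoint R m * cpoint R m * bool,
  perm_eq (inner_crossings D pl P) [:: c M B; c T B; c T M] /\
  forall i j, i != j -> [/\ upper b (c i j) = pt i j, lower b (c i j) = pt j i &
    (c i j).2 = triangle_sign fwd b i j].
Proof.
move=> u hts; exists (fun i j => if b then meeting j i else meeting i j); split.
  case: b hts => /andP[h1 h2]; last exact: triangle_inner.
  have u' : uniq [:: T; M; B] by move: u; rewrite -rev_uniq.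
  apply: perm_trans (triangle_inner u' h1 h2) _.
  by rewrite -(perm_rev [:: meeting M T; meeting B T; meeting B M]).
move=> i j ij; case: b {hts}; split.
- exact: erefl.
- exact: erefl.
- rewrite meeting_sign 1?eq_sym // /triangle_sign addbF addbT (eq_sym (fwd j)).
  by move: i j ij; elim/ord3P; elim/ord3P.
- exact: erefl.
- exact: erefl.
- exact: meeting_sign.
Qed.

Lemma triangle_picture b B M T : uniq [:: B; M; T] ->
  (if b then (ht T < ht M)%N && (ht M < ht B)%N else (ht B < ht M)%N && (ht M < ht T)%N) ->
  transfer xvar yvar (entry pl) (exit_ pl) (inner_crossings D pl P) (arcs pl meeting_times) b
    (triangle_values xvar yvar (triangle_sign fwd b M B) (triangle_sign fwd b T B)
      (triangle_sign fwd b T M) (meets_first fwd t B M) (meets_first fwd t M B)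
      (meets_first fwd t T M) B M T) /\
  tangle_det (inner_crossings D pl P) (arcs pl meeting_times) b =
    \prod_(e <- [:: triangle_sign fwd b M B; triangle_sign fwd b T B; triangle_sign fwd b T M])
      sign_power xvar e.
Proof.
move=> u hts; have [c [CC cE]] := triangle_crossings_at u hts.
have tg := shown_tangle ok sh out meeting_times_sorted mem_meeting_times.
have [MB TB TM] : [/\ M != B, T != B & T != M].
  move: u; rewrite /= !inE !negb_or (eq_sym B M) !(eq_sym _ T) andbT.
  by case/andP => /andP[-> ->] ->.
have [u1 l1 s1] := cE _ _ MB; have [u2 l2 s2] := cE _ _ TB; have [u3 l3 s3] := cE _ _ TM.
have uM : uniq [:: M; B; T].
  rewrite (perm_uniq (_ : perm_eq _ [:: B; M; T])) //.
  exact/permPl/(perm_catCA [:: M] [:: B] [:: T]).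
have uT : uniq [:: T; M; B] by move: u; rewrite -rev_uniq.
have uC : uniq (points [:: c M B; c T B; c T M]).
  by rewrite -(perm_uniq (points_perm CC)); exact: (tangle_inner_uniq tg).
have fC j : exit_ pl j \notin points [:: c M B; c T B; c T M].
  by rewrite -(perm_mem (points_perm CC)); exact: (tangle_passive tg (tangle_fP tg j)).
have us := tangle_uniq_upper_lower b tg (entry_exit ok) u CC.
rewrite -s1 -s2 -s3.
move: u1 l1 u2 l2 u3 l3 CC uC fC us {s1 s2 s3 cE}; move: (c M B) (c T B) (c T M) => z1 z2 z3.
move=> u1 l1 u2 l2 u3 l3 CC uC fC us.
have GE : arcs pl meeting_times =i
    (if meets_first fwd t B M
     then [:: (entry pl B, lower b z1); (lower b z1, lower b z2); (lower b z2, exit_ pl B)]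
     else [:: (entry pl B, lower b z2); (lower b z2, lower b z1); (lower b z1, exit_ pl B)]) ++
    (if meets_first fwd t M B
     then [:: (entry pl M, upper b z1); (upper b z1, lower b z3); (lower b z3, exit_ pl M)]
     else [:: (entry pl M, lower b z3); (lower b z3, upper b z1); (upper b z1, exit_ pl M)]) ++
    (if meets_first fwd t T M
     then [:: (entry pl T, upper b z3); (upper b z3, upper b z2); (upper b z2, exit_ pl T)]
     else [:: (entry pl T, upper b z2); (upper b z2, upper b z3); (upper b z3, exit_ pl T)]).
  move=> a; rewrite (@mem_arcs _ _ _ pl meeting_times [:: B; M; T] u erefl a).
  rewrite -[flatten _]/(strand_arcs pl meeting_times B ++ strand_arcs pl meeting_times M ++
    strand_arcs pl meeting_times T ++ [::]) cats0.
  rewrite mem_cat [in X in _ || X]mem_cat (strand_arcs_triangle u) (strand_arcs_triangle uM).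
  rewrite (strand_arcs_triangle uT) u1 l1 u2 l2 u3 l3 [RHS]mem_cat; congr (_ || _).
  by rewrite mem_cat.
split.
  apply: (transfer_perm (_ : perm_eq [:: z1; z2; z3] _) (fun=> erefl)).
    by rewrite perm_sym.
  exact: (triangle_transfer xvar_neq0 yvar_neq0 uC fC us u GE).
rewrite (tangle_det_perm b CC (fun=> erefl)) /tangle_det.
rewrite (triangle_det xvar_neq0 yvar_neq0 uC fC us GE).
by rewrite !big_cons !big_nil.
Qed.

End Picture.

Section Replacement.
Variables (D D' : diagram R m) (pl : placement R m 3) (ht : 'S_3).
Variables (rc : seq (cpoint R m * cpoint R m)) (bs : seq (cpoint R m)).
Let P := Picture (@triangle_strands R 1) (@triangle_crossings R ht 1) [::].
Let P' := Picture (@triangle_strands R (-1)) (@triangle_crossings R ht (-1)) [::].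
Hypothesis ok : placement_ok pl.
Hypothesis sh : shows D pl P rc bs.
Hypothesis sh' : shows D' pl P' rc bs.
Hypothesis out : (forall z, z \in rc -> ~ covered pl z.1 /\ ~ covered pl z.2) /\
  (forall p, p \in bs -> ~ covered pl p).
Hypothesis same : forall p, on_circle p -> ~ covered pl p -> at_point D' p = at_point D p.

Lemma Zbar_triangle : Zbar D' = Zbar D.
Proof.
have [L [M [H [u LM MH]]]] := height_order ht.
pose B b := if b then H else L; pose T b := if b then L else H.
have uB b : uniq [:: B b; M; T b].
  by case: b; rewrite //= /B /T; move: u; rewrite -rev_uniq.
have hts b : if b then (ht (T b) < ht M)%N && (ht M < ht (B b))%N
    else (ht (B b) < ht M)%N && (ht M < ht (T b))%N.
  by case: b; rewrite /B /T LM MH.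
have pic b := triangle_picture (t := true) erefl ok sh out (uB b) (hts b).
have pic' b := triangle_picture (t := false) erefl ok sh' out (uB b) (hts b).
pose fwd := forwards pl.
have tr b : transfer xvar yvar (entry pl) (exit_ pl) (inner_crossings D' pl P')
    (arcs pl (meeting_times (-1) false)) b
    (triangle_values xvar yvar (triangle_sign fwd b M (B b)) (triangle_sign fwd b (T b) (B b))
      (triangle_sign fwd b (T b) M) (meets_first fwd true (B b) M) (meets_first fwd true M (B b))
      (meets_first fwd true (T b) M) (B b) M (T b)).
  have [e1 e2] := triangle_sign_flip fwd true b (uB b).
  rewrite (_ : triangle_values _ _ _ _ _ _ _ _ _ _ _ =
    triangle_values xvar yvar (triangle_sign fwd b M (B b)) (triangle_sign fwd b (T b) (B b))
      (triangle_sign fwd b (T b) M) (meets_first fwd false (B b) M) (meets_first fwd false M (B b))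
      (meets_first fwd false (T b) M) (B b) M (T b)); first exact: (pic' b).1.
  apply/funext => i; apply/funext => j.
  (* Passing from t = true to t = false reverses all three orders and leaves the signs alone. *)
  rewrite (triangle_values_flip xvar_neq0 yvar_neq0 (B b) M (T b) i j e1 e2).
  by rewrite -!meets_firstN.
have sorted := meeting_times_sorted (s := 1) (t := true) erefl.
have sorted' := meeting_times_sorted (s := -1) (t := false) erefl.
have mem := @mem_meeting_times ht 1 true; have mem' := @mem_meeting_times ht (-1) false.
(* The inner determinants depend on the signs only, so they agree and can be cancelled. *)
have dE b := etrans (pic' b).2 (esym (pic b).2).
have sgn0 (e : bool) : sign_power xvar e != 0.
  by rewrite /sign_power; case: e; rewrite ?invr_eq0 xvar_neq0.
have nz b : tangle_det (inner_crossings D pl P) (arcs pl (meeting_times 1 true)) b != 0.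
  rewrite (pic b).2; move: (triangle_sign _ _ _ _) (triangle_sign _ _ _ _) (triangle_sign _ _ _ _).
  by move=> e1 e2 e3; rewrite !big_cons big_nil !mulf_neq0 ?oner_eq0 ?sgn0.
have cancel (a a' v w v' w' : ratfun) : a * (v' * w') = a' * (v * w) -> v' = v -> w' = w ->
    v != 0 -> w != 0 -> a' = a.
  move=> E Ev Ew v0 w0; rewrite Ev Ew in E; exact/esym/(mulIf (mulf_neq0 v0 w0) E).
exact: (cancel _ _ _ _ _ _ (Zbar_transfer ok sh sh' out same sorted mem erefl sorted' mem' erefl
  (fun b => (pic b).1) tr) (dE false) (dE true) (nz false) (nz true)).
Qed.

End Replacement.
End Triangle.

(** * The virtual and twisted moves, and the conclusion *)

Section Invariance.
Variables (R : realType) (m : nat).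
Local Notation h := (onehalf R).

Lemma det2_slopes (a b : R) : det2 (1, a) (1, b) = b - a.
Proof. by rewrite /det2 /= mul1r mulr1. Qed.

Lemma derive1_diagonals s : derive1 (tnth (triangle_strands s) s3_0) (0 : R) = (1, 1) /\
  derive1 (tnth (triangle_strands s) s3_1) (0 : R) = (1, -1).
Proof.
split; first exact: (derive1_graph (is_derive_diagonal 0)).
exact: (derive1_graph (is_derive_opp 0)).
Qed.

Lemma derive1_cross u : derive1 (tnth (@cross_strands R) s2_0) u = (1, 1) /\
  derive1 (tnth (@cross_strands R) s2_1) u = (1, - 1).
Proof.
split; first exact: (derive1_graph (is_derive_diagonal u)).
exact: (derive1_graph (is_derive_opp u)).
Qed.

(** [hump] is 1 at 0, so the slope of [wiggle] there is 1 - 16/9 = -7/9, opposite in sign to that of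
    the straight strand. This reversal compensates the exchange of over and under. *)
Lemma derive1_twisted0 : derive1 (tnth (@twisted_strands R) s2_0) 0 = (1, - (7 / 9)) /\
  derive1 (tnth (@twisted_strands R) s2_1) 0 = (1, 7 / 9).
Proof.
have w0 : 1 - 16 / 9 * hump (0 : R) + 0 * (16 / 9 * (4 * 0 * (1 - 0 ^+ 2))) = - (7 / 9).
  by rewrite /hump; field.
have dw := is_derive_wiggle (0 : R); rewrite w0 in dw.
split; first exact: (derive1_graph dw).
have dn := @is_deriveN _ _ _ (@wiggle R : R -> R^o) 0 1 _ dw.
by rewrite opprK in dn; exact: (derive1_graph dn).
Qed.

Section Replacement.
Variables (k : nat) (P P' : picture R k) (D D' : diagram R m) (pl : placement R m k).
Variables (rc : seq (cpoint R m * cpoint R m)) (bs : seq (cpoint R m)).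
Hypothesis ok : placement_ok pl.
Hypothesis sh : shows D pl P rc bs.
Hypothesis sh' : shows D' pl P' rc bs.

(** Both pictures share the speeds of the placement, so only the sense in which the slopes differ
    has to be compared. *)
Lemma same_sign z w z' w' (a b a' b' : R) :
  -1 < z.2 < 1 -> -1 < w.2 < 1 -> -1 < z'.2 < 1 -> -1 < w'.2 < 1 ->
  derive1 (tnth (strands P) z.1) z.2 = (1, a) -> derive1 (tnth (strands P) w.1) w.2 = (1, b) ->
  derive1 (tnth (strands P') z'.1) z'.2 = (1, a') ->
  derive1 (tnth (strands P') w'.1) w'.2 = (1, b') ->
  0 < (b - a) * (b' - a') ->
  (forwards pl z.1 == forwards pl w.1) = (forwards pl z'.1 == forwards pl w'.1) ->
  positive_crossing D' (place pl z', place pl w') = positive_crossing D (place pl z, place pl w).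
Proof.
move=> z1 w1 z1' w1' aE bE aE' bE' ab0 fE.
have [n n'] : b - a != 0 /\ b' - a' != 0.
  by have := gt_eqF ab0; rewrite mulf_eq0 => /negbT; rewrite negb_or => /andP.
rewrite -det2_slopes in n; rewrite -det2_slopes in n'.
rewrite (sign_place ok sh z1 w1 aE bE n) (sign_place ok sh' z1' w1' aE' bE' n') !det2_slopes fE.
congr (_ == _); apply/idP/idP => p; by rewrite ?(pmulr_lgt0 _ p) ?(pmulr_rgt0 _ p) in ab0.
Qed.

End Replacement.

Lemma Zbar_move k (P P' : picture R k) (D D' : diagram R m) : move_pictures P P' ->
  replaces P P' D D' -> exists n : int, Zbar D' = xvar ^ n * Zbar D.
Proof.
have same0 (E E' : diagram R m) : Zbar E' = Zbar E -> exists n : int, Zbar E' = xvar ^ n * Zbar E.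
  by move=> ->; exists 0; rewrite expr0z mul1r.
have half : 0 < h < 1 by exact: onehalf_gt0.
have half1 : -1 <= h <= 1 by have /andP[? ?] := half; apply/andP; split; lra.
have half2 : -1 <= - h <= 1 by have /andP[? ?] := half; apply/andP; split; lra.
have o0 : -1 < (0 : R) < 1 by apply/andP; split; lra.
move=> mv [pl [rc [bs []]]].
case: {k P P'} mv pl rc bs.
- move=> b pl rc bs ok sh sh' out same; exact: Zbar_kink ok sh sh' out same.
- move=> b pl rc bs ok sh sh' out same; apply: same0; exact: Zbar_bigon ok sh sh' out same.
- move=> ht pl rc bs ok sh sh' out same; apply: same0; exact: Zbar_triangle ok sh sh' out same.
- move=> pl rc bs ok sh sh' out same; apply: same0.
  exact: (Zbar_virtual ok sh sh' out same erefl (perm_refl _)).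
- move=> pl rc bs ok sh sh' out same; apply: same0.
  exact: (Zbar_virtual ok sh sh' out same erefl (perm_refl _)).
- move=> pl rc bs ok sh sh' out same; apply: same0.
  exact: (Zbar_virtual ok sh sh' out same erefl (perm_refl _)).
- move=> b pl rc bs ok sh sh' out same; apply: same0.
  apply: (Zbar_virtual ok sh sh' out same _ (perm_refl _)).
  have [a0 a1] := derive1_diagonals 1; have [b0 b1] := derive1_diagonals (-1).
  rewrite /inner_crossings /placed_crossings /= /crossing_of /signed; case: b sh sh' => sh sh'.
    have q : 0 < (-1 - 1) * (-1 - 1 : R) by lra.
    have E := same_sign ok sh sh' (z := (s3_0, 0)) (w := (s3_1, 0)) (z' := (s3_0, 0)) (w' := (s3_1, 0))
      o0 o0 o0 o0 a0 a1 b0 b1 q erefl.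
    by rewrite /= E.
  have q : 0 < (1 - -1) * (1 - -1 : R) by lra.
  have E := same_sign ok sh sh' (z := (s3_1, 0)) (w := (s3_0, 0)) (z' := (s3_1, 0)) (w' := (s3_0, 0))
    o0 o0 o0 o0 a1 a0 b1 b0 q erefl.
  by rewrite /= E.
- move=> pl rc bs ok sh sh' out same; apply: same0.
  exact: (Zbar_slide ok sh sh' out same erefl erefl erefl erefl half2 half1).
- move=> pl rc bs ok sh sh' out same; apply: same0.
  exact: (Zbar_cancel ok sh sh' out same erefl erefl erefl erefl half2 half1).
- move=> b pl rc bs ok sh sh' out same; apply: same0.
  have [a0 a1] := @derive1_cross 0; have [b0 b1] := derive1_twisted0.
  case: b sh sh' => sh sh'.
    (* Under slope minus over slope, before and after the exchange of the strands. *)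
    have q : 0 < (-1 - 1) * (- (7 / 9) - 7 / 9 : R) by lra.
    have E := same_sign ok sh sh' (z := (s2_0, 0)) (w := (s2_1, 0)) (z' := (s2_1, 0)) (w' := (s2_0, 0))
      o0 o0 o0 o0 a0 a1 b1 b0 q (eq_sym _ _).
    exact: (Zbar_switch ok sh sh' out same half (z := (s2_0, 0)) (w := (s2_1, 0)) erefl erefl isT
      erefl erefl (perm_refl _) erefl E).
  have q : 0 < (1 - -1) * (7 / 9 - - (7 / 9) : R) by lra.
  have E := same_sign ok sh sh' (z := (s2_1, 0)) (w := (s2_0, 0)) (z' := (s2_0, 0)) (w' := (s2_1, 0))
    o0 o0 o0 o0 a1 a0 b0 b1 q (eq_sym _ _).
  have barsE (T : eqType) (p q' r s : T) : perm_eq [:: p; q'; r; s] [:: r; s; p; q'].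
    exact/permPl/(perm_catC [:: p; q'] [:: r; s]).
  exact: (Zbar_switch ok sh sh' out same half (z := (s2_1, 0)) (w := (s2_0, 0)) erefl erefl isT
    erefl erefl (barsE _ _ _ _ _) erefl E).
Qed.

Lemma Zbar_equiv (D D' : diagram R m) : twisted_equiv D D' ->
  exists n : int, Zbar D' = xvar ^ n * Zbar D.
Proof.
elim=> {D D'} [D D' iso|k P P' D D' mv rep|D|D D' _ [n E]|D D' D'' _ [n E] _ [n' E']].
- by exists 0; rewrite expr0z mul1r (Zbar_isotopic iso).
- exact: Zbar_move mv rep.
- by exists 0; rewrite expr0z mul1r.
- by exists (- n); rewrite E mulrA -expfzDr ?xvar_neq0 // addNr expr0z mul1r.
- by exists (n' + n); rewrite E' E mulrA -expfzDr ?xvar_neq0.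
Qed.

End Invariance.

Theorem theorem2 (R : realType) (m : nat) (D D' : diagram R m) :
  four_valent D -> four_valent D' -> twisted_equiv D D' ->
  exists k : int, Ztilde D' = xvar ^ k * Ztilde D.
Proof.
move=> fD fD' /Zbar_equiv[k E]; exists k.
by rewrite -!Zbar_four_valent.
Qed.
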